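(* Let $n\ge1$, $1<p\le q<\infty$, $s_1,s_2\in(0,1)$, $\alpha\in(0,1]$, $C\ge0$, and let $\xi\in C^{0,\alpha}(B_2)$ be nonnegative. Suppose that $s_2q<ps_1+\alpha$. Let $u\in C(\bar B_2)\cap L^{p-1}_{s_1p}(\mathbb{R}^n)\cap L^{q-1}_{s_2q}(\mathbb{R}^n)$ be a viscosity solution to $$-C\le(-\Delta_p)^{s_1}u+\xi(x)(-\Delta_q)^{s_2}u\le C\quad\text{in }B_2.$$ Then $u\in C^{0,\gamma}(B_1)$ for any $0<\gamma<\gamma_\circ(s_1)=\min\{1,\frac{s_1p}{p-1}\}$. Furthermore, $u\in C^{0,\gamma_\circ(s_1)}(B_1)$, provided $\frac{s_1p}{p-1}\neq1$.
   Context: $B_r(x_0)$ is the open ball of radius $r$ centred at $x_0$ and $B_r=B_r(0)$. For $p>1$, $s\in(0,1)$, $(-\Delta_p)^su(x)=-(1-s)\,\mathrm{PV}\int_{\mathbb{R}^n}|u(y)-u(x)|^{p-2}(u(y)-u(x))\frac{dy}{|x-y|^{n+sp}}$, and $L^{p-1}_{sp}(\mathbb{R}^n)=\{v\in L^{p-1}_{\rm loc}(\mathbb{R}^n):\int_{\mathbb{R}^n}\frac{|v(z)|^{p-1}}{(1+|z|)^{n+sp}}dz<\infty\}$. Viscosity solutions. For an open set $D$ and $\eta\in C^2(D)$ let $N_\eta=\{x\in D:\nabla\eta(x)=0\}$, $d_\eta(x)=\mathrm{dist}(x,N_\eta)$, and let $C^2_\beta(D)$ be the set of $\eta\in C^2(D)$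 with $\sup_{x\in D\setminus N_\eta}\bigl[\frac{\min\{d_\eta(x),1\}^{\beta-1}}{|\nabla\eta(x)|}+\frac{|D^2\eta(x)|}{d_\eta(x)^{\beta-2}}\bigr]<\infty$. Let $\mathscr{M}v(x)=(-\Delta_p)^{s_1}v(x)+\xi(x)(-\Delta_q)^{s_2}v(x)$. A function $\eta\in C^2(B_r(x_0))$ is an admissible test function at $x_0$ if either (a) both $p>\frac{2}{2-s_1}$ and $q>\frac2{2-s_2}$, or $\nabla\eta(x_0)\ne0$; or (b) $p\le\frac2{2-s_1}$ or $q\le\frac{2}{2-s_2}$, $\nabla\eta(x_0)=0$, $x_0$ is an isolated critical point of $\eta$, and $\eta\in C^2_\beta(B_r(x_0))$ for some $\beta>\max\{\frac{s_1p}{p-1},\frac{s_2q}{q-1}\}$. A function $u\in C(\bar B_2)\cap L^{p-1}_{s_1p}(\mathbb{R}^n)\cap L^{q-1}_{s_2q}(\mathbb{R}^n)$ is a viscosity solution to $-C\le\mathscr{M}u\le C$ in $B_2$ if for every $B_r(x_0)\subset B_2$ and every admissible $\eta$ with $\eta(x_0)=u(x_0)$, with $\eta_r=\eta$ in $B_r(x_0)$ and $\eta_r=u$ elsewhere: if $\eta\ge u$ in $B_r(x_0)$ then $\mathscr{M}\eta_r(x_0)\le C$, and if $\eta\le u$ in $B_r(x_0)$ then $\mathscr{M}\eta_r(x_0)\ge-C$. *)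

(* Defs.v *)
From HB Require Import structures.
From mathcomp Require Import all_boot all_order all_algebra.
From mathcomp Require Import all_classical all_reals all_analysis.

Set Implicit Arguments.
Unset Strict Implicit.
Unset Printing Implicit Defensive.

Import Order.TTheory GRing.Theory Num.Theory.
Import numFieldNormedType.Exports.

Local Open Scope classical_set_scope.
Local Open Scope ring_scope.

(* The product sigma-algebra, which is the Borel sigma-algebra of ['rV[R]_n]. *)
Section measurable_rV.
Context {R : realType}.
Variable n : nat.

Definition coord_rV (i : 'I_n) (x : 'rV[R]_n) : R := x ord0 i.

Let rV_set0 : g_sigma_preimage coord_rV set0.
Proof. exact: sigma_algebra0. Qed.

Let rV_setC A : g_sigma_preimage coord_rV A -> g_sigma_preimage coord_rV (~` A).
Proof. exact: sigma_algebraC. Qed.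

Let rV_bigcup (F : _^nat) : (forall i, g_sigma_preimage coord_rV (F i)) ->
  g_sigma_preimage coord_rV (\bigcup_i (F i)).
Proof. exact: sigma_algebra_bigcup. Qed.

HB.instance Definition _ := @isMeasurable.Build default_measure_display
  'rV[R]_n (g_sigma_preimage coord_rV) rV_set0 rV_setC rV_bigcup.

End measurable_rV.

Lemma measurable_coord_rV (R : realType) n (i : 'I_n) :
  measurable_fun [set: 'rV[R]_n] (coord_rV i).
Proof.
move=> _ Y mY; rewrite setTI; apply: sub_sigma_algebra => /=.
rewrite -bigcup_seq/=; exists i => /=; first by rewrite mem_index_enum.
by exists Y => //; rewrite setTI.
Qed.

Lemma measurable_fun_rVP (R : realType) d (T : measurableType d) n
    (f : T -> 'rV[R]_n) :
  (forall i, measurable_fun [set: T] (coord_rV i \o f)) ->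
  measurable_fun [set: T] f.
Proof.
move=> mf.
suff prefS : g_sigma_preimage (fun i => coord_rV i \o f) `<=` measurable.
  move: prefS; rewrite g_sigma_preimage_comp => prefS.
  by move=> _ A mA; apply: prefS; exists A.
apply: smallest_sub; first exact: sigma_algebra_measurable.
case: n => [|n] in f mf *; first by rewrite big_ord0.
rewrite -bigcup_mkord_ord; apply: bigcup_sub => i Ii.
by move=> A [B mB <-]; exact: mf.
Qed.

Definition cons_rV (R : realType) n (z : measurableTypeR R * 'rV[R]_n) :
    'rV[R]_n.+1 :=
  \row_i oapp (fun j : 'I_n => z.2 ord0 j) (z.1 : R) (unlift ord0 i).

Definition uncons_rV (R : realType) n (x : 'rV[R]_n.+1) :
    measurableTypeR R * 'rV[R]_n :=
  (x ord0 ord0, \row_j x ord0 (lift ord0 j)).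

Lemma measurable_cons_rV (R : realType) n :
  measurable_fun setT (@cons_rV R n).
Proof.
apply: measurable_fun_rVP => i.
have -> : coord_rV i \o @cons_rV R n =
    fun z => oapp (fun j : 'I_n => z.2 ord0 j) (z.1 : R) (unlift ord0 i).
  by apply/funext => z; rewrite /coord_rV /= mxE.
case: (unlift ord0 i) => [j|] /=; last exact: measurable_fst.
exact: (measurableT_comp (measurable_coord_rV j) measurable_snd).
Qed.

Lemma measurable_uncons_rV (R : realType) n :
  measurable_fun setT (@uncons_rV R n).
Proof.
apply/measurable_fun_pairP; split => /=.
  exact: (measurable_coord_rV ord0).
apply: measurable_fun_rVP => j.
have -> : coord_rV j \o (snd \o @uncons_rV R n) = coord_rV (lift ord0 j).
  by apply/funext => x; rewrite /coord_rV /= mxE.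
exact: measurable_coord_rV.
Qed.

Lemma cons_rVK (R : realType) n : cancel (@cons_rV R n) (@uncons_rV R n).
Proof.
move=> [a v]; rewrite /uncons_rV /cons_rV; congr (_, _).
  by rewrite mxE unlift_none.
by apply/rowP => j; rewrite !mxE liftK.
Qed.

Section lebesgue_cons.
Context {R : realType} (n : nat) (m : {sigma_finite_measure set 'rV[R]_n -> \bar R}).

Definition lebesgue_cons : set 'rV[R]_n.+1 -> \bar R :=
  pushforward (@lebesgue_measure R \x m)%E (@cons_rV R n).

Let lebesgue_cons0 : lebesgue_cons set0 = 0%E.
Proof. by rewrite /lebesgue_cons /pushforward preimage_set0 measure0. Qed.

Let lebesgue_cons_ge0 A : (0 <= lebesgue_cons A)%E.
Proof. by rewrite /lebesgue_cons /pushforward measure_ge0. Qed.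

Let lebesgue_cons_sigma_additive : semi_sigma_additive lebesgue_cons.
Proof.
have mcons F : measurable F -> measurable (@cons_rV R n @^-1` F).
  by move=> mF; rewrite -[X in measurable X]setTI; exact: measurable_cons_rV.
move=> F mF tF mUF; rewrite /lebesgue_cons /pushforward preimage_bigcup.
apply: measure_semi_sigma_additive.
- by move=> k; exact: mcons.
- apply/trivIsetP => /= i j _ _ ij; rewrite -preimage_setI.
  by move/trivIsetP : tF => /(_ _ _ _ _ ij) ->//; rewrite preimage_set0.
- by rewrite -preimage_bigcup; exact: mcons.
Qed.

HB.instance Definition _ := isMeasure.Build _ _ _ lebesgue_cons
  lebesgue_cons0 lebesgue_cons_ge0 lebesgue_cons_sigma_additive.

Let lebesgue_cons_sigma_finite : sigma_finite setT lebesgue_cons.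
Proof.
have /sigma_finiteP[F [TF ndF Foo]] := sigma_finiteT (@lebesgue_measure R).
have /sigma_finiteP[G [TG ndG Goo]] := sigma_finiteT m.
exists (fun k => @uncons_rV R n @^-1` (F k `*` G k)).
  apply/esym; rewrite -subTset => x _.
  have [[k _ Fk] [l _ Gl]] : (\bigcup_i F i) (uncons_rV x).1 /\
      (\bigcup_i G i) (uncons_rV x).2 by rewrite -TF -TG.
  exists (maxn k l) => //; split => /=.
  - by move: Fk; exact/subsetPset/ndF/leq_maxl.
  - by move: Gl; exact/subsetPset/ndG/leq_maxr.
move=> k; have [mF Fk] := Foo k; have [mG Gk] := Goo k; split.
  rewrite -[X in measurable X]setTI; apply: measurable_uncons_rV => //.
  exact: measurableX.
rewrite /lebesgue_cons /pushforward -comp_preimage.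
rewrite (_ : _ \o _ = id); last by apply/funext => z; exact: cons_rVK.
by rewrite preimage_id product_measure1E// lte_mul_pinfty// ge0_fin_numE.
Qed.

HB.instance Definition _ := @Measure_isSigmaFinite.Build _ _ _
  lebesgue_cons lebesgue_cons_sigma_finite.

End lebesgue_cons.

Fixpoint lebesgue_rV (R : realType) (n : nat) :
    {sigma_finite_measure set 'rV[R]_n -> \bar R} :=
  if n is n'.+1 then lebesgue_cons (lebesgue_rV R n')
  else @dirac _ 'rV[R]_0 0 R.

Lemma measurable_box_rV (R : realType) n (A : 'I_n -> set (measurableTypeR R)) :
  (forall i, measurable (A i)) ->
  measurable [set x : 'rV[R]_n | forall i, A i (x ord0 i)].
Proof.
move=> mA; have -> : [set x : 'rV[R]_n | forall i, A i (x ord0 i)] =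
    \bigcap_(i in setT) (coord_rV i @^-1` A i).
  by apply/seteqP; split => [v Av i _|v Av i]; [exact: Av|exact: (Av i I)].
apply: fin_bigcap_measurable => [|i _]; first exact: finite_finset.
by rewrite -[X in measurable X]setTI; apply: measurable_coord_rV => //; exact: mA.
Qed.

Lemma lebesgue_rV_box (R : realType) n (A : 'I_n -> set (measurableTypeR R)) :
  (forall i, measurable (A i)) ->
  lebesgue_rV R n [set x | forall i, A i (x ord0 i)] =
  (\prod_(i < n) lebesgue_measure (A i))%E.
Proof.
elim: n => [|n IHn] in A *.
  move=> _; rewrite big_ord0 /= diracE mem_set //.
  by move=> [].
move=> mA; rewrite big_ord_recl -(IHn (A \o lift ord0)); last by move=> i; exact: mA.
rewrite /= /lebesgue_cons /pushforward -product_measure1E //.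
  congr (_ _); apply/seteqP; split => -[a v] /=.
  + move=> Aav; split; first by have := Aav ord0; rewrite mxE unlift_none.
    by move=> i; have := Aav (lift ord0 i); rewrite mxE liftK.
  + move=> [Aa Av] i; rewrite mxE.
    by case: unliftP => [j ->|->] //=; exact: Av.
by apply: (@measurable_box_rV R n (A \o lift ord0)) => i; exact: mA.
Qed.

(* The library norm on ['rV[R]_n] is the sup norm, whose topology is the
   Euclidean one; [enorm] is the Euclidean norm on ['rV[R]_n] and the Frobenius
   norm on square matrices. *)
Definition enorm (R : realType) m n (A : 'M[R]_(m, n)) : R :=
  Num.sqrt (\sum_i \sum_j A i j ^+ 2).

Definition eball (R : realType) n (x0 : 'rV[R]_n) (r : R) : set 'rV[R]_n :=
  [set x | enorm (x - x0) < r].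

Definition closed_eball (R : realType) n (x0 : 'rV[R]_n) (r : R) :
    set 'rV[R]_n :=
  [set x | enorm (x - x0) <= r].

(* Global Hoelder condition on [D]. It is used on balls only, where it forces
   boundedness, so that it is finiteness of the full [C^{0,a}(D)] norm. *)
Definition hoelder_on (R : realType) n (D : set 'rV[R]_n) (a : R)
    (f : 'rV[R]_n -> R) : Prop :=
  exists K : R, forall x y, D x -> D y ->
    `|f x - f y| <= K * enorm (x - y) `^ a.

(* The measurable sets of ['rV[R]_n] are the Borel sets; measurability for their
   Lebesgue completion is a.e. equality with a Borel function. The integral of
   the library, a supremum over simple Borel functions on nonnegative
   functions, agrees with the Lebesgue integral for such functions. *)
Definition Lebesgue_measurable_fun (R : realType) n (v : 'rV[R]_n -> R) : Prop :=
  exists2 w : 'rV[R]_n -> R, measurable_fun setT w &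
    {ae lebesgue_rV R n, forall x, v x = w x}.

Definition Lloc (R : realType) n (m : R) (v : 'rV[R]_n -> R) : Prop :=
  Lebesgue_measurable_fun v /\
  forall K : set 'rV[R]_n, compact K ->
    (\int[lebesgue_rV R n]_(x in K) (`|v x| `^ m)%:E < +oo)%E.

Definition Ltail (R : realType) n (p s : R) (v : 'rV[R]_n -> R) : Prop :=
  Lloc (p - 1) v /\
  (\int[lebesgue_rV R n]_x
     (`|v x| `^ (p - 1) / (1 + enorm x) `^ (n%:R + s * p))%:E < +oo)%E.

(* Extended-real valued, the principal value being the limit as [e] decreases
   to 0 of the integrals over the complements of the balls [B_e(x)]. *)
Definition frac_plaplacian (R : realType) n (p s : R) (v : 'rV[R]_n -> R)
    (x : 'rV[R]_n) : \bar R :=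
  (- ((1 - s)%:E *
      lim ((fun e : R => \int[lebesgue_rV R n]_(y in ~` eball x e)
        (`|v y - v x| `^ (p - 2) * (v y - v x)
           / enorm (x - y) `^ (n%:R + s * p))%:E) @ 0^'+)))%E.

Definition double_phase (R : realType) n (p q s1 s2 : R)
    (xi v : 'rV[R]_n -> R) (x : 'rV[R]_n) : \bar R :=
  (frac_plaplacian p s1 v x + (xi x)%:E * frac_plaplacian q s2 v x)%E.

Definition partial (R : realType) n (i : 'I_n) (f : 'rV[R]_n -> R) :
    'rV[R]_n -> R :=
  fun x => 'D_(delta_mx ord0 i) f x.

Definition grad (R : realType) n (f : 'rV[R]_n -> R) (x : 'rV[R]_n) :
    'rV[R]_n :=
  \row_i partial i f x.

Definition hessian (R : realType) n (f : 'rV[R]_n -> R) (x : 'rV[R]_n) :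
    'M[R]_n :=
  \matrix_(i, j) partial j (partial i f) x.

Definition C2_on (R : realType) n (D : set 'rV[R]_n) (f : 'rV[R]_n -> R) :
    Prop :=
  forall x, D x ->
    [/\ {for x, continuous f},
        forall i, derivable f x (delta_mx ord0 i) /\
                  {for x, continuous (partial i f)} &
        forall i j, derivable (partial i f) x (delta_mx ord0 j) /\
                    {for x, continuous (partial j (partial i f))}].

Definition crit_set (R : realType) n (D : set 'rV[R]_n) (f : 'rV[R]_n -> R) :
    set 'rV[R]_n :=
  [set x | D x /\ grad f x = 0].

(* As a real infimum this is 0, and not [+oo], when there is no critical point;
   below it only matters for [f] having one in [D]. *)
Definition crit_dist (R : realType) n (D : set 'rV[R]_n) (f : 'rV[R]_n -> R)
    (x : 'rV[R]_n) : R :=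
  inf [set enorm (x - z) | z in crit_set D f].

Definition C2beta_on (R : realType) n (D : set 'rV[R]_n) (b : R)
    (f : 'rV[R]_n -> R) : Prop :=
  C2_on D f /\
  has_ubound [set Num.min (crit_dist D f x) 1 `^ (b - 1) / enorm (grad f x)
                  + enorm (hessian f x) / crit_dist D f x `^ (b - 2)
             | x in D `\` crit_set D f].

Definition isolated_crit (R : realType) n (D : set 'rV[R]_n)
    (f : 'rV[R]_n -> R) (x0 : 'rV[R]_n) : Prop :=
  crit_set D f x0 /\
  exists2 e : R, 0 < e & crit_set D f `&` eball x0 e = [set x0].

Definition admissible (R : realType) n (p q s1 s2 : R) (x0 : 'rV[R]_n) (r : R)
    (f : 'rV[R]_n -> R) : Prop :=
  C2_on (eball x0 r) f /\
  ((p > 2 / (2 - s1) /\ q > 2 / (2 - s2) \/ grad f x0 <> 0) \/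
   [/\ p <= 2 / (2 - s1) \/ q <= 2 / (2 - s2),
       grad f x0 = 0,
       isolated_crit (eball x0 r) f x0 &
       exists2 b : R, b > Num.max (s1 * p / (p - 1)) (s2 * q / (q - 1)) &
                      C2beta_on (eball x0 r) b f]).

(* [patch u A f] is [f] on [A] and [u] elsewhere. *)
Definition viscosity_solution (R : realType) n (p q s1 s2 C : R)
    (xi u : 'rV[R]_n -> R) (D : set 'rV[R]_n) : Prop :=
  forall (x0 : 'rV[R]_n) (r : R) (f : 'rV[R]_n -> R),
    0 < r -> eball x0 r `<=` D ->
    admissible p q s1 s2 x0 r f -> f x0 = u x0 ->
    ((forall x, eball x0 r x -> u x <= f x) ->
       (double_phase p q s1 s2 xi (patch u (eball x0 r) f) x0 <= C%:E)%E) /\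
    ((forall x, eball x0 r x -> f x <= u x) ->
       ((- C)%:E <= double_phase p q s1 s2 xi (patch u (eball x0 r) f) x0)%E).

Definition gamma_circ (R : realType) (p s : R) : R :=
  Num.min 1 (s * p / (p - 1)).

(* Main.v *)
Require Import Defs.
From mathcomp Require Import all_boot all_order all_algebra.
From mathcomp Require Import all_classical all_reals all_analysis.
From mathcomp Require Import measurable_realfun.
From mathcomp Require Import ring lra.
Import Order.TTheory GRing.Theory Num.Theory.
Import numFieldNormedType.Exports.
Local Open Scope classical_set_scope.
Local Open Scope ring_scope.

(** The method is the doubling of variables of Ishii and Lions, iterated.

    Suppose that [u x - u y > L phi(|x - y|) + m |x - x0|^2] for some [x], [y] near
    [x0], where [phi t] is [t^ga] for [ga < 1] and [t - t^(1 + th) / 4] for [ga = 1].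
    At a maximum point of the difference of the two sides, [x] and [y] are distinct
    and [t = |x - y|] tends to 0 as [L] grows. There [u] is touched from above at
    [x], and from below at [y], by smooth functions with a nonzero gradient, so both
    are admissible for every [p] and [q] ([grad_test_bounds]). Write [Ap] and [Aq]
    for the two operators applied to [u] patched with these functions. Subtracting
    the viscosity inequalities gives

      [(Ap(x) - Ap(y)) + xi(x) (Aq(x) - Aq(y)) + (xi(x) - xi(y)) Aq(y) <= 2 C].

    Each operator is an integral over three regions of [z], once an odd function
    has been removed from the principal value ([frac_plaplacianE]). In the inner
    ball [|z| < c t^(1 + thp)] only the test functions matter, and they contribute
    at most a small multiple of [(L t^ga)^(p-1) t^(-s1 p)] for small [c]
    ([inner_bound], [inner_test]). In the far region everything is bounded
    ([tail_bound]). In between, maximality compares the increments of [u] at [x] and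
    at [y]: moving both points by [z] does not change the penalty, so
    [u (x + z) - u x <= u (y + z) - u y] up to the variation of the localization
    ([mid_pointwise]); and for [z] close to [y - x] the strict concavity of [phi]
    yields a gain of order [(L t^ga)^(p-1) t^(-s1 p)] in [Ap(x) - Ap(y)], up to
    powers of [t^th] ([gain_pointwise], [gain_value]). The sum is [operator_gap].

    The gain is [L^(p-1) t^(ga (p-1) - s1 p)], and does not vanish as [t] tends to 0
    because [ga <= s1 p / (p - 1)]. The difference of the [q]-operators obeys the
    same estimate and is multiplied by [xi(x) >= 0], hence does no harm. The
    coefficient term is of the order of [t^alpha (L t^ga)^(q-1) t^(-s2 q)]
    ([operator_abs]); as [L t^ga] is bounded by the oscillation of [u] and [p <= q],
    it is smaller than the gain because [s2 q < s1 p + alpha]. For large [L] this is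
    a contradiction ([no_doubling]), and [u] is Hoelder continuous of exponent [ga]
    ([hoelder_step]).

    The localization error and the size of the increments are controlled by the
    regularity already known, of exponent [g0]. It suffices that [g0] exceeds
    [ga - g] for a fixed [g > 0] ([exponents_lt1]), so finitely many steps lead from
    boundedness to any [ga < 1] with [ga <= s1 p / (p - 1)] ([hoelder_lt1]). If
    [s1 p / (p - 1) > 1], one more step with the second profile and [g0] close to 1
    gives the Lipschitz bound ([exponents_lipschitz], [hoelder_lipschitz]).

    The integrals are computed for Borel functions. As the operators ignore null
    sets ([frac_plaplacian_ae]), [u] may be replaced by a Borel function that equals
    [u] in the open ball and almost everywhere ([borel_version]). *)

Set Implicit Arguments.
Unset Strict Implicit.
Unset Printing Implicit Defensive.

(** * Euclidean norm and scalar product *)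

Section enorm.
Context {R : realType} {n : nat}.
Implicit Types x y z a : 'rV[R]_n.

Definition dotv a z : R := \sum_i a ord0 i * z ord0 i.

Lemma enormE x : enorm x = Num.sqrt (\sum_i x ord0 i ^+ 2).
Proof. by rewrite /enorm big_ord1. Qed.

Lemma enorm_ge0 x : 0 <= enorm x.
Proof. by rewrite enormE sqrtr_ge0. Qed.

Lemma sum_sqr_ge0 x : 0 <= \sum_i x ord0 i ^+ 2.
Proof. by apply: sumr_ge0 => i _; rewrite sqr_ge0. Qed.

Lemma enorm_sqr x : enorm x ^+ 2 = \sum_i x ord0 i ^+ 2.
Proof. by rewrite enormE sqr_sqrtr// sum_sqr_ge0. Qed.

Lemma dotvv x : dotv x x = enorm x ^+ 2.
Proof. by rewrite enorm_sqr; apply: eq_bigr => i _; rewrite expr2. Qed.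

Lemma dotvC x y : dotv x y = dotv y x.
Proof. by apply: eq_bigr => i _; rewrite mulrC. Qed.

Lemma dotvDr x y z : dotv x (y + z) = dotv x y + dotv x z.
Proof. by rewrite -big_split; apply: eq_bigr => i _; rewrite mxE mulrDr. Qed.

Lemma dotvNr x y : dotv x (- y) = - dotv x y.
Proof. by rewrite -sumrN; apply: eq_bigr => i _; rewrite mxE mulrN. Qed.

Lemma dotvZr k x y : dotv x (k *: y) = k * dotv x y.
Proof. by rewrite mulr_sumr; apply: eq_bigr => i _; rewrite mxE mulrCA. Qed.

Lemma dotvDl x y z : dotv (x + y) z = dotv x z + dotv y z.
Proof. by rewrite dotvC dotvDr dotvC (dotvC z y). Qed.

Lemma dotvNl x y : dotv (- x) y = - dotv x y.
Proof. by rewrite dotvC dotvNr dotvC. Qed.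

Lemma dotvZl k x y : dotv (k *: x) y = k * dotv x y.
Proof. by rewrite dotvC dotvZr dotvC. Qed.

Lemma enormD_sqr x y :
  enorm (x + y) ^+ 2 = enorm x ^+ 2 + 2 * dotv x y + enorm y ^+ 2.
Proof. by rewrite -!dotvv !dotvDl !dotvDr (dotvC y x); ring. Qed.

Lemma enormN x : enorm (- x) = enorm x.
Proof.
by rewrite !enormE; congr Num.sqrt; apply: eq_bigr => i _; rewrite mxE sqrrN.
Qed.

Lemma enormB x y : enorm (x - y) = enorm (y - x).
Proof. by rewrite -enormN opprB. Qed.

Lemma enormZ k x : enorm (k *: x) = `|k| * enorm x.
Proof.
rewrite !enormE -sqrtr_sqr -sqrtrM ?sqr_ge0// mulr_sumr; congr Num.sqrt.
by apply: eq_bigr => i _; rewrite mxE exprMn.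
Qed.

Lemma enorm0 : enorm (0 : 'rV[R]_n) = 0.
Proof. by rewrite enormE big1 ?sqrtr0// => i _; rewrite mxE expr0n. Qed.

Lemma ler_coord_enorm x i : `|x ord0 i| <= enorm x.
Proof.
rewrite enormE -sqrtr_sqr ler_wsqrtr// (bigD1 i)//= lerDl.
by apply: sumr_ge0 => j _; rewrite sqr_ge0.
Qed.

Lemma enorm_eq0 x : (enorm x == 0) = (x == 0).
Proof.
apply/eqP/eqP => [x0|->]; last exact: enorm0.
by apply/rowP => i; apply/eqP; rewrite mxE -normr_le0 -x0 ler_coord_enorm.
Qed.

Lemma enorm_gt0 x : (0 < enorm x) = (x != 0).
Proof. by rewrite lt_neqAle enorm_ge0 andbT eq_sym enorm_eq0. Qed.

Lemma dotv_le x y : `|dotv x y| <= enorm x * enorm y.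
Proof.
wlog: x / 0 <= dotv x y => [h|d0].
  have [/h//|/ltW d0] := leP 0 (dotv x y).
  by rewrite -normrN -dotvNl -(enormN x) h// dotvNl oppr_ge0.
rewrite ger0_norm//.
have [->|x0] := eqVneq x 0.
  by rewrite enorm0 mul0r /dotv big1// => i _; rewrite mxE mul0r.
have [->|y0] := eqVneq y 0.
  by rewrite enorm0 mulr0 /dotv big1// => i _; rewrite mxE mulr0.
have xy0 : 0 < enorm x * enorm y by rewrite mulr_gt0// enorm_gt0.
rewrite -(ler_pM2l xy0).
have := sqr_ge0 (enorm (enorm y *: x - enorm x *: y)).
rewrite enormD_sqr dotvNr enormN dotvZr dotvZl !enormZ !ger0_norm ?enorm_ge0//.
by nra.
Qed.

Lemma enormD x y : enorm (x + y) <= enorm x + enorm y.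
Proof.
rewrite -(@ler_pXn2r _ 2)// ?nnegrE ?addr_ge0 ?enorm_ge0//.
rewrite enormD_sqr; have := ler_norm (dotv x y); have := dotv_le x y; nra.
Qed.

Lemma enorm_ge_sub x y : enorm x - enorm y <= enorm (x + y).
Proof. by rewrite lerBlDr -[x in leLHS](addrK y) -(enormN y) enormD. Qed.

Lemma enorm_le_sum x : enorm x <= \sum_i `|x ord0 i|.
Proof.
rewrite enormE -(ger0_norm (_ : 0 <= \sum_i `|x ord0 i|)) ?sumr_ge0//.
rewrite -sqrtr_sqr ler_wsqrtr//.
have gen (s : seq 'I_n) :
    \sum_(i <- s) x ord0 i ^+ 2 <= (\sum_(i <- s) `|x ord0 i|) ^+ 2.
  elim: s => [|i s ih]; first by rewrite !big_nil expr0n.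
  rewrite !big_cons -[x ord0 i ^+ 2]real_normK ?num_real//.
  have : 0 <= \sum_(j <- s) `|x ord0 j| by apply: sumr_ge0.
  move: ih; set S1 := \sum_(j <- s) _; set S2 := \sum_(j <- s) _.
  have := normr_ge0 (x ord0 i); nra.
exact: gen.
Qed.

Lemma enorm_le_coord x (t : R) : (forall i, `|x ord0 i| <= t) ->
  enorm x <= n%:R * t.
Proof.
move=> xt; apply: (le_trans (enorm_le_sum x)).
apply: (@le_trans _ _ (\sum_(i < n) t)); first by apply: ler_sum => i _.
by rewrite sumr_const card_ord mulr_natl.
Qed.

End enorm.

Section measurability.
Context {R : realType} {n : nat}.

Lemma measurable_dotv d (T : measurableType d) (a : 'rV[R]_n)
    (f : T -> 'rV[R]_n) : measurable_fun setT f ->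
  measurable_fun setT (fun x => dotv a (f x)).
Proof.
move=> mf; apply: measurable_sum => i; apply: measurable_funM => //.
exact: (measurableT_comp (measurable_coord_rV i)).
Qed.

Lemma measurable_enorm d (T : measurableType d)
    (f : T -> 'rV[R]_n) : measurable_fun setT f ->
  measurable_fun setT (fun x => enorm (f x)).
Proof.
move=> mf; under eq_fun do rewrite enormE.
apply: (measurableT_comp (continuous_measurable_fun (@sqrt_continuous R))).
apply: measurable_sum => i; apply: measurable_funX.
exact: (measurableT_comp (measurable_coord_rV i)).
Qed.

End measurability.

(** * Invariance of Lebesgue measure under translations and reflections *)

Section affine_invariance.
Context {R : realType}.

Lemma measurable_affine1 (k v : R) :
  measurable_fun [set: measurableTypeR R]
    (fun x : measurableTypeR R => k * x + v : measurableTypeR R).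
Proof. by apply: measurable_funD => //; exact: measurable_funM. Qed.

Lemma measurable_affine_rV n (k : R) (v : 'rV[R]_n) :
  measurable_fun [set: 'rV[R]_n] (fun x : 'rV[R]_n => k *: x + v).
Proof.
apply: measurable_fun_rVP => i.
rewrite (_ : _ \o _ = fun x : 'rV[R]_n => k * coord_rV i x + v ord0 i).
  apply: measurable_funD => //; apply: measurable_funM => //.
  exact: measurable_coord_rV.
by apply/funext => x; rewrite /coord_rV /= !mxE.
Qed.

Lemma lebesgue_measure_affine (k v : R) (A : set (measurableTypeR R)) :
  k ^+ 2 = 1 -> measurable A ->
  lebesgue_measure ((fun x : measurableTypeR R => k * x + v) @^-1` A) =
  lebesgue_measure A.
Proof.
move=> /eqP; rewrite sqrf_eq1 => k1 mA; apply/esym.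
apply: (@lebesgue_measure_unique R (pushforward lebesgue_measure
  (fun x : measurableTypeR R => k * x + v : measurableTypeR R))) => //.
  exact: measurable_affine1.
move=> mf _ [[a b]] _ <- /=; rewrite /pushforward.
case/orP: k1 => /eqP ->.
  rewrite (_ : _ @^-1` _ = `]a - v, b - v]%classic).
    rewrite !lebesgue_measure_itv/= !lte_fin ltrD2r; case: ifP => // _.
    by rewrite -!EFinB; congr EFin; ring.
  apply/seteqP; split => x /=; rewrite !in_itv/= mul1r => /andP[h1 h2];
    apply/andP; split; lra.
rewrite (_ : _ @^-1` _ = `[v - b, v - a[%classic).
  rewrite !lebesgue_measure_itv/= !lte_fin ltrD2l ltrN2; case: ifP => // _.
  by rewrite -!EFinB; congr EFin; ring.
by apply/seteqP; split => x /=; rewrite !in_itv/= mulN1r => /andP[h1 h2];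
    apply/andP; split; lra.
Qed.

(** Fubini reduces the statement to [lebesgue_measure_affine] in each coordinate,
    by induction on the dimension. The two cases in use are [k = 1] and [k = -1]. *)
Lemma lebesgue_rV_affine n (k : R) (v : 'rV[R]_n) (A : set 'rV[R]_n) :
  k ^+ 2 = 1 -> measurable A ->
  lebesgue_rV R n ((fun x : 'rV[R]_n => k *: x + v) @^-1` A) = lebesgue_rV R n A.
Proof.
move=> k1; elim: n => [|n IHn] in v A *.
  move=> _; congr (lebesgue_rV R 0 _); apply/seteqP.
  by split => x /=; rewrite (_ : k *: x + v = x)//; apply/rowP => -[].
move=> mA; rewrite /= /lebesgue_cons /pushforward -comp_preimage.
pose v' : 'rV[R]_n := \row_j v ord0 (lift ord0 j).
pose T := fun z : measurableTypeR R * 'rV[R]_n =>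
  ((k * z.1 + v ord0 ord0 : measurableTypeR R), k *: z.2 + v').
have mT : measurable_fun setT T.
  apply/measurable_fun_pairP; split => /=.
    exact: (measurableT_comp (measurable_affine1 k (v ord0 ord0)) measurable_fst).
  exact: (measurableT_comp (measurable_affine_rV k v') measurable_snd).
rewrite (_ : _ @^-1` A = T @^-1` (@cons_rV R n @^-1` A)); last first.
  rewrite -[RHS]comp_preimage; congr (_ @^-1` A); apply/funext => -[a w] /=.
  apply/rowP => i; rewrite /cons_rV !mxE /=.
  by case: unliftP => [j ->|->] /=; rewrite ?mxE.
have mcA : measurable (@cons_rV R n @^-1` A).
  by rewrite -[X in measurable X]setTI; exact: measurable_cons_rV.
have := @product_measure_unique _ _ _ _ R lebesgue_measure (lebesgue_rV R n)
  (pushforward (lebesgue_measure \x lebesgue_rV R n)%E T).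
move=> /(_ mT) h; rewrite [RHS]h//.
move=> B D mB mD; rewrite /= /pushforward.
rewrite (_ : T @^-1` _ =
    ((fun x : measurableTypeR R => k * x + v ord0 ord0) @^-1` B) `*`
    ((fun x : 'rV[R]_n => k *: x + v') @^-1` D)); last by apply/seteqP; split => -[x y] [? ?]; split.
have mB' : measurable ((fun x : measurableTypeR R => k * x + v ord0 ord0) @^-1` B).
  by rewrite -[X in measurable X]setTI; exact: measurable_affine1.
have mD' : measurable ((fun x : 'rV[R]_n => k *: x + v') @^-1` D).
  by rewrite -[X in measurable X]setTI; exact: measurable_affine_rV.
rewrite product_measure1E//; congr (_ * _)%E; last exact: IHn.
exact: lebesgue_measure_affine.
Qed.

Lemma ge0_integral_affine n (k : R) (v : 'rV[R]_n) (f : 'rV[R]_n -> \bar R) D :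
  k ^+ 2 = 1 -> measurable D -> measurable_fun D f ->
  (forall x, D x -> (0 <= f x)%E) ->
  (\int[lebesgue_rV R n]_(y in D) f y =
   \int[lebesgue_rV R n]_(x in (fun x : 'rV[R]_n => k *: x + v)%R @^-1` D) f (k *: x + v)%R)%E.
Proof.
move=> k1 mD mf f0.
rewrite -(@ge0_integral_pushforward _ _ _ _ R (fun x : 'rV[R]_n => k *: x + v)
  (measurable_affine_rV k v) (lebesgue_rV R n) D f)//.
  apply: eq_measure_integral => [|mT A mA _]; first exact: measurable_affine_rV.
  by apply/esym; exact: lebesgue_rV_affine.
by move=> y; rewrite inE; exact: f0.
Qed.

Lemma integral_affine n (k : R) (v : 'rV[R]_n) (f : 'rV[R]_n -> \bar R) D :
  k ^+ 2 = 1 -> measurable D -> measurable_fun setT f ->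
  (\int[lebesgue_rV R n]_(y in D) f y =
   \int[lebesgue_rV R n]_(x in (fun x : 'rV[R]_n => k *: x + v)%R @^-1` D) f (k *: x + v)%R)%E.
Proof.
move=> k1 mD mf; rewrite [LHS]integralE [RHS]integralE; congr (_ - _)%E.
  rewrite (ge0_integral_affine v k1)//; last exact/measurable_funepos/measurable_funTS.
  by apply: eq_integral => x _; rewrite !funeposE.
rewrite (ge0_integral_affine v k1)//; last exact/measurable_funeneg/measurable_funTS.
by apply: eq_integral => x _; rewrite !funenegE.
Qed.

End affine_invariance.

(** * Volumes of balls, boxes and slabs *)

Section volumes.
Context {R : realType}.

Lemma measurable_eball n (x0 : 'rV[R]_n) (r : R) : measurable (eball x0 r).
Proof.
have mf : measurable_fun [set: 'rV[R]_n] (fun x : 'rV[R]_n => enorm (x - x0)).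
  apply: measurable_enorm.
  rewrite (_ : (fun x => _) = (fun x : 'rV[R]_n => 1 *: x + (- x0)%R)).
    exact: measurable_affine_rV.
  by apply/funext => x; rewrite scale1r.
rewrite (_ : eball x0 r = setT `&`
    (fun x => enorm (x - x0)) @^-1` `]-oo, r[%classic).
  exact: mf.
by apply/seteqP; split => x /=; rewrite in_itv/= /eball /=; [split|case].
Qed.

Lemma lebesgue_closed_itv (c r : R) : 0 <= r ->
  lebesgue_measure [set x : measurableTypeR R | `|x - c| <= r] = (2 * r)%:E.
Proof.
move=> r0; rewrite (_ : [set x | _] = `[c - r, c + r]%classic).
  rewrite lebesgue_measure_itv/= lte_fin.
  case: ltP => h; first by rewrite -EFinB; congr EFin; ring.
  by congr EFin; lra.
by apply/seteqP; split => x /=; rewrite in_itv/= ler_norml => /andP[h1 h2];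
  apply/andP; split; lra.
Qed.

Lemma measurable_closed_itv (c r : R) :
  measurable [set x : measurableTypeR R | `|x - c| <= r].
Proof.
rewrite (_ : [set x | _] = `[c - r, c + r]%classic); first exact: measurable_itv.
by apply/seteqP; split => x /=; rewrite in_itv/= ler_norml => /andP[h1 h2];
  apply/andP; split; lra.
Qed.

Definition box n (c : 'rV[R]_n) (r : R) : set 'rV[R]_n :=
  [set x | forall i, `|x ord0 i - c ord0 i| <= r].

Lemma measurable_box n (c : 'rV[R]_n) (r : R) : measurable (box c r).
Proof.
apply: (@measurable_box_rV R n (fun i => [set x | `|x - c ord0 i| <= r])) => i.
exact: measurable_closed_itv.
Qed.

Lemma box_volume n (c : 'rV[R]_n) (r : R) : 0 <= r ->
  lebesgue_rV R n (box c r) = ((2 * r) ^+ n)%:E.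
Proof.
move=> r0.
rewrite (@lebesgue_rV_box R n (fun i => [set x | `|x - c ord0 i| <= r])).
  under eq_bigr do rewrite lebesgue_closed_itv//.
  by rewrite prodEFin prodr_const card_ord.
by move=> i; exact: measurable_closed_itv.
Qed.

Lemma eball_volume_le n (x0 : 'rV[R]_n) (r : R) : 0 <= r ->
  (lebesgue_rV R n (eball x0 r) <= ((2 * r) ^+ n)%:E)%E.
Proof.
move=> r0; rewrite -(box_volume x0 r0); apply: le_measure.
- by rewrite inE; exact: measurable_eball.
- by rewrite inE; exact: measurable_box.
move=> x xr i; have := ler_coord_enorm (x - x0) i.
by rewrite !mxE => /le_trans; apply; exact: ltW.
Qed.

Lemma box_sub_eball n (c : 'rV[R]_n) (r : R) : (0 < n)%N -> 0 < r ->
  box c (r / (2 * n%:R)) `<=` eball c r.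
Proof.
move=> n0 r0 x xc; rewrite /eball /=.
apply: (le_lt_trans (enorm_le_sum _)).
apply: (@le_lt_trans _ _ (\sum_(i < n) (r / (2 * n%:R)))).
  by apply: ler_sum => i _; have := xc i; rewrite !mxE.
have n0' : (0 : R) < n%:R by rewrite ltr0n.
rewrite sumr_const card_ord -[X in X < _]mulr_natr.
have -> : r / (2 * n%:R) * n%:R = r / 2 by field; rewrite gt_eqF.
by rewrite ltr_pdivrMr// ltr_pMr// ltr1n.
Qed.

Section sections.
Local Open Scope ereal_scope.
Context d1 d2 (T1 : measurableType d1) (T2 : measurableType d2).
Variables (m1 : {sigma_finite_measure set T1 -> \bar R})
          (m2 : {sigma_finite_measure set T2 -> \bar R}).

Lemma product_measure_le_xsection (A : set (T1 * T2)) (B : set T1) (c : R) :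
  measurable A -> measurable B -> (0 <= c)%R ->
  (forall x, B x -> m2 (xsection A x) <= c%:E) ->
  (forall x, ~ B x -> xsection A x = set0) ->
  (m1 \x m2) A <= c%:E * m1 B.
Proof.
move=> mA mB c0 hB hNB.
apply: (@le_trans _ _ (\int[m1]_x (c%:E * (\1_B x)%:E))).
  apply: ge0_le_integral => //.
  - exact: measurable_fun_xsection.
  - apply: emeasurable_funM => //.
    by apply/measurable_EFinP; exact: measurable_indic.
  - move=> x _; rewrite /= indicE; case: (boolP (x \in B)) => xB.
      by rewrite mule1; apply: hB; rewrite inE in xB.
    by rewrite mule0 hNB ?measure0//; rewrite notin_setE in xB.
rewrite ge0_integralZl//.
  by rewrite integral_indic// setIT.
by apply/measurable_EFinP; exact: measurable_indic.
Qed.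

Lemma product_measure_le_ysection (A : set (T1 * T2)) (B : set T2) (c : R) :
  measurable A -> measurable B -> (0 <= c)%R ->
  (forall y, B y -> m1 (ysection A y) <= c%:E) ->
  (forall y, ~ B y -> ysection A y = set0) ->
  (m1 \x m2) A <= c%:E * m2 B.
Proof.
move=> mA mB c0 hB hNB.
rewrite (_ : (m1 \x m2) A = (m1 \x^ m2) A); last first.
  apply: (@product_measure_unique _ _ _ _ R m1 m2 (m1 \x^ m2)) => //.
  by move=> X Y mX mY; exact: product_measure2E.
apply: (@le_trans _ _ (\int[m2]_y (c%:E * (\1_B y)%:E))).
  apply: ge0_le_integral => //.
  - exact: measurable_fun_ysection.
  - apply: emeasurable_funM => //.
    by apply/measurable_EFinP; exact: measurable_indic.
  - move=> x _; rewrite /= indicE; case: (boolP (x \in B)) => xB.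
      by rewrite mule1; apply: hB; rewrite inE in xB.
    by rewrite mule0 hNB ?measure0//; rewrite notin_setE in xB.
rewrite ge0_integralZl//.
  by rewrite integral_indic// setIT.
by apply/measurable_EFinP; exact: measurable_indic.
Qed.

End sections.

(** The part of a hyperplane layer of width [tau] inside a box. The shift [c] is
    there for the induction on the dimension. *)
Definition slab n (a : 'rV[R]_n) (c r tau : R) : set 'rV[R]_n :=
  box 0 r `&` [set x | `|dotv a x + c| <= tau].

Lemma measurable_slab n (a : 'rV[R]_n) (c r tau : R) :
  measurable (slab a c r tau).
Proof.
apply: measurableI; first exact: measurable_box.
have mf : measurable_fun [set: 'rV[R]_n] (fun x : 'rV[R]_n => dotv a x + c).
  by apply: measurable_funD => //; exact: measurable_dotv.
rewrite -[X in measurable X]setTI.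
have -> : [set x | `|dotv a x + c| <= tau] =
    (fun x : 'rV[R]_n => dotv a x + c) @^-1` [set y | `|y - 0| <= tau].
  by apply/seteqP; split => x /=; rewrite subr0.
by apply: mf => //; exact: measurable_closed_itv.
Qed.

Lemma dotv_recl n (a : 'rV[R]_n.+1) (z : measurableTypeR R * 'rV[R]_n) :
  dotv a (cons_rV z) =
  a ord0 ord0 * z.1 + dotv (\row_j a ord0 (lift ord0 j)) z.2.
Proof.
rewrite /dotv big_ord_recl /cons_rV !mxE unlift_none /=; congr (_ + _).
by apply: eq_bigr => i _; rewrite !mxE liftK.
Qed.

Lemma box_cons n (r : R) (z : measurableTypeR R * 'rV[R]_n) :
  box 0 r (cons_rV z) <-> `|z.1 - 0| <= r /\ box 0 r z.2.
Proof.
case: z => t w; split => /= [h|[h1 h2] i].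
  split; first by have := h ord0; rewrite !mxE unlift_none.
  by move=> i; have := h (lift ord0 i); rewrite !mxE liftK.
rewrite !mxE; case: unliftP => [j _|_] //=.
by have := h2 j; rewrite mxE.
Qed.

(** Fubini, integrating first along a coordinate [i] in which [a] does not vanish:
    each line in that direction meets the layer in a segment of half-length
    [tau / |a_i|]. The recursive construction of the measure only splits off the
    first coordinate, hence the induction and the two section lemmas. *)
Lemma slab_volume_le n (a : 'rV[R]_n) (i : 'I_n) (c r tau : R) :
  a ord0 i != 0 -> 0 <= r -> 0 <= tau ->
  (lebesgue_rV R n (slab a c r tau)
     <= ((2 * r) ^+ n.-1 * (2 * (tau / `|a ord0 i|)))%:E)%E.
Proof.
elim: n => [|n IHn] in a i c *; first by case: i.
move=> ai0 r0 t0; rewrite /= /lebesgue_cons /pushforward.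
have mA : measurable (@cons_rV R n @^-1` slab a c r tau).
  rewrite -[X in measurable X]setTI; apply: measurable_cons_rV => //.
  exact: measurable_slab.
have ta0 : 0 <= 2 * (tau / `|a ord0 i|) by rewrite mulr_ge0// divr_ge0.
have [j ij|i0] := unliftP ord0 i; last first.
  apply: (@le_trans _ _
      ((2 * (tau / `|a ord0 i|))%:E * lebesgue_rV R n (box 0 r))%E).
    apply: product_measure_le_ysection => //; first exact: measurable_box.
    - move=> w bw; rewrite -(@lebesgue_closed_itv
        (- (dotv (\row_j a ord0 (lift ord0 j)) w + c) / a ord0 i)
        (tau / `|a ord0 i|)) ?divr_ge0//.
      apply: le_measure.
      + by rewrite inE; exact: measurable_ysection.
      + by rewrite inE; exact: measurable_closed_itv.
      move=> t; rewrite /ysection /= inE => -[_] /=.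
      rewrite dotv_recl /= -i0 ler_pdivlMr ?normr_gt0// -normrM.
      rewrite mulrBl divfK// opprK.
      by rewrite (mulrC t) addrA.
    - move=> w nbw; apply/seteqP; split => // t.
      by rewrite /ysection /= inE => -[/box_cons[_ /nbw]].
  by rewrite box_volume// -EFinM lee_fin mulrC.
pose a' : 'rV[R]_n := \row_j a ord0 (lift ord0 j).
have a'j : a' ord0 j = a ord0 i by rewrite mxE ij.
apply: (@le_trans _ _ (((2 * r) ^+ n.-1 * (2 * (tau / `|a ord0 i|)))%:E *
    lebesgue_measure [set x : measurableTypeR R | (`|x - 0| <= r)%R])%E).
  apply: product_measure_le_xsection => //; first exact: measurable_closed_itv.
  - by rewrite mulr_ge0// exprn_ge0// mulr_ge0.
  - move=> t bt; rewrite -a'j.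
    apply: (le_trans _ (IHn a' j (a ord0 ord0 * t + c) _ r0 t0)); last by rewrite a'j.
    apply: le_measure.
    + by rewrite inE; exact: measurable_xsection.
    + by rewrite inE; exact: measurable_slab.
    move=> w; rewrite /xsection /= inE => -[/box_cons[_ bw]] /=.
    rewrite dotv_recl /= => h; split => //=; move: h.
    by rewrite (addrC (a ord0 ord0 * t)) addrA.
  - move=> t nbt; apply/seteqP; split => // w.
    by rewrite /xsection /= inE => -[/box_cons[/nbt]].
rewrite lebesgue_closed_itv// -EFinM lee_fin.
have n0 : (0 < n)%N by exact: leq_ltn_trans (ltn_ord j).
rewrite (_ : (2 * r) ^+ n.+1.-1 = 2 * r * (2 * r) ^+ n.-1).
  by rewrite le_eqVlt; apply/orP; left; apply/eqP; ring.
by rewrite -exprS prednK.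
Qed.

End volumes.

(** * Powers and summation over dyadic shells *)

Section powers.
Context {R : realType}.
Implicit Types x y a b : R.

Lemma powD x a b : 0 < x -> x `^ (a + b) = x `^ a * x `^ b.
Proof. by move=> x0; rewrite powRD//; apply/implyP => _; rewrite gt_eqF. Qed.

Lemma powB x a b : 0 < x -> x `^ (a - b) = x `^ a / x `^ b.
Proof. by move=> x0; rewrite powD// powRN. Qed.

Lemma powV x a : 0 <= x -> (x^-1) `^ a = x `^ (- a).
Proof. by move=> x0; rewrite -powR_inv1// -powRrM mulN1r. Qed.

Lemma ler_pow x y a : 0 <= a -> 0 <= x -> x <= y -> x `^ a <= y `^ a.
Proof.
by move=> a0 x0 xy; apply: ge0_ler_powR => //; rewrite nnegrE// (le_trans x0).
Qed.

Lemma ler_pow_neg x y a : a <= 0 -> 0 < x -> x <= y -> y `^ a <= x `^ a.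
Proof.
move=> a0 x0 xy; have y0 := lt_le_trans x0 xy.
rewrite -(opprK a) powRN [leRHS]powRN lef_pV2 ?posrE ?powR_gt0//.
by apply: ler_pow => //; [rewrite oppr_ge0|exact: ltW].
Qed.

(** On a dyadic shell a power is comparable to its value at the outer radius. *)
Lemma pow_dyadic_le x y b : 0 < y -> y / 2 <= x -> x <= y ->
  x `^ b <= 2 `^ `|b| * y `^ b.
Proof.
move=> y0 yx xy; have x0 : 0 < x by rewrite (lt_le_trans _ yx)// divr_gt0.
have [b0|/ltW b0] := leP 0 b.
  apply: (@le_trans _ _ (y `^ b)); first by rewrite ler_pow// ltW.
  rewrite ler_peMl ?powR_ge0//.
  by have := @ler_powR R 2 (ler1n _ 2) 0 `|b| (normr_ge0 b); rewrite powRr0.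
rewrite ler0_norm// (le_trans (ler_pow_neg b0 _ yx)) ?divr_gt0//.
by rewrite powRM ?invr_ge0 ?(ltW y0)// powV//; rewrite mulrC.
Qed.

Lemma pow2N_lt1 a : 0 < a -> 2 `^ (- a) < 1 :> R.
Proof.
move=> a0; rewrite powRN invf_lt1 ?powR_gt0//.
by have := @gt0_ltr_powR R a a0 1 2; rewrite powR1; apply; rewrite ?nnegrE// ltr1n.
Qed.

End powers.

Section dyadic.
Local Open Scope ereal_scope.
Context d (T : measurableType d) (R : realType).
Variable mu : {measure set T -> \bar R}.

Lemma nneseries_geometric_le (f : nat -> \bar R) (B q : R) :
  (forall k, 0 <= f k) -> (0 <= B)%R -> (0 <= q < 1)%R ->
  (forall k, f k <= (B * q ^+ k)%:E) ->
  \sum_(k <oo) f k <= (B / (1 - q))%:E.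
Proof.
move=> f0 B0 /andP[q0 q1] fB; apply: lime_le; first exact: is_cvg_nneseries.
apply: nearW => N; apply: (@le_trans _ _ (\sum_(0 <= k < N) (B * q ^+ k)%:E)).
  by apply: lee_sum => k _.
rewrite sumEFin lee_fin -mulr_sumr ler_wpM2l//.
rewrite -[leRHS]mul1r ler_pdivlMr ?subr_gt0//.
rewrite big_mkord mulrC.
have -> : ((1 - q) * \sum_(i < N) q ^+ i = 1 - q ^+ N)%R.
  by rewrite -[LHS]opprK -mulNr opprB -subrX1 opprB.
by rewrite lerBlDr lerDl exprn_ge0.
Qed.

(** Summation of a geometric series over the shells [T0 / 2^(k+1) < g <= T0 / 2^k].
    All the integrals of powers below, singular at a point or along a hyperplane,
    are bounded in this way from a volume estimate of the shells. *)
Lemma dyadic_integral_le (F : T -> \bar R) (g : T -> R) (A a T0 : R) :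
  (0 < a)%R -> (0 <= A)%R -> (0 < T0)%R ->
  measurable_fun setT F -> (forall x, 0 <= F x) -> measurable_fun setT g ->
  (forall tau : R, (0 < tau <= T0)%R ->
    \int[mu]_(x in [set x | (tau / 2 < g x <= tau)%R]) F x
      <= (A * tau `^ a)%:E) ->
  \int[mu]_(x in [set x | (0 < g x <= T0)%R]) F x
    <= (A * T0 `^ a / (1 - 2 `^ (- a)))%:E.
Proof.
move=> a0 A0 T00 mF F0 mg shell.
pose t k : R := (T0 * 2^-1 ^+ k)%R.
have t0 k : (0 < t k)%R by rewrite mulr_gt0// exprn_gt0// invr_gt0.
have tS k : t k.+1 = (t k / 2)%R by rewrite /t exprSr mulrA.
have tle k : (t k <= T0)%R.
  by rewrite /t ler_piMr ?(ltW T00)// exprn_ile1// ?invr_ge0// invf_le1// ler1n.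
have tanti k j : (k <= j)%N -> (t j <= t k)%R.
  move=> kj; rewrite /t ler_wpM2l ?(ltW T00)// ler_wiXn2l// ?invr_ge0//.
  by rewrite invf_le1// ler1n.
pose E k := [set x | (t k / 2 < g x <= t k)%R].
have mE (b c : R) : measurable [set x | (b < g x <= c)%R].
  rewrite (_ : [set x | _] = setT `&` g @^-1` `]b, c]%classic); first exact: mg.
  by apply/seteqP; split => x /=; rewrite in_itv/=; [split|case].
have -> : [set x | (0 < g x <= T0)%R] = \bigcup_k E k.
  apply/seteqP; split => [x /= /andP[gx gT]|x [k _] /= /andP[h1 h2]]; last first.
    rewrite (le_trans h2)// andbT (lt_trans _ h1)// divr_gt0//.
  have ex : exists k, (t k.+1 < g x)%R.
    exists (Num.truncn (T0 / g x)); rewrite /t.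
    have := truncnS_gt (T0 / g x); set m := Num.truncn _ => hm.
    have h2m : ((m.+1)%:R <= 2 ^+ m.+1 :> R)%R.
      by rewrite -natrX ler_nat ltnW// ltn_expl.
    rewrite exprVn ltr_pdivrMr ?exprn_gt0// mulrC.
    by rewrite -ltr_pdivrMr// (lt_le_trans hm).
  have [k hk hmin] := ex_minnP ex; exists k => //=; rewrite /E /= -tS hk /=.
  case: k hk hmin => [|k] hk hmin; first by rewrite /t expr0 mulr1.
  by rewrite leNgt; apply/negP => /hmin; rewrite ltnn.
rewrite ge0_integral_bigcup//.
- apply: nneseries_geometric_le.
  + by move=> k; apply: integral_ge0.
  + by rewrite mulr_ge0// powR_ge0.
  + by rewrite powR_ge0 pow2N_lt1.
  move=> k; apply: (le_trans (shell (t k) _)); first by rewrite t0 tle.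
  rewrite lee_fin -mulrA ler_wpM2l// /t powRM ?exprn_ge0 ?invr_ge0 ?(ltW T00)//.
  rewrite ler_wpM2l ?powR_ge0//.
  have h2 : (0 <= 2^-1 :> R)%R by rewrite invr_ge0.
  rewrite -(powR_mulrn k h2) -(powR_mulrn k (powR_ge0 2 (- a))) -!powRrM powV//.
  by rewrite (_ : (- (k%:R * a) = - a * k%:R)%R)//; ring.
- by move=> k; exact: mE.
- exact: measurable_funTS.
- move=> i j _ _ [x []] /= /andP[h1 h2] /andP[h3 h4].
  have [ij|ji|//] := ltngtP i j.
    by exfalso; have := tanti _ _ ij; rewrite tS; lra.
  by exfalso; have := tanti _ _ ji; rewrite tS; lra.
Qed.

End dyadic.

(** * Integrals of powers near zero and near infinity *)

Section integral_helpers.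
Local Open Scope ereal_scope.
Context d (T : measurableType d) (R : realType).
Variable mu : {measure set T -> \bar R}.

Lemma integral_le_cst (D : set T) (f : T -> R) (c : R) (v : \bar R) :
  measurable D -> (0 <= c)%R -> measurable_fun setT f ->
  (forall x, D x -> (0 <= f x <= c)%R) -> mu D <= v ->
  \int[mu]_(x in D) (f x)%:E <= c%:E * v.
Proof.
move=> mD c0 mf fc Dv; apply: (@le_trans _ _ (c%:E * mu D)); last first.
  by apply: lee_wpmul2l => //; rewrite lee_fin.
rewrite -integral_cst//; apply: ge0_le_integral => //.
- by move=> x /fc /andP[? ?]; rewrite lee_fin.
- by apply/measurable_EFinP; exact: measurable_funTS.
- by move=> x /fc /andP[? ?]; rewrite lee_fin.
Qed.

Lemma integral_support (D E : set T) (f : T -> \bar R) :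
  (forall x, D x -> ~ E x -> f x = 0) -> (forall x, E x -> D x) ->
  \int[mu]_(x in D) f x = \int[mu]_(x in E) f x.
Proof.
move=> f0 ED; rewrite integral_mkcond [RHS]integral_mkcond.
apply: eq_integral => x _; rewrite !patchE.
case: (boolP (x \in E)) => xE.
  by rewrite (mem_set (ED _ (set_mem xE))).
case: ifPn => // xD; apply: f0; first exact: set_mem.
by rewrite notin_setE in xE.
Qed.

End integral_helpers.

Section power_integrals.
Context {R : realType} {n : nat}.
Notation mu := (lebesgue_rV R n).

Lemma measurable_enorm1 : measurable_fun setT (fun z : 'rV[R]_n => enorm z).
Proof. exact: measurable_enorm. Qed.

Lemma measurable_enorm_pow b :
  measurable_fun setT (fun z : 'rV[R]_n => enorm z `^ b).
Proof. exact: (measurableT_comp (measurable_powR b) measurable_enorm1). Qed.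

Lemma measurable_dotv_pow (a : 'rV[R]_n) b :
  measurable_fun setT (fun z : 'rV[R]_n => `|dotv a z| `^ b).
Proof.
apply: (measurableT_comp (measurable_powR b)).
by apply: measurableT_comp => //; exact: measurable_dotv.
Qed.

Lemma measurable_preimage_itv d (T : measurableType d) (g : T -> R) (i : interval R) :
  measurable_fun setT g -> measurable [set x | g x \in i].
Proof.
move=> mg; rewrite (_ : [set x | _] = setT `&` g @^-1` [set` i]).
  by apply: mg => //; exact: measurable_itv.
by apply/seteqP; split => x /=; [split|case].
Qed.

Definition pball (rho : R) : set 'rV[R]_n := [set z | 0 < enorm z <= rho].

Lemma measurable_pball rho : measurable (pball rho).
Proof.
rewrite (_ : pball rho = [set z : 'rV[R]_n | enorm z \in `]0, rho]]).
  exact: measurable_preimage_itv measurable_enorm1.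
by apply/seteqP; split => x /=; rewrite in_itv.
Qed.

Lemma shell_volume_le (D : set 'rV[R]_n) (r : R) : 0 < r ->
  measurable D -> (forall z, D z -> enorm z <= r) ->
  (mu D <= ((4 * r) ^+ n)%:E)%E.
Proof.
move=> r0 mD Dr; apply: (@le_trans _ _ (mu (eball 0 (2 * r)))).
  apply: le_measure; rewrite ?inE//; first exact: measurable_eball.
  by move=> z /Dr zr; rewrite /eball /= subr0; lra.
have -> : 4 * r = 2 * (2 * r) by ring.
by apply: eball_volume_le; rewrite mulr_ge0// ltW.
Qed.

Lemma integral_power_near (e : R) : 0 < e ->
  exists2 C : R, 0 <= C & forall rho : R, 0 < rho ->
  (\int[mu]_(z in pball rho) (enorm z `^ (e - n%:R))%:E
     <= (C * rho `^ e)%:E)%E.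
Proof.
move=> e0; pose A : R := 2 `^ `|e - n%:R| * 4 ^+ n.
have A0 : 0 <= A by rewrite mulr_ge0 ?powR_ge0// exprn_ge0.
exists (A / (1 - 2 `^ (- e))).
  by rewrite divr_ge0// subr_ge0 ltW// pow2N_lt1.
move=> rho rho0; rewrite mulrAC.
apply: dyadic_integral_le => //.
- by apply/measurable_EFinP; exact: measurable_enorm_pow.
- by move=> x; rewrite lee_fin powR_ge0.
- exact: measurable_enorm1.
move=> tau /andP[tau0 _].
have mD : measurable [set x : 'rV[R]_n | tau / 2 < enorm x <= tau].
  rewrite (_ : [set x | _] = [set z : 'rV[R]_n | enorm z \in `]tau / 2, tau]]).
    exact: measurable_preimage_itv measurable_enorm1.
  by apply/seteqP; split => x /=; rewrite in_itv.
apply: le_trans.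
  apply: (@integral_le_cst _ _ _ mu _ _ (2 `^ `|e - n%:R| * tau `^ (e - n%:R))
    ((4 * tau) ^+ n)%:E) => //.
  - by rewrite mulr_ge0 ?powR_ge0.
  - exact: measurable_enorm_pow.
  - by move=> z /= /andP[z1 z2]; rewrite powR_ge0 pow_dyadic_le// ltW.
  - by apply: shell_volume_le => // z /= /andP[].
rewrite -EFinM lee_fin exprMn /A.
rewrite -(powR_mulrn n (ltW tau0)).
rewrite (_ : tau `^ e = tau `^ (e - n%:R) * tau `^ n%:R); last first.
  by rewrite -powD// subrK.
by rewrite le_eqVlt; apply/orP; left; apply/eqP; ring.
Qed.

Lemma integral_power_far (a : R) : 0 < a ->
  exists2 C : R, 0 <= C & forall r : R, 0 < r ->
  (\int[mu]_(z in [set z | (r <= enorm z)%R]) (enorm z `^ (- (n%:R + a)))%:E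
     <= (C * r `^ (- a))%:E)%E.
Proof.
move=> a0; pose A : R := 8 ^+ n.
have A0 : 0 <= A by rewrite exprn_ge0.
exists (A / (1 - 2 `^ (- a))).
  by rewrite divr_ge0// subr_ge0 ltW// pow2N_lt1.
move=> r r0; rewrite mulrAC -[r `^ _]powV ?(ltW r0)//.
have -> : [set z : 'rV[R]_n | (r <= enorm z)%R] =
    [set z : 'rV[R]_n | 0 < enorm z `^ (-1) <= r^-1].
  apply/seteqP; split => z /=; rewrite powR_inv1 ?enorm_ge0// invr_gt0.
    by move=> rz; rewrite (lt_le_trans r0 rz) lef_pV2 ?posrE ?(lt_le_trans r0 rz).
  by move=> /andP[z0]; rewrite lef_pV2 ?posrE.
apply: dyadic_integral_le => //.
- by rewrite invr_gt0.
- by apply/measurable_EFinP; exact: measurable_enorm_pow.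
- by move=> x; rewrite lee_fin powR_ge0.
- exact: measurable_enorm_pow.
move=> tau /andP[tau0 _].
have mD : measurable [set x : 'rV[R]_n | tau / 2 < enorm x `^ (-1) <= tau].
  rewrite (_ : [set x | _] =
      [set z : 'rV[R]_n | enorm z `^ (-1) \in `]tau / 2, tau]]).
    exact: measurable_preimage_itv (measurable_enorm_pow _).
  by apply/seteqP; split => x /=; rewrite in_itv.
apply: le_trans.
  apply: (@integral_le_cst _ _ _ mu _ _ (tau `^ (n%:R + a))
    ((4 * (2 * tau^-1)) ^+ n)%:E) => //.
  - by rewrite powR_ge0.
  - exact: measurable_enorm_pow.
  - move=> z /= /andP[z1 z2]; rewrite powR_ge0 -mulN1r powRrM.
    by rewrite ler_pow ?powR_ge0// addr_ge0// ltW.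
  - apply: shell_volume_le => //; first by rewrite mulr_gt0// invr_gt0.
    move=> z /= /andP[z1 _]; move: z1; rewrite powR_inv1 ?enorm_ge0// => z1.
    have z0 : 0 < enorm z by rewrite -invr_gt0 (lt_trans _ z1)// divr_gt0.
    rewrite ltW// -ltf_pV2 ?posrE ?mulr_gt0 ?invr_gt0//.
    by rewrite invfM invrK mulrC.
rewrite -EFinM lee_fin /A powD// powR_mulrn ?(ltW tau0)//.
have -> : 4 * (2 * tau^-1) = 8 * tau^-1 by ring.
rewrite exprMn exprVn le_eqVlt; apply/orP; left; apply/eqP.
by field; rewrite expf_neq0// gt_eqF.
Qed.

Lemma exists_large_coord (a : 'rV[R]_n) : a != 0 ->
  exists i, a ord0 i != 0 /\ enorm a <= n%:R * `|a ord0 i|.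
Proof.
move=> a0; apply: contrapT => /forallNP h.
have ha i : n%:R * `|a ord0 i| < enorm a.
  have [->|ai0] := eqVneq (a ord0 i) 0; first by rewrite normr0 mulr0 enorm_gt0.
  by rewrite ltNge; apply/negP => hi; exact: (h i).
have [n0|n0] := posnP n.
  suff : a = 0 by move/eqP; rewrite (negbTE a0).
  by apply/rowP => i; have := ltn_ord i; rewrite {2}n0.
have : enorm a < enorm a; last by rewrite ltxx.
apply: (le_lt_trans (enorm_le_sum a)).
have n0' : (0 : R) < n%:R by rewrite ltr0n.
apply: (@lt_le_trans _ _ (\sum_(i < n) (enorm a / n%:R))).
  apply: ltr_sum; first by apply/hasP; exists (Ordinal n0) => //; rewrite mem_index_enum.
  by move=> i _; rewrite ltr_pdivlMr// mulrC.
by rewrite sumr_const card_ord -[X in X <= _]mulr_natr divfK// gt_eqF.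
Qed.

(** The layers [|a.z| ~ tau'] have volume of order [tau' / |a|], which makes the
    negative power [-b] integrable across the hyperplane because [b < 1]. *)
Lemma integral_dotv_box (b : R) : 0 < b < 1 ->
  exists2 C : R, 0 <= C & forall (a : 'rV[R]_n) (tau : R), a != 0 -> 0 < tau ->
  (\int[mu]_(z in box 0 tau) (`|dotv a z| `^ (- b))%:E
     <= (C * enorm a `^ (- b) * tau `^ (n%:R - b))%:E)%E.
Proof.
move=> /andP[b0 b1].
have b1' : 0 < 1 - b by rewrite subr_gt0.
have D0 : 0 < 1 - 2 `^ (- (1 - b)) :> R.
  by rewrite subr_gt0 pow2N_lt1.
pose C : R := 2 `^ b * 2 ^+ n.-1 * (2 * n%:R) * n%:R `^ (1 - b) / (1 - 2 `^ (- (1 - b))).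
have C0 : 0 <= C.
  by rewrite /C divr_ge0 ?(ltW D0)// !mulr_ge0// ?powR_ge0// exprn_ge0.
exists C => // a tau a0 tau0.
have [i [ai0 ai]] := exists_large_coord a0.
have n0 : (0 < n)%N by exact: leq_ltn_trans (ltn_ord i).
have n0' : (0 : R) < n%:R by rewrite ltr0n.
have ea0 : 0 < enorm a by rewrite enorm_gt0.
pose A : R := 2 `^ b * ((2 * tau) ^+ n.-1 * (2 / `|a ord0 i|)).
have A0 : 0 <= A.
  by rewrite !mulr_ge0 ?powR_ge0// ?exprn_ge0 ?mulr_ge0 ?(ltW tau0)// invr_ge0.
pose F z : \bar R := (`|dotv a z| `^ (- b) * \1_(box 0 tau) z)%:E.
pose T0 : R := enorm a * (n%:R * tau).
have T00 : 0 < T0 by rewrite !mulr_gt0.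
have mind : measurable_fun setT (\1_(box 0 tau) : 'rV[R]_n -> R).
  by apply: measurable_indic; exact: measurable_box.
have mF1 : measurable_fun setT (fun z => `|dotv a z| `^ (- b) * \1_(box 0 tau) z).
  by apply: measurable_funM => //; exact: measurable_dotv_pow.
have mg : measurable_fun setT (fun z : 'rV[R]_n => `|dotv a z|).
  by apply: measurableT_comp => //; exact: measurable_dotv.
have boxn (z : 'rV[R]_n) : box 0 tau z -> enorm z <= n%:R * tau.
  by move=> bz; apply: enorm_le_coord => j; have := bz j; rewrite mxE subr0.
have -> : (\int[mu]_(z in box 0 tau) (`|dotv a z| `^ (- b))%:E =
    \int[mu]_(z in [set z | (0 < `|dotv a z| <= T0)%R]) F z)%E.
  transitivity (\int[mu]_z F z)%E.
    rewrite integral_mkcond; apply: eq_integral => z _.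
    rewrite patchE /F indicE; case: ifPn => _; first by rewrite mulr1.
    by rewrite mulr0.
  apply: integral_support => // z _ /= /negP; rewrite negb_and -leNgt => h.
  rewrite /F indicE; case: (boolP (z \in _)) => zb; last by rewrite mulr0.
  case/orP: h => h.
    have /eqP -> : `|dotv a z| == 0 by rewrite eq_le h normr_ge0.
    by rewrite powR0 ?mul0r// oppr_eq0 gt_eqF.
  exfalso; move/negP: h; apply.
  rewrite (le_trans (dotv_le _ _))// ler_wpM2l ?enorm_ge0//.
  by apply: boxn; rewrite inE in zb.
apply: le_trans.
  apply: (@dyadic_integral_le _ _ _ mu F _ A (1 - b) T0) => //.
  - exact/measurable_EFinP.
  - by move=> z; rewrite lee_fin mulr_ge0 ?powR_ge0.
  move=> t /andP[t0 _].
  have mD : measurable [set x : 'rV[R]_n | t / 2 < `|dotv a x| <= t].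
    rewrite (_ : [set x | _] = [set z : 'rV[R]_n | `|dotv a z| \in `]t / 2, t]]).
      exact: measurable_preimage_itv.
    by apply/seteqP; split => x /=; rewrite in_itv.
  have -> : (\int[mu]_(x in [set x | (t / 2 < `|dotv a x| <= t)%R]) F x =
    \int[mu]_(x in [set x | (t / 2 < `|dotv a x| <= t)%R] `&` box 0 tau) F x)%E.
    apply: integral_support => [z /= h1 h2|z []//].
    rewrite /F indicE memNset ?mulr0// => zb; exact: h2.
  apply: le_trans.
    apply: (@integral_le_cst _ _ _ mu _ _ (2 `^ b * t `^ (- b))
      ((2 * tau) ^+ n.-1 * (2 * (t / `|a ord0 i|)))%:E) => //.
    - by apply: measurableI => //; exact: measurable_box.
    - by rewrite mulr_ge0 ?powR_ge0.
    - move=> z [/= /andP[z1 z2] zb]; rewrite indicE mem_set// mulr1 powR_ge0 /=.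
      rewrite (le_trans (pow_dyadic_le _ t0 (ltW z1) z2))//.
      by rewrite normrN gtr0_norm.
    - apply: (le_trans _ (slab_volume_le 0 ai0 (ltW tau0) (ltW t0))).
      apply: le_measure.
      + by rewrite inE; apply: measurableI => //; exact: measurable_box.
      + by rewrite inE; exact: measurable_slab.
      by move=> z [/= /andP[_ z2] zb]; split => //=; rewrite addr0.
  rewrite -EFinM lee_fin /A.
  rewrite (_ : t `^ (1 - b) = t * t `^ (- b)); last by rewrite powD// powRr1 ?(ltW t0).
  by rewrite le_eqVlt; apply/orP; left; apply/eqP; ring.
rewrite lee_fin /C /A /T0.
rewrite !powRM ?mulr_ge0 ?(ltW ea0) ?(ltW tau0) ?(ltW n0')//.
rewrite (_ : enorm a `^ (1 - b) = enorm a * enorm a `^ (- b)); last first.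
  by rewrite powD// powRr1 ?(ltW ea0).
rewrite (_ : tau `^ (n%:R - b) = tau ^+ n.-1 * tau `^ (1 - b)); last first.
  rewrite -powR_mulrn ?(ltW tau0)// -powD//; congr (_ `^ _).
  by rewrite -[in LHS](prednK n0) -natr1; ring.
rewrite exprMn.
have hh : enorm a / `|a ord0 i| <= n%:R by rewrite ler_pdivrMr ?normr_gt0.
set X := enorm a `^ (- b); set Y := tau `^ (1 - b); set Z := n%:R `^ (1 - b).
set W := (1 - 2 `^ (- (1 - b)))^-1.
have -> : 2 `^ b * (2 ^+ n.-1 * tau ^+ n.-1 * (2 / `|a ord0 i|)) *
  (enorm a * X * (Z * Y)) * W = 2 `^ b * 2 ^+ n.-1 * 2 * (enorm a / `|a ord0 i|)
   * (Z * W * X * tau ^+ n.-1 * Y) by ring.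
have -> : 2 `^ b * 2 ^+ n.-1 * (2 * n%:R) * Z * W * X * (tau ^+ n.-1 * Y) =
  2 `^ b * 2 ^+ n.-1 * 2 * n%:R * (Z * W * X * tau ^+ n.-1 * Y) by ring.
rewrite ler_wpM2r//.
  by rewrite !mulr_ge0 ?powR_ge0 ?exprn_ge0 ?(ltW tau0)// invr_ge0 ltW.
by rewrite ler_wpM2l// !mulr_ge0 ?powR_ge0 ?exprn_ge0.
Qed.

(** The weight [|a.z|^(-b)] is singular on a whole hyperplane, but integrably so
    since [b < 1]; the radial weight is constant up to a factor on dyadic shells. *)
Lemma integral_dotv_power (b c : R) : 0 < b < 1 -> 0 < n%:R - b - c ->
  exists2 C : R, 0 <= C & forall (a : 'rV[R]_n) (rho : R), a != 0 -> 0 < rho ->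
  (\int[mu]_(z in pball rho) (`|dotv a z| `^ (- b) * enorm z `^ (- c))%:E
     <= (C * enorm a `^ (- b) * rho `^ (n%:R - b - c))%:E)%E.
Proof.
move=> b01 e0; have [C1 C10 hC1] := integral_dotv_box b01.
set e := n%:R - b - c in e0 *.
pose A : R := 2 `^ `|- c| * C1.
have A0 : 0 <= A by rewrite mulr_ge0 ?powR_ge0.
exists (A / (1 - 2 `^ (- e))).
  by rewrite divr_ge0// subr_ge0 ltW// pow2N_lt1.
move=> a rho a0 rho0.
have -> : A / (1 - 2 `^ (- e)) * enorm a `^ (- b) * rho `^ e =
  A * enorm a `^ (- b) * rho `^ e / (1 - 2 `^ (- e)) by ring.
have mf : measurable_fun setT
    (fun z : 'rV[R]_n => `|dotv a z| `^ (- b) * enorm z `^ (- c)).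
  apply: measurable_funM; first exact: measurable_dotv_pow.
  exact: measurable_enorm_pow.
apply: dyadic_integral_le => //.
- by rewrite mulr_ge0 ?powR_ge0.
- exact/measurable_EFinP.
- by move=> x; rewrite lee_fin mulr_ge0 ?powR_ge0.
- exact: measurable_enorm1.
move=> tau /andP[tau0 _].
have mD : measurable [set x : 'rV[R]_n | tau / 2 < enorm x <= tau].
  rewrite (_ : [set x | _] = [set z : 'rV[R]_n | enorm z \in `]tau / 2, tau]]).
    exact: measurable_preimage_itv measurable_enorm1.
  by apply/seteqP; split => x /=; rewrite in_itv.
pose k : R := 2 `^ `|- c| * tau `^ (- c).
have k0 : 0 <= k by rewrite mulr_ge0 ?powR_ge0.
apply: (@le_trans _ _ (\int[mu]_(z in box 0 tau) (k%:E * (`|dotv a z| `^ (- b))%:E))%E).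
  apply: (@le_trans _ _ (\int[mu]_(x in [set x | (tau / 2 < enorm x <= tau)%R])
      (k%:E * (`|dotv a x| `^ (- b))%:E))%E).
    apply: ge0_le_integral => //.
    - by move=> z _; rewrite lee_fin mulr_ge0 ?powR_ge0.
    - by apply/measurable_EFinP; exact: measurable_funTS.
    - apply/measurable_EFinP; apply: measurable_funTS; apply: measurable_funM => //.
      exact: measurable_dotv_pow.
    - move=> z /= /andP[z1 z2]; rewrite lee_fin mulrC ler_wpM2r ?powR_ge0//.
      by rewrite pow_dyadic_le// ltW.
  apply: ge0_subset_integral => //; first exact: measurable_box.
  - apply/measurable_EFinP; apply: measurable_funTS; apply: measurable_funM => //.
    exact: measurable_dotv_pow.
  - by move=> z _; rewrite lee_fin mulr_ge0 ?powR_ge0.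
  - move=> z /= /andP[_ z2] i; rewrite mxE subr0.
    exact: le_trans (ler_coord_enorm _ _) z2.
rewrite ge0_integralZl//; first last.
- apply/measurable_EFinP; apply: measurable_funTS; exact: measurable_dotv_pow.
- exact: measurable_box.
apply: (@le_trans _ _ (k%:E * (C1 * enorm a `^ (- b) * tau `^ (n%:R - b))%:E)%E).
  by apply: lee_wpmul2l; [rewrite lee_fin|exact: hC1].
rewrite -EFinM lee_fin /k /A /e (powD (n%:R - b))//.
by rewrite le_eqVlt; apply/orP; left; apply/eqP; ring.
Qed.

End power_integrals.

(** * The function [|t|^(p-2) t] *)

Section scalar_inequalities.
Context {R : realType}.
Implicit Types x y t r : R.

Lemma bernoulli_ge x r : 1 <= r -> 0 <= x -> 1 + r * (x - 1) <= x `^ r.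
Proof.
move=> r1 x0; have [->|rn1] := eqVneq r 1; first by rewrite powRr1//; lra.
have {rn1} r1' : 1 < r by rewrite lt_neqAle eq_sym rn1.
have r0 : 0 < r by lra.
have q0 : 0 < r / (r - 1) by rewrite divr_gt0// subr_gt0.
have := @conjugate_powR R x 1 r (r / (r - 1)) x0 ler01 r0 q0.
rewrite powR1 mulr1 => /(_ _)/wrap[].
  by field; rewrite subr_eq0 !gt_eqF.
move=> h; have {h} := ler_wpM2l (ltW r0) h.
have -> : r * (x `^ r / r + 1 / (r / (r - 1))) = x `^ r + (r - 1).
  by field; rewrite subr_eq0 !gt_eqF.
lra.
Qed.

Lemma bernoulli_le x r : 0 < r -> r <= 1 -> 0 <= x -> x `^ r <= 1 + r * (x - 1).
Proof.
move=> r0 r1 x0; have r1' : 1 <= r^-1 by rewrite invf_ge1.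
have := bernoulli_ge r1' (powR_ge0 x r).
rewrite -powRrM mulfV ?gt_eqF// powRr1// => h.
have {h} := ler_wpM2l (ltW r0) h.
rewrite mulrDr mulrA mulfV ?gt_eqF//; lra.
Qed.

Lemma pow_subadditive x y r : 0 < r -> r <= 1 -> 0 <= x -> 0 <= y ->
  (x + y) `^ r <= x `^ r + y `^ r.
Proof.
move=> r0 r1 x0 y0.
have [->|xn0] := eqVneq x 0; first by rewrite add0r powR0 ?gt_eqF// add0r.
have [->|yn0] := eqVneq y 0; first by rewrite addr0 powR0 ?gt_eqF// addr0.
have {}x0 : 0 < x by rewrite lt_neqAle eq_sym xn0.
have {}y0 : 0 < y by rewrite lt_neqAle eq_sym yn0.
have s0 : 0 < x + y by exact: addr_gt0.
have r10 : r - 1 <= 0 by rewrite subr_le0.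
rewrite -(mulr_powRB1 (ltW s0) r0) -(mulr_powRB1 (ltW x0) r0).
rewrite -(mulr_powRB1 (ltW y0) r0) mulrDl.
by apply: lerD; apply: ler_wpM2l; rewrite ?(ltW x0) ?(ltW y0)//;
  apply: ler_pow_neg => //; rewrite ?lerDl ?lerDr ltW.
Qed.

End scalar_inequalities.

Section J.
Context {R : realType}.
Variable p : R.
Implicit Types x y t : R.

Definition J t : R := `|t| `^ (p - 2) * t.

Hypothesis p1 : 1 < p.

Let r0 : 0 < p - 1. Proof. by rewrite subr_gt0. Qed.

Lemma J0 : J 0 = 0. Proof. by rewrite /J mulr0. Qed.

Lemma JN t : J (- t) = - J t. Proof. by rewrite /J normrN mulrN. Qed.

Lemma J_ge0E t : 0 <= t -> J t = t `^ (p - 1).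
Proof.
move=> t0; rewrite /J ger0_norm// -(mulr_powRB1 t0 r0) mulrC.
by congr (_ * _ `^ _); ring.
Qed.

Lemma normJ t : `|J t| = `|t| `^ (p - 1).
Proof.
have [t0|t0] := leP 0 t; first by rewrite J_ge0E// ger0_norm ?powR_ge0// ger0_norm.
rewrite -normrN -JN -(normrN t) J_ge0E ?oppr_ge0 ?(ltW t0)//.
by rewrite ger0_norm ?powR_ge0// ger0_norm ?oppr_ge0 ?(ltW t0).
Qed.

Lemma J_ge0 t : 0 <= t -> 0 <= J t.
Proof. by move=> t0; rewrite J_ge0E// powR_ge0. Qed.

Lemma J_mono x y : x <= y -> J x <= J y.
Proof.
move=> xy; have [x0|x0] := leP 0 x.
  by rewrite !J_ge0E ?(le_trans x0)// ler_pow// ltW.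
have [y0|y0] := leP 0 y.
  rewrite (@le_trans _ _ 0)// ?J_ge0// -[x]opprK JN oppr_le0 J_ge0//.
  by rewrite oppr_ge0 ltW.
rewrite -[x]opprK -[y]opprK !(JN (- _)) lerN2 !J_ge0E ?oppr_ge0 ?(ltW x0) ?(ltW y0)//.
by rewrite ler_pow ?(ltW r0) ?oppr_ge0 ?(ltW y0)// lerN2.
Qed.

Lemma measurable_J d (T : measurableType d) (f : T -> R) :
  measurable_fun setT f -> measurable_fun setT (J \o f).
Proof.
move=> mf; apply: measurable_funM => //.
apply: (measurableT_comp (measurable_powR (p - 2))).
exact: measurableT_comp.
Qed.

(** Differences of an odd function: by the symmetries it is enough to compare two
    nonnegative numbers, or two numbers of opposite signs. *)
Lemma J_diff_wlog (F : R -> R -> Prop) :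
  (forall x y, F x y -> F (- x) (- y)) ->
  (forall x y, F x y -> F y x) ->
  (forall x y, 0 <= y -> y <= x -> F x y) ->
  (forall x y, 0 <= x -> 0 <= y -> F x (- y)) ->
  forall x y, F x y.
Proof.
move=> FN FC F1 F2.
have pos x y : 0 <= y -> F x y.
  move=> y0; have [x0|/ltW x0] := leP 0 x.
    have [yx|/ltW xy] := leP y x; first exact: F1.
    by apply: FC; exact: F1.
  by apply: FC; rewrite -[x]opprK; apply: F2; rewrite ?oppr_ge0.
move=> x y; have [/pos//|/ltW y0] := leP 0 y.
by rewrite -[x]opprK -[y]opprK; apply/FN/pos; rewrite oppr_ge0.
Qed.

Lemma J_diff_ge2 : 2 <= p -> forall x y,
  `|J x - J y| <= (p - 1) * Num.max `|x| `|y| `^ (p - 2) * `|x - y|.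
Proof.
move=> p2; have r1 : 1 <= p - 1 by lra.
have p20 : 0 <= p - 2 by lra.
apply: J_diff_wlog.
- by move=> x y; rewrite !JN !normrN -!opprD !normrN.
- by move=> x y; rewrite distrC maxC [X in _ * X]distrC.
- move=> x y y0 yx; have x0 := le_trans y0 yx.
  have h := @J_mono _ _ yx.
  rewrite !ger0_norm ?subr_ge0// max_l//.
  have [xz|xn0] := eqVneq x 0.
    have -> : y = 0 by apply/eqP; rewrite eq_le y0 -xz yx.
    by rewrite xz !subrr mulr0.
  have {}x0 : 0 < x by rewrite lt_neqAle eq_sym xn0.
  rewrite !J_ge0E ?(ltW x0)//.
  have yx0 : 0 <= y / x by rewrite divr_ge0// ltW.
  have := bernoulli_ge r1 yx0.
  rewrite powRM ?invr_ge0 ?(ltW x0)// powV ?(ltW x0)// powRN => hb.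
  have {hb} := ler_wpM2l (powR_ge0 x (p - 1)) hb.
  rewrite mulrCA mulfV ?mulr1 ?gt_eqF ?powR_gt0//.
  rewrite [X in X * (1 + _)](_ : _ = x * x `^ (p - 2)); last first.
    by rewrite -(mulr_powRB1 (ltW x0) r0); congr (_ * _ `^ _); ring.
  rewrite (_ : x `^ (p - 1) = x * x `^ (p - 2)); last first.
    by rewrite -(mulr_powRB1 (ltW x0) r0); congr (_ * _ `^ _); ring.
  have -> : x * x `^ (p - 2) * (1 + (p - 1) * (y / x - 1)) =
    x * x `^ (p - 2) + (p - 1) * x `^ (p - 2) * (y - x) by field; rewrite gt_eqF.
  lra.
- move=> x y x0 y0; rewrite JN !opprK normrN !ger0_norm ?addr_ge0 ?J_ge0//.
  rewrite /J !ger0_norm// mulrDr.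
  have hM z : 0 <= z -> z <= Num.max x y ->
     z `^ (p - 2) * z <= (p - 1) * Num.max x y `^ (p - 2) * z.
    move=> z0 zM; apply: ler_wpM2r => //.
    apply: (@le_trans _ _ (Num.max x y `^ (p - 2))); first exact: ler_pow.
    by rewrite ler_peMl ?powR_ge0.
  by apply: lerD; apply: hM => //; rewrite le_max lexx ?orbT.
Qed.

Lemma J_diff_le2 : p <= 2 -> forall x y,
  `|J x - J y| <= 2 * `|x - y| `^ (p - 1).
Proof.
move=> p2; have r1 : p - 1 <= 1 by lra.
apply: J_diff_wlog.
- by move=> x y; rewrite !JN -!opprD !normrN.
- by move=> x y; rewrite distrC [X in _ * X `^ _]distrC.
- move=> x y y0 yx; have x0 := le_trans y0 yx.
  have h := @J_mono _ _ yx.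
  have xy0 : 0 <= x - y by rewrite subr_ge0.
  rewrite !ger0_norm ?subr_ge0// !J_ge0E//.
  have := pow_subadditive r0 r1 y0 xy0; rewrite addrC subrK.
  by have := powR_ge0 (x - y) (p - 1); lra.
- move=> x y x0 y0; rewrite JN !opprK !ger0_norm ?addr_ge0 ?J_ge0// !J_ge0E//.
  have := @ler_pow R x (x + y) (p - 1) (ltW r0) x0.
  have := @ler_pow R y (x + y) (p - 1) (ltW r0) y0.
  by rewrite lerDl lerDr => /(_ x0) ? /(_ y0) ?; lra.
Qed.

(** For [p <= 2] the derivative of [J] is unbounded at the origin; the bound is the
    tangent at [y], up to a factor, and degenerates only when [y] does. *)
Lemma J_diff_le2_lin : p <= 2 -> forall x y, y != 0 ->
  `|J x - J y| <= 2 * `|y| `^ (p - 2) * `|x - y|.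
Proof.
move=> p2 x y yn0; have p20 : p - 2 <= 0 by lra.
wlog y0 : x y yn0 / 0 < y => [hw|].
  have [/hw|y0|/eqP] := ltgtP 0 y; first exact.
    have := hw (- x) (- y); rewrite oppr_eq0 oppr_gt0 => /(_ yn0 y0).
    by rewrite !JN -!opprD !normrN.
  by rewrite eq_sym (negbTE yn0).
rewrite (gtr0_norm y0).
have pw0 := powR_ge0 y (p - 2).
have [x0|x0] := leP 0 x.
  have Jy : J y = y `^ (p - 2) * y by rewrite /J gtr0_norm.
  have [xz|xn0] := eqVneq x 0.
    rewrite xz J0 !sub0r !normrN Jy normrM (gtr0_norm y0) ger0_norm//.
    by rewrite ler_wpM2r ?(ltW y0)//; lra.
  have {}x0 : 0 < x by rewrite lt_neqAle eq_sym xn0.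
  have Jx : J x = x `^ (p - 2) * x by rewrite /J gtr0_norm.
  have [xy|/ltW yx] := leP x y.
    rewrite distrC [X in _ * X]distrC !ger0_norm ?subr_ge0 ?J_mono// Jx Jy.
    have := ler_pow_neg p20 x0 xy; nra.
  rewrite !ger0_norm ?subr_ge0 ?J_mono// Jx Jy.
  have := ler_pow_neg p20 y0 yx; nra.
have {x0} : 0 < - x by rewrite oppr_gt0.
rewrite -[x in J x]opprK -[x in `|x - y|]opprK; move: (- x) => z z0.
rewrite JN -!opprD !normrN !ger0_norm ?addr_ge0 ?J_ge0 ?(ltW y0) ?(ltW z0)//.
have -> : J y = y `^ (p - 2) * y by rewrite /J gtr0_norm.
have [zy|/ltW yz] := leP z y.
  have := J_mono zy; have -> : J y = y `^ (p - 2) * y by rewrite /J gtr0_norm.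
  nra.
have -> : J z = z `^ (p - 2) * z by rewrite /J gtr0_norm.
have := ler_pow_neg p20 y0 yz; nra.
Qed.

(** Quantitative strict monotonicity, with the right homogeneity in [X]; the two
    values of the minimum come from the concave and the convex range of [p]. *)
Lemma J_gap (X Y del : R) : 0 < X -> 0 <= del <= 1 -> Y <= X * (1 - del) ->
  Num.min 1 (p - 1) * del * X `^ (p - 1) <= J X - J Y.
Proof.
move=> X0 /andP[d0 d1] /J_mono YX.
have d1' : 0 <= 1 - del by rewrite subr_ge0.
suff : J (X * (1 - del)) <= X `^ (p - 1) * (1 - Num.min 1 (p - 1) * del).
  by rewrite (J_ge0E (ltW X0)); lra.
rewrite J_ge0E ?mulr_ge0 ?(ltW X0)// powRM ?(ltW X0)// ler_wpM2l ?powR_ge0//.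
have [r1|/ltW r1] := leP 1 (p - 1).
  rewrite mul1r; have [->|dn] := eqVneq (1 - del) 0; first by rewrite powR0 ?gt_eqF.
  by apply: ge1r_powR => //; rewrite lt_neqAle eq_sym dn d1'/=; lra.
have := bernoulli_le r0 r1 d1'; lra.
Qed.

End J.

(** * The principal value as an absolutely convergent integral *)

Section principal_value.
Context {R : realType} {n : nat}.
Notation mu := (lebesgue_rV R n).
Implicit Types (x a z : 'rV[R]_n) (v : 'rV[R]_n -> R).

Definition kern (p s : R) z : R := (enorm z `^ (n%:R + s * p))^-1.

Lemma kernE (p s : R) z : kern p s z = enorm z `^ (- (n%:R + s * p)).
Proof. by rewrite powRN. Qed.

Lemma kern_ge0 (p s : R) z : 0 <= kern p s z.
Proof. by rewrite kernE powR_ge0. Qed.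

Lemma kernN (p s : R) z : kern p s (- z) = kern p s z.
Proof. by rewrite /kern enormN. Qed.

Lemma measurable_kern (p s : R) : measurable_fun setT (kern p s).
Proof.
rewrite (_ : kern p s = fun z => enorm z `^ (- (n%:R + s * p))).
  exact: measurable_enorm_pow.
by apply/funext => z; rewrite kernE.
Qed.

(** The odd function [J (a.z)] is subtracted near the origin: with [a] the gradient
    of [v] at [x] this makes the integrand absolutely integrable for a [C^2]
    function, also when [p] is so small that [J (v (x + z) - v x)] alone is not. *)
Definition pv_integrand (p s : R) v x a (r : R) z : R :=
  (J p (v (x + z) - v x) - \1_(eball 0 r) z * J p (dotv a z)) * kern p s z.

Lemma measurable_translate v x :
  measurable_fun setT v -> measurable_fun setT (fun z => v (x + z)).
Proof.
move=> mv; apply: (measurableT_comp mv).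
rewrite [X in measurable_fun _ X](_ : _ = (fun z : 'rV[R]_n => 1 *: z + x)).
  exact: measurable_affine_rV.
by apply/funext => z; rewrite scale1r addrC.
Qed.

Lemma measurable_pv_integrand (p s : R) v x a (r : R) :
  measurable_fun setT v -> measurable_fun setT (pv_integrand p s v x a r).
Proof.
move=> mv; apply: measurable_funM; last exact: measurable_kern.
apply: measurable_funB.
  apply: measurable_J; apply: measurable_funB => //.
  exact: measurable_translate.
apply: measurable_funM; first by apply: measurable_indic; exact: measurable_eball.
by apply: measurable_J; exact: measurable_dotv.
Qed.

Lemma odd_integral0 (f : 'rV[R]_n -> R) (A : set 'rV[R]_n) :
  measurable A -> (forall z, A (- z) <-> A z) ->
  (forall z, f (- z) = - f z) ->
  mu.-integrable A (EFin \o f) -> measurable_fun setT f ->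
  (\int[mu]_(z in A) (f z)%:E = 0)%E.
Proof.
move=> mA AN fN intf mf.
have := @integral_affine R n (-1) 0 (EFin \o f) A.
rewrite sqrrN expr1n => /(_ erefl mA (proj2 (measurable_EFinP _ _) mf)).
rewrite (_ : _ @^-1` A = A); last first.
  by apply/seteqP; split => z /=; rewrite scaleN1r addr0 AN.
under [X in _ = X -> _]eq_integral do rewrite /= scaleN1r addr0 fN EFinN.
have fin := integrable_fin_num mA intf.
rewrite integralN; last exact: integrable_add_def.
rewrite -(fineK fin) /= => -[h]; congr EFin; lra.
Qed.

Hypothesis n0 : (0 < n)%N.

(** The subtracted term is odd, so its integral over the complement of each ball
    vanishes; what remains converges by dominated convergence as the ball
    shrinks. Hence the limit exists and is finite, whatever the vector [a]. *)
Lemma frac_plaplacianE (p s : R) v x a (r : R) : 1 < p -> 0 < s -> 0 < r ->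
  measurable_fun setT v ->
  mu.-integrable setT (EFin \o pv_integrand p s v x a r) ->
  frac_plaplacian p s v x =
  (- (1 - s) * \int[mu]_z (pv_integrand p s v x a r z))%:E.
Proof.
move=> p1 s0 r0 mv intG; set G := pv_integrand p s v x a r in intG *.
have N0 : 0 < n%:R + s * p.
  by rewrite addr_gt0 ?ltr0n// mulr_gt0// (lt_trans _ p1).
have mG : measurable_fun setT G by exact: measurable_pv_integrand.
have mC e : measurable (~` eball (0 : 'rV[R]_n) e).
  by apply: measurableC; exact: measurable_eball.
pose F z := J p (v (x + z) - v x) * kern p s z.
have mF : measurable_fun setT F.
  apply: measurable_funM; last exact: measurable_kern.
  by apply: measurable_J; apply: measurable_funB => //; exact: measurable_translate.
pose I e := (\int[mu]_(y in ~` eball x e)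
  (`|v y - v x| `^ (p - 2) * (v y - v x)
           / enorm (x - y) `^ (n%:R + s * p))%:E)%E.
have IE (e : R) : I e = (\int[mu]_(z in ~` eball (0 : 'rV[R]_n) e) (F z)%:E)%E.
  rewrite /I (@integral_affine R n 1 x).
  - rewrite (_ : _ @^-1` _ = ~` eball (0 : 'rV[R]_n) e); last first.
      apply/seteqP; split => z; rewrite /eball /= scale1r subr0 addrK //.
    apply: eq_integral => z _; rewrite scale1r (addrC z) /F /J /kern.
    by rewrite (_ : (x - (x + z))%R = - z)%R ?enormN// opprD addrA subrr sub0r.
  - by rewrite expr1n.
  - by apply: measurableC; exact: measurable_eball.
  - apply/measurable_EFinP; apply: measurable_funM.
      by apply: measurable_J; exact: measurable_funB.
    have mpw : measurable_fun setT (fun t : R => (t `^ (n%:R + s * p))^-1).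
      rewrite (_ : (fun _ => _) = @powR R ^~ (- (n%:R + s * p))).
        exact: measurable_powR.
      by apply/funext => t; rewrite powRN.
    apply: (measurableT_comp mpw); apply: measurable_enorm.
    rewrite [X in measurable_fun _ X](_ : _ = (fun y : 'rV[R]_n => (- 1) *: y + x)).
      exact: measurable_affine_rV.
    by apply/funext => y; rewrite scaleN1r addrC.
have IG (e : R) : 0 < e -> e < r ->
    I e = (\int[mu]_z (G z * \1_(~` eball (0 : 'rV[R]_n) e) z)%:E)%E.
  move=> e0 er.
  (* the odd part, which is integrable away from the origin *)
  pose h z := \1_(eball 0 r) z * J p (dotv a z) * kern p s z.
  have mh : measurable_fun setT h.
    apply: measurable_funM; last exact: measurable_kern.
    apply: measurable_funM; first by apply: measurable_indic; exact: measurable_eball.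
    by apply: measurable_J; exact: measurable_dotv.
  have inth : mu.-integrable (~` eball (0 : 'rV[R]_n) e) (EFin \o h).
    apply/integrableP; split; first by apply: measurable_funTS; exact/measurable_EFinP.
    under eq_integral do rewrite abse_EFin.
    rewrite (@integral_support _ _ _ _ _ (~` eball (0 : 'rV[R]_n) e `&` eball 0 r)).
    - apply: le_lt_trans.
        apply: (@integral_le_cst _ _ _ mu _ (fun z => `|h z|)
          ((enorm a * r) `^ (p - 1) * e `^ (- (n%:R + s * p)))
          ((2 * r) ^+ n)%:E).
        + apply: measurableI => //; exact: measurable_eball.
        + by rewrite mulr_ge0 ?powR_ge0.
        + exact: measurableT_comp.
        + move=> z [/= ez rz]; rewrite normr_ge0 /= /h indicE mem_set// mul1r.
          rewrite /eball /= subr0 in ez rz; move/negP: ez; rewrite -leNgt => ez.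
          rewrite normrM normJ// kernE (ger0_norm (powR_ge0 _ _)).
          apply: ler_pM; rewrite ?powR_ge0//.
            rewrite ler_pow ?subr_ge0 ?(ltW p1)// (le_trans (dotv_le _ _))//.
            by rewrite ler_wpM2l ?enorm_ge0// ltW.
          by rewrite ler_pow_neg// oppr_le0 ltW.
        + apply: (le_trans _ (eball_volume_le 0 (ltW r0))).
          apply: le_measure.
          * by rewrite inE; apply: measurableI => //; exact: measurable_eball.
          * by rewrite inE; exact: measurable_eball.
          * by move=> z [].
      by rewrite -EFinM ltry.
    - move=> z /= ez nz; rewrite /h indicE memNset ?mul0r ?normr0// => rz.
      exact: nz.
    - by move=> z [].
  have h0 : (\int[mu]_(z in ~` eball (0 : 'rV[R]_n) e) (h z)%:E = 0)%E.
    apply: odd_integral0 => //.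
      by move=> z; rewrite /eball /= !subr0 enormN.
    move=> z; rewrite /h kernN dotvNr JN !indicE.
    rewrite (_ : (- z \in eball 0 r) = (z \in eball 0 r)).
      by rewrite mulrN mulNr.
    by apply/idP/idP; rewrite !inE /eball /= !subr0 enormN.
  have intG' : mu.-integrable (~` eball (0 : 'rV[R]_n) e) (EFin \o G).
    by apply: integrableS intG.
  rewrite IE.
  transitivity (\int[mu]_(z in ~` eball (0 : 'rV[R]_n) e)
      ((EFin \o G) z + (EFin \o h) z))%E.
    apply: eq_integral => z _; rewrite /= -EFinD; congr EFin.
    by rewrite /F /G /h /pv_integrand; ring.
  rewrite integralD// [X in (_ + X)%E]h0 adde0.
  rewrite integral_mkcond; apply: eq_integral => z _; rewrite patchE indicE /=.
  by case: ifP => _; rewrite ?mulr1 ?mulr0.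
have G0 : G 0 = 0.
  by rewrite /G /pv_integrand addr0 subrr J0 /dotv big1 ?J0 ?mulr0 ?subrr ?mul0r// => i _; rewrite mxE mulr0.
have mGe (e : R) : measurable_fun setT (fun z => G z * \1_(~` eball (0 : 'rV[R]_n) e) z).
  apply: measurable_funM => //; apply: measurable_indic; exact: mC.
have leGe (e : R) z : `|G z * \1_(~` eball (0 : 'rV[R]_n) e) z| <= `|G z|.
  by rewrite normrM ler_piMr// indicE; case: (_ \in _); rewrite ?normr1 ?normr0.
have intGe (e : R) : mu.-integrable setT
    (EFin \o (fun z => G z * \1_(~` eball (0 : 'rV[R]_n) e) z)).
  apply: le_integrable intG => //; first exact/measurable_EFinP.
  by move=> z _ /=; rewrite !lee_fin.
pose fI (e : R) : R := \int[mu]_z (G z * \1_(~` eball (0 : 'rV[R]_n) e) z).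
have cvgfI : fI e @[e --> 0^'+] --> \int[mu]_z G z.
  apply/cvg_at_rightP => u [u0 ucvg].
  apply: fine_cvg.
  rewrite fineK; last exact: (integrable_fin_num measurableT intG).
  have [| | | | |_ _] := @dominated_convergence _ _ R mu setT measurableT
    (fun k z => (G z * \1_(~` eball (0 : 'rV[R]_n) (u k)) z)%:E) (EFin \o G)
    (fun z => (`|G z|)%:E).
  - by move=> k; apply/measurable_EFinP.
  - exact/measurable_EFinP.
  - apply: aeW => z _; have [->|z0] := eqVneq z 0.
      by rewrite /= G0; under eq_fun do rewrite mul0r; exact: cvg_cst.
    apply: cvg_near_cst; have z0' : 0 < enorm z by rewrite enorm_gt0.
    have : \forall k \near \oo, u k < enorm z.
      by move/cvgrPdist_lt : ucvg => /(_ _ z0') [N _ hN]; exists N => // k /hN /=;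
        rewrite sub0r normrN => /(le_lt_trans (ler_norm _)).
    apply: filterS => k uk /=; rewrite indicE mem_set ?mulr1//=.
    by rewrite /eball /= subr0; apply/negP; rewrite -leNgt ltW.
  - exact: integrable_norm.
  - by apply: aeW => z k _ /=; rewrite lee_fin.
  - exact.
have cvgI : I e @[e --> 0^'+] --> (\int[mu]_z G z)%:E.
  apply: (@cvg_trans _ ((fI e)%:E @[e --> 0^'+])); last first.
    by apply: cvg_EFin; [exact: nearW|exact: cvgfI].
  apply: near_eq_cvg; near=> e.
  rewrite IG; last 2 first.
  - by near: e; exact: nbhs_right_gt.
  - by near: e; exact: nbhs_right_lt.
  rewrite /fI /Rintegral fineK//.
  by apply: (integrable_fin_num measurableT); exact: intGe.
rewrite /frac_plaplacian -/I.
rewrite (_ : lim (I @ 0^'+) = (\int[mu]_z G z)%:E); last exact/cvg_lim.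
by rewrite -EFinM -EFinN mulNr.
Unshelve. all: by end_near. Qed.

End principal_value.

(** * Insensitivity of the operator to null sets *)

Section ae_equal.
Local Open Scope ereal_scope.
Context d (T : measurableType d) (R : realType).
Variable mu : {measure set T -> \bar R}.
Import HBNNSimple.

(** The integral of a nonnegative function is a supremum over the simple functions
    below it, and cutting these off on [N] does not change their integrals. *)
Lemma ge0_integral_ae_eq (N : set T) (f g : T -> \bar R) :
  measurable N -> mu N = 0 -> (forall x, 0 <= f x) -> (forall x, 0 <= g x) ->
  (forall x, ~ N x -> f x = g x) -> \int[mu]_x f x = \int[mu]_x g x.
Proof.
move=> mN N0; have mNC : measurable (~` N) by exact: measurableC.
suff le f' g' : (forall x, 0 <= f' x) -> (forall x, 0 <= g' x) ->
    (forall x, ~ N x -> f' x = g' x) -> \int[mu]_x f' x <= \int[mu]_x g' x.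
  move=> f0 g0 fg; apply/eqP; rewrite eq_le !le// => x Nx.
  by rewrite fg.
move=> f0 g0 fg; rewrite !ge0_integralTE//.
apply: ge_ereal_sup => _ [h hf <-].
have E x : proj_nnsfun h mNC x = (h \_ (~` N)) x by rewrite mrestrict.
apply: ereal_sup_ge; exists (sintegral mu (proj_nnsfun h mNC)).
  exists (proj_nnsfun h mNC) => // x; rewrite E patchE.
  case: ifPn => xN; last by rewrite g0.
  by rewrite -fg ?hf//; rewrite inE in xN.
rewrite -!integralT_nnsfun (ge0_negligible_integral mN measurableT)//; last 2 first.
- exact/measurable_EFinP.
- by move=> x _; rewrite lee_fin.
rewrite [leRHS](ge0_negligible_integral mN measurableT)//; last 2 first.
- exact/measurable_EFinP.
- by move=> x _; rewrite lee_fin.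
rewrite le_eqVlt; apply/orP; left; apply/eqP; apply: eq_integral => x.
by rewrite inE => -[_ xN]; rewrite E patchE mem_set.
Qed.

Lemma integral_ae_eq_fun (D N : set T) (f g : T -> \bar R) :
  measurable N -> mu N = 0 ->
  (forall x, D x -> ~ N x -> f x = g x) ->
  \int[mu]_(x in D) f x = \int[mu]_(x in D) g x.
Proof.
move=> mN N0 fg; rewrite integral_mkcond [RHS]integral_mkcond.
rewrite integralE [RHS]integralE.
have fgD x : ~ N x -> (f \_ D) x = (g \_ D) x.
  by move=> xN; rewrite !patchE; case: ifPn => // xD; apply: fg => //; rewrite inE in xD.
congr (_ - _); apply: (@ge0_integral_ae_eq N) => // x xN.
- by rewrite !funeposE fgD.
- by rewrite !funenegE fgD.
Qed.

End ae_equal.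

Section ae_operator.
Context {R : realType} {n : nat}.

Lemma frac_plaplacian_ae (p s : R) (v w : 'rV[R]_n -> R) (N : set 'rV[R]_n) x :
  measurable N -> lebesgue_rV R n N = 0%E -> (forall y, ~ N y -> v y = w y) ->
  v x = w x -> frac_plaplacian p s v x = frac_plaplacian p s w x.
Proof.
move=> mN N0 vw vwx; rewrite /frac_plaplacian.
congr (- ((1 - s)%:E * lim (_ @ 0^'+)))%E; apply/funext => e.
apply: (integral_ae_eq_fun mN N0) => y _ yN; rewrite vwx vw//.
Qed.

End ae_operator.

(** * The inner region *)

Section inner.
Context {R : realType} {n : nat}.
Notation mu := (lebesgue_rV R n).

Lemma hyperplane_null (a : 'rV[R]_n) (r : R) : a != 0 -> 0 <= r ->
  mu (slab a 0 r 0) = 0%E.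
Proof.
move=> a0 r0; have [i [ai _]] := exists_large_coord a0.
apply/eqP; rewrite -measure_le0.
by have := slab_volume_le 0 ai r0 (lexx 0); rewrite mul0r !mulr0.
Qed.

(** Against the odd function [J (a.z)], which the principal value ignores, a
    function with gradient [a] and second order bound [M] leaves a remainder of
    order [M |z|^2] times the derivative of [J] at [a.z]. For [p >= 2] that
    derivative is at most [(|a| |z|)^(p-2)]; for [p < 2] it blows up on the
    hyperplane [a.z = 0], but with an exponent [2 - p < 1]. *)
Lemma inner_bound (p s : R) : 1 < p -> 0 < s < 1 ->
  exists2 C : R, 0 <= C & forall (a : 'rV[R]_n) (M r : R) (g : 'rV[R]_n -> R),
    a != 0 -> 0 <= M -> 0 < r -> M * r <= enorm a -> measurable_fun setT g ->
    (forall z, enorm z < r -> `|g z - dotv a z| <= M * enorm z ^+ 2) ->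
    (\int[mu]_(z in eball 0 r) (`|J p (g z) - J p (dotv a z)| * kern p s z)%:E
      <= (C * enorm a `^ (p - 2) * M * r `^ (p - s * p))%:E)%E.
Proof.
move=> p1 /andP[s0 s1]; have p0 : 0 < p by lra.
have e0 : 0 < p - s * p by rewrite -{1}[p]mul1r -mulrBl mulr_gt0// subr_gt0.
(* It is enough to bound the integrand by [M * B], with [B] of known integral,
   off the hyperplane [a.z = 0], which is a null set. *)
have common (B : 'rV[R]_n -> 'rV[R]_n -> R) (C : R) :
    (forall a, a != 0 -> measurable_fun setT (B a)) ->
    (forall a z, 0 <= B a z) -> 0 <= C ->
    (forall (a : 'rV[R]_n) (r : R), a != 0 -> 0 < r ->
      (\int[mu]_(z in pball r) (B a z)%:E <=
         (C * enorm a `^ (p - 2) * r `^ (p - s * p))%:E)%E) ->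
    (forall (a : 'rV[R]_n) (M r : R) (g : 'rV[R]_n -> R) z,
      a != 0 -> 0 <= M -> 0 < r -> M * r <= enorm a ->
      `|g z - dotv a z| <= M * enorm z ^+ 2 -> 0 < enorm z -> enorm z < r ->
      dotv a z != 0 ->
      `|J p (g z) - J p (dotv a z)| * kern p s z <= M * B a z) ->
    exists2 C : R, 0 <= C & forall (a : 'rV[R]_n) (M r : R) (g : 'rV[R]_n -> R),
    a != 0 -> 0 <= M -> 0 < r -> M * r <= enorm a -> measurable_fun setT g ->
    (forall z, enorm z < r -> `|g z - dotv a z| <= M * enorm z ^+ 2) ->
    (\int[mu]_(z in eball 0 r) (`|J p (g z) - J p (dotv a z)| * kern p s z)%:E
      <= (C * enorm a `^ (p - 2) * M * r `^ (p - s * p))%:E)%E.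
  move=> mB B0 C0 intB hB; exists C => // a M r g a0 M0 r0 Mr mg hg.
  set f := fun z => `|J p (g z) - J p (dotv a z)| * kern p s z.
  have mf : measurable_fun setT f.
    apply: measurable_funM; last exact: measurable_kern.
    apply: measurableT_comp => //; apply: measurable_funB.
      exact: measurable_J.
    by apply: measurable_J; exact: measurable_dotv.
  have f0 z : 0 <= f z by rewrite mulr_ge0// kern_ge0.
  have mE : measurable (eball (0 : 'rV[R]_n) r `&` pball r).
    apply: measurableI; first exact: measurable_eball.
    exact: measurable_pball.
  rewrite (@integral_support _ _ _ mu _ (eball 0 r `&` pball r)); last 2 first.
  - move=> z /= zr nz; rewrite /f.
    have -> : z = 0.
      apply/eqP; rewrite -enorm_eq0 eq_le enorm_ge0 andbT leNgt.
      apply/negP => z0; apply: nz; split => //; rewrite /pball /= z0.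
      by rewrite /eball /= subr0 in zr; rewrite ltW.
    have : `|g 0 - dotv a 0| <= 0.
      by have := hg 0; rewrite enorm0 expr0n mulr0; apply.
    rewrite normr_le0 subr_eq0 => /eqP ->.
    by rewrite subrr normr0 mul0r.
  - by move=> z [].
  have mS : measurable (slab a 0 r 0) by exact: measurable_slab.
  rewrite (ge0_negligible_integral mS mE)//; last 3 first.
  - by apply/measurable_EFinP; exact: measurable_funTS.
  - by move=> z _; rewrite lee_fin; exact: f0.
  - by apply: hyperplane_null => //; exact: ltW.
  apply: (@le_trans _ _ (\int[mu]_(z in eball 0 r `&` pball r `\` slab a 0 r 0)
    (M%:E * (B a z)%:E))%E).
    apply: ge0_le_integral => //.
    - exact: measurableD.
    - by move=> z _; rewrite lee_fin; exact: f0.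
    - by apply/measurable_EFinP; exact: measurable_funTS.
    - apply/measurable_EFinP; apply: measurable_funTS; apply: measurable_funM => //.
      exact: mB.
    - move=> z [[zr /= /andP[z0 zr']] nS]; rewrite lee_fin.
      rewrite /eball /= subr0 in zr.
      apply: (hB a M r) => //; first exact: hg.
      apply/eqP => az; apply: nS; split => /=; last by rewrite addr0 az normr0.
      by move=> i; rewrite mxE subr0 (le_trans (ler_coord_enorm _ _)).
  apply: (@le_trans _ _ (\int[mu]_(z in pball r) (M%:E * (B a z)%:E))%E).
    apply: ge0_subset_integral => //.
    - exact: measurableD.
    - exact: measurable_pball.
    - apply/measurable_EFinP; apply: measurable_funTS; apply: measurable_funM => //.
      exact: mB.
    - by move=> z _; rewrite lee_fin mulr_ge0.
    - by move=> z [[_ ?] _].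
  rewrite ge0_integralZl//; first last.
  - by move=> z _; rewrite lee_fin.
  - by apply/measurable_EFinP; apply: measurable_funTS; exact: mB.
  - exact: measurable_pball.
  apply: (@le_trans _ _ (M%:E * (C * enorm a `^ (p - 2) * r `^ (p - s * p))%:E)%E).
    by apply: lee_wpmul2l; [rewrite lee_fin|exact: intB].
  by rewrite -EFinM lee_fin le_eqVlt; apply/orP; left; apply/eqP; ring.
have [p2|p2] := leP 2 p.
- have [C0 C00 hC0] := @integral_power_near R n _ e0.
  pose c : R := (p - 1) * 2 `^ (p - 2).
  have c0 : 0 <= c by rewrite mulr_ge0 ?powR_ge0//; lra.
  apply: (common (fun a z => c * enorm a `^ (p - 2) *
    enorm z `^ (p - s * p - n%:R)) (c * C0)).
  + by move=> a _; apply: measurable_funM => //; exact: measurable_enorm_pow.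
  + by move=> a z; apply: mulr_ge0; [apply: mulr_ge0|]; rewrite ?powR_ge0.
  + exact: mulr_ge0.
  + move=> a r a0 r0.
    under eq_integral do rewrite EFinM.
    rewrite ge0_integralZl//; first last.
    * by rewrite lee_fin; apply: mulr_ge0; rewrite ?powR_ge0.
    * by move=> z _; rewrite lee_fin powR_ge0.
    * by apply/measurable_EFinP; apply: measurable_funTS; exact: measurable_enorm_pow.
    * exact: measurable_pball.
    apply: (@le_trans _ _ ((c * enorm a `^ (p - 2))%:E * (C0 * r `^ (p - s * p))%:E)%E).
      by apply: lee_wpmul2l; [rewrite lee_fin; apply: mulr_ge0; rewrite ?powR_ge0|exact: hC0].
    by rewrite -EFinM lee_fin le_eqVlt; apply/orP; left; apply/eqP; ring.
  + move=> a M r g z a0 M0 r0 Mr hg z0 zr _.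
    have ea0 := enorm_ge0 a.
    have hM : M * enorm z ^+ 2 <= enorm a * enorm z.
      rewrite expr2 mulrA ler_wpM2r ?(ltW z0)// (le_trans _ Mr)//.
      by rewrite ler_wpM2l ?(ltW zr).
    have gz : `|g z| <= 2 * enorm a * enorm z.
      have := ler_normD (g z - dotv a z) (dotv a z); rewrite subrK.
      have := dotv_le a z; lra.
    have mx : Num.max `|g z| `|dotv a z| <= 2 * enorm a * enorm z.
      by rewrite ge_max gz /=; have := dotv_le a z; nra.
    apply: (@le_trans _ _ ((p - 1) * (2 * enorm a * enorm z) `^ (p - 2)
       * (M * enorm z ^+ 2) * kern p s z)).
      apply: ler_wpM2r; first exact: kern_ge0.
      apply: (le_trans (J_diff_ge2 p1 p2 _ _)).
      apply: ler_pM => //.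
        by rewrite mulr_ge0 ?powR_ge0//; lra.
      apply: ler_wpM2l; first lra.
      apply: ler_pow => //; first lra.
    rewrite kernE !powRM ?mulr_ge0 ?(ltW z0)//.
    rewrite (_ : enorm z `^ (p - s * p - n%:R) =
      enorm z `^ (p - 2) * (enorm z ^+ 2 * enorm z `^ (- (n%:R + s * p)))); last first.
      by rewrite -powR_mulrn ?(ltW z0)// -!powD//; congr (_ `^ _); ring.
    by rewrite le_eqVlt; apply/orP; left; apply/eqP; rewrite /c; ring.
- have b01 : 0 < 2 - p < 1 by apply/andP; split; lra.
  have e1 : 0 < n%:R - (2 - p) - (n%:R + s * p - 2).
    by rewrite (_ : _ - _ = p - s * p)//; ring.
  have [C0 C00 hC0] := @integral_dotv_power R n _ _ b01 e1.
  apply: (common (fun a z => 2 * (`|dotv a z| `^ (- (2 - p)) *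
    enorm z `^ (- (n%:R + s * p - 2)))) (2 * C0)).
  + move=> a _; apply: measurable_funM => //.
    apply: measurable_funM; first exact: measurable_dotv_pow.
    exact: measurable_enorm_pow.
  + by move=> a z; rewrite !mulr_ge0 ?powR_ge0.
  + by rewrite mulr_ge0.
  + move=> a r a0 r0.
    under eq_integral do rewrite EFinM.
    rewrite ge0_integralZl//; first last.
    * by move=> z _; rewrite lee_fin mulr_ge0 ?powR_ge0.
    * apply/measurable_EFinP; apply: measurable_funTS; apply: measurable_funM.
        exact: measurable_dotv_pow.
      exact: measurable_enorm_pow.
    * exact: measurable_pball.
    have := hC0 a r a0 r0.
    rewrite (_ : n%:R - (2 - p) - _ = p - s * p); last by ring.
    rewrite (_ : - (2 - p) = p - 2); last by ring.
    move=> h; apply: (le_trans (lee_wpmul2l _ h)) => //.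
    by rewrite -EFinM lee_fin le_eqVlt; apply/orP; left; apply/eqP; ring.
  + move=> a M r g z a0 M0 r0 Mr hg z0 zr az.
    rewrite (_ : - (2 - p) = p - 2); last by ring.
    rewrite (_ : enorm z `^ (- (n%:R + s * p - 2)) =
      enorm z ^+ 2 * enorm z `^ (- (n%:R + s * p))); last first.
      by rewrite -powR_mulrn ?(ltW z0)// -!powD//; congr (_ `^ _); ring.
    rewrite kernE.
    rewrite (_ : M * _ = 2 * `|dotv a z| `^ (p - 2) * (M * enorm z ^+ 2) *
       enorm z `^ (- (n%:R + s * p))); last by ring.
    apply: ler_wpM2r; first exact: powR_ge0.
    apply: (le_trans (J_diff_le2_lin p1 (ltW p2) _ az)).
    by apply: ler_wpM2l => //; rewrite mulr_ge0 ?powR_ge0.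
Qed.

End inner.

(** * Derivatives of the test functions *)

Section continuity_at_a_point.
Context {R : realType} {T : topologicalType} {V : normedModType R}.
Implicit Types w : T.

Lemma continuousD_at (f g : T -> V) w : {for w, continuous f} ->
  {for w, continuous g} -> {for w, continuous (fun y => f y + g y)}.
Proof. exact: continuousD. Qed.

Lemma continuousB_at (f g : T -> V) w : {for w, continuous f} ->
  {for w, continuous g} -> {for w, continuous (fun y => f y - g y)}.
Proof. exact: continuousB. Qed.

Lemma continuousM_at (f g : T -> R) w : {for w, continuous f} ->
  {for w, continuous g} -> {for w, continuous (fun y => f y * g y)}.
Proof. exact: continuousM. Qed.

Lemma continuous_cst_at (c : R) w : {for w, continuous (fun _ : T => c)}.
Proof. exact: (@cst_continuous _ _ c w). Qed.

End continuity_at_a_point.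

Section test_functions.
Context {R : realType} {n : nat}.
Implicit Types (x v b : 'rV[R]_n) (i j : 'I_n).

Definition sqd b x : R := enorm (x - b) ^+ 2.

Lemma sqd_line b x v (h : R) :
  sqd b (h *: v + x) =
  sqd b x + 2 * h * dotv v (x - b) + h ^+ 2 * enorm v ^+ 2.
Proof.
rewrite /sqd (_ : h *: v + x - b = (x - b) + h *: v); last by rewrite -addrA addrC.
rewrite enormD_sqr dotvZr enormZ exprMn real_normK ?num_real//.
by rewrite dotvC; ring.
Qed.

(** A directional derivative is the derivative of a function of one variable. *)
Lemma is_derive_line (f : 'rV[R]_n -> R) x v (d : R) :
  is_derive (0 : R) 1 (fun h : R => f (h *: v + x)) d -> is_derive x v f d.
Proof.
have E : (fun h : R => h^-1 *: (((fun h : R => f (h *: v + x)) \o shift 0) (h *: 1) - f (0 *: v + x)))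
   = (fun h : R => h^-1 *: ((f \o shift x) (h *: v) - f x)).
  apply/funext => h /=; rewrite addr0 scale0r add0r.
  by rewrite (_ : h *: 1 = h)//; exact: mulr1.
move=> [df dE]; split.
  by move: df; rewrite /derivable E.
by move: dE; rewrite /derive E.
Qed.

Lemma is_derive_quadratic (S d w : R) :
  is_derive (0 : R) 1 (fun h : R => S + d * h + w * (h * h)) d.
Proof.
have hi := @is_derive_id R R 0 1.
have h1 := is_deriveZ d hi.
have h2 := is_deriveZ w (is_deriveM hi hi).
have h := is_deriveD (is_deriveD (is_derive_cst S (0 : R) 1) h1) h2.
apply: (@is_derive_eq _ _ _ _ _ _ _ _ h).
rewrite add0r scale0r addr0 scaler0 addr0.
exact: mulr1.
Qed.

Lemma is_derive_sqd_line b x v :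
  is_derive (0 : R) 1 (fun h : R => sqd b (h *: v + x)) (2 * dotv v (x - b)).
Proof.
rewrite (_ : (fun h : R => _) =
    fun h => sqd b x + (2 * dotv v (x - b)) * h + enorm v ^+ 2 * (h * h)).
  exact: is_derive_quadratic.
by apply/funext => h; rewrite sqd_line; ring.
Qed.

Lemma is_derive_sqd b x v : is_derive x v (sqd b) (2 * dotv v (x - b)).
Proof. exact/is_derive_line/is_derive_sqd_line. Qed.

Definition sqd_pow (be : R) b x : R := sqd b x `^ be.

Lemma is_derive_sqd_pow (be : R) b x v : 0 < sqd b x ->
  is_derive x v (sqd_pow be b)
    (be * sqd b x `^ (be - 1) * (2 * dotv v (x - b))).
Proof.
move=> s0; apply: is_derive_line.
have E : sqd b (0 *: v + x) = sqd b x by rewrite scale0r add0r.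
rewrite (_ : (fun h : R => _) = (@powR R ^~ be) \o (fun h : R => sqd b (h *: v + x)))//.
apply: is_derive1_comp; last exact: is_derive_sqd_line.
by rewrite E; exact: is_derive1_powR.
Qed.

Lemma is_derive_coord i b x v :
  is_derive x v (fun y : 'rV[R]_n => y ord0 i - b ord0 i) (v ord0 i).
Proof.
apply: is_derive_line.
rewrite (_ : (fun h : R => _) =
    fun h => (x ord0 i - b ord0 i) + v ord0 i * h + 0 * (h * h)).
  exact: is_derive_quadratic.
by apply/funext => h; rewrite !mxE; ring.
Qed.

Lemma continuous_coord i : continuous (fun y : 'rV[R]_n => y ord0 i).
Proof. exact: coord_continuous. Qed.

Lemma continuous_coordB b x i :
  {for x, continuous (fun y : 'rV[R]_n => y ord0 i - b ord0 i)}.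
Proof.
have h : {for x, continuous (fun y : 'rV[R]_n => y ord0 i)} := @continuous_coord i x.
exact: (@continuousB _ _ _ _ (cst (b ord0 i)) x h (@cst_continuous _ _ _ _)).
Qed.

Lemma continuous_sqd b : continuous (sqd b).
Proof.
rewrite (_ : sqd b = fun y => \sum_i (y ord0 i - b ord0 i) ^+ 2).
  move=> x; apply: cvg_big; first exact: pseudometric_normed_Zmodule.add_continuous.
    exact: (nbhs_filter x).
  move=> i _.
  apply: (@continuous_comp _ _ _ (fun y : 'rV[R]_n => y ord0 i - b ord0 i) (fun t : R => t ^+ 2)).
    exact: continuous_coordB.
  exact: exprn_continuous.
apply/funext => y; rewrite /sqd enorm_sqr; apply: eq_bigr => i _.
by rewrite !mxE.
Qed.

Lemma continuous_enorm : continuous (fun y : 'rV[R]_n => enorm y).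
Proof.
rewrite (_ : (fun y => _) = Num.sqrt \o sqd 0).
  move=> x; apply: continuous_comp; [exact: continuous_sqd|exact: sqrt_continuous].
by apply/funext => y; rewrite /= /sqd subr0 sqrtr_sqr ger0_norm// enorm_ge0.
Qed.

Lemma continuous_powR (be t : R) : 0 < t -> {for t, continuous (@powR R ^~ be)}.
Proof.
move=> t0; apply: differentiable_continuous; apply/derivable1_diffP.
exact: (@ex_derive _ _ _ _ _ _ _ (is_derive1_powR be t0)).
Qed.

Lemma continuous_sqd_pow (be : R) b x : 0 < sqd b x ->
  {for x, continuous (sqd_pow be b)}.
Proof.
move=> s0; apply: (@continuous_comp _ _ _ (sqd b) (@powR R ^~ be)).
  exact: continuous_sqd.
exact: continuous_powR.
Qed.

(** A combination of two powers of [|x - b|], written as powers of [|x - b|^2] so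
    that the chain rule applies to a quadratic polynomial, and of the quadratic
    localization [|x - b'|^2]. *)
Definition testf (A B al be m c : R) b b' x : R :=
  A * sqd_pow al b x + B * sqd_pow be b x + m * sqd b' x + c.

(** The factor of [x - b] in the gradient of a radial function. *)
Definition radial (A B al be : R) b x : R :=
  A * (al * sqd_pow (al - 1) b x * 2) + B * (be * sqd_pow (be - 1) b x * 2).

Lemma is_derive_testf A B al be m c b b' x v : 0 < sqd b x ->
  is_derive x v (testf A B al be m c b b')
    (radial A B al be b x * dotv v (x - b) + 2 * m * dotv v (x - b')).
Proof.
move=> s0; rewrite (_ : testf _ _ _ _ _ _ _ _ = A *: sqd_pow al b + B *: sqd_pow be b
   + m *: sqd b' + cst c); last by apply/funext => y; rewrite !fctE.
have h1 := is_derive_sqd_pow al v s0; have h2 := is_derive_sqd_pow be v s0.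
have h3 := is_derive_sqd b' x v.
have h := is_deriveD (is_deriveD (is_deriveD (is_deriveZ A h1) (is_deriveZ B h2))
  (is_deriveZ m h3)) (is_derive_cst c x v).
apply: (@is_derive_eq _ _ _ _ _ _ _ _ h).
rewrite -!mulrA /GRing.scale /= /radial /sqd_pow; ring.
Qed.

(** The same factor for the gradient of [radial]. *)
Definition radial2 (A B al be : R) b x : R :=
  A * (al * ((al - 1) * sqd_pow (al - 1 - 1) b x * 2) * 2) +
  B * (be * ((be - 1) * sqd_pow (be - 1 - 1) b x * 2) * 2).

Lemma is_derive_radial A B al be b x v : 0 < sqd b x ->
  is_derive x v (radial A B al be b) (radial2 A B al be b x * dotv v (x - b)).
Proof.
move=> s0; rewrite (_ : radial _ _ _ _ _ =
   (A * al * 2) *: sqd_pow (al - 1) b + (B * be * 2) *: sqd_pow (be - 1) b); last first.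
  by apply/funext => y; rewrite !fctE /GRing.scale /= /radial; ring.
have h1 := is_derive_sqd_pow (al - 1) v s0; have h2 := is_derive_sqd_pow (be - 1) v s0.
have h := is_deriveD (is_deriveZ (A * al * 2) h1) (is_deriveZ (B * be * 2) h2).
apply: (@is_derive_eq _ _ _ _ _ _ _ _ h).
rewrite /GRing.scale /= /radial2 /sqd_pow; ring.
Qed.

Lemma dotv_delta i x : dotv (delta_mx ord0 i) x = x ord0 i.
Proof.
rewrite /dotv (bigD1 i)//= !mxE !eqxx mul1r big1 ?addr0// => j ji.
by rewrite mxE (negbTE ji) mul0r.
Qed.

Lemma partial_testf A B al be m c b b' x i : 0 < sqd b x ->
  partial i (testf A B al be m c b b') x =
  radial A B al be b x * (x ord0 i - b ord0 i) + 2 * m * (x ord0 i - b' ord0 i).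
Proof.
move=> s0; rewrite /partial.
have h := is_derive_testf A B al be m c b' (delta_mx ord0 i) s0.
by rewrite derive_val !dotv_delta !mxE.
Qed.

Lemma grad_testf A B al be m c b b' x : 0 < sqd b x ->
  grad (testf A B al be m c b b') x =
  radial A B al be b x *: (x - b) + (2 * m) *: (x - b').
Proof.
by move=> s0; apply/rowP => i; rewrite !mxE partial_testf.
Qed.

Lemma near_sqd_gt0 b x : 0 < sqd b x -> \forall y \near x, 0 < sqd b y.
Proof.
move=> s0; have := @continuous_sqd b x => /cvgrPdist_lt /(_ _ s0).
apply: filterS => y; rewrite ltr_distlC subrr => /andP[].
by [].
Qed.

(** The formula for the first derivatives holds in a neighbourhood, which is what
    is needed to differentiate it again. *)
Lemma near_partial_testf A B al be m c b b' x i : 0 < sqd b x ->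
  \forall y \near x, radial A B al be b y * (y ord0 i - b ord0 i) +
    2 * m * (y ord0 i - b' ord0 i) = partial i (testf A B al be m c b b') y.
Proof.
move=> /near_sqd_gt0; apply: filterS => y s0.
by rewrite partial_testf.
Qed.

Lemma is_derive_partial_testf A B al be m c b b' x v i : 0 < sqd b x ->
  is_derive x v (partial i (testf A B al be m c b b'))
   (radial2 A B al be b x * dotv v (x - b) * (x ord0 i - b ord0 i) +
    radial A B al be b x * v ord0 i + 2 * m * v ord0 i).
Proof.
move=> s0; apply: (near_eq_is_derive (near_partial_testf A B al be m c b' i s0)).
rewrite (_ : (fun y => _) = radial A B al be b * (fun y : 'rV[R]_n => y ord0 i - b ord0 i)
  + (2 * m) *: (fun y : 'rV[R]_n => y ord0 i - b' ord0 i)); last first.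
  by apply/funext => y; rewrite !fctE.
have h1 := is_derive_radial A B al be v s0.
have h2 := is_derive_coord i b x v; have h3 := is_derive_coord i b' x v.
have h := is_deriveD (is_deriveM h1 h2) (is_deriveZ (2 * m) h3).
apply: (@is_derive_eq _ _ _ _ _ _ _ _ h).
rewrite /GRing.scale /=; ring.
Qed.

Lemma continuous_radial A B al be b x : 0 < sqd b x ->
  {for x, continuous (radial A B al be b)}.
Proof.
move=> s0; have h1 := @continuous_sqd_pow (al - 1) b x s0.
have h2 := @continuous_sqd_pow (be - 1) b x s0.
have c k := @continuous_cst_at R _ k x; have M := @continuousM_at R 'rV[R]_n.
exact: (continuousD_at (M _ _ _ (c A) (M _ _ _ (M _ _ _ (c al) h1) (c 2)))
  (M _ _ _ (c B) (M _ _ _ (M _ _ _ (c be) h2) (c 2)))).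
Qed.

Lemma continuous_radial2 A B al be b x : 0 < sqd b x ->
  {for x, continuous (radial2 A B al be b)}.
Proof.
move=> s0; have h1 := @continuous_sqd_pow (al - 1 - 1) b x s0.
have h2 := @continuous_sqd_pow (be - 1 - 1) b x s0.
have c k := @continuous_cst_at R _ k x; have M := @continuousM_at R 'rV[R]_n.
exact: (continuousD_at
  (M _ _ _ (c A) (M _ _ _ (M _ _ _ (c al) (M _ _ _ (M _ _ _ (c (al - 1)) h1) (c 2))) (c 2)))
  (M _ _ _ (c B) (M _ _ _ (M _ _ _ (c be) (M _ _ _ (M _ _ _ (c (be - 1)) h2) (c 2))) (c 2)))).
Qed.

Lemma C2_testf A B al be m c b b' (D : set 'rV[R]_n) :
  (forall x, D x -> 0 < sqd b x) -> C2_on D (testf A B al be m c b b').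
Proof.
move=> Dpos x /Dpos s0.
have h1 := @continuous_sqd_pow al b x s0; have h2 := @continuous_sqd_pow be b x s0.
have h3 : {for x, continuous (sqd b')} by exact: continuous_sqd.
have h4 := @continuous_radial A B al be b x s0.
have h5 := @continuous_radial2 A B al be b x s0.
have k t := @continuous_cst_at R _ t x; have M := @continuousM_at R 'rV[R]_n.
split.
- exact: (continuousD_at (continuousD_at (continuousD_at (M _ _ _ (k A) h1)
    (M _ _ _ (k B) h2)) (M _ _ _ (k m) h3)) (k c)).
- move=> i; split.
    have h := is_derive_testf A B al be m c b' (delta_mx ord0 i) s0.
    exact: ex_derive.
  have E := partial_testf A B al be m c b' i s0.
  set f := testf _ _ _ _ _ _ _ _ in E *.
  change (partial i f y @[y --> x] --> partial i f x); rewrite [X in _ --> X]E /f.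
  apply: (cvg_trans (near_eq_cvg (near_partial_testf A B al be m c b' i s0))).
  exact: (continuousD_at (M _ _ _ h4 (@continuous_coordB b x i))
    (M _ _ _ (k (2 * m)) (@continuous_coordB b' x i))).
- move=> i j; split.
    have h := is_derive_partial_testf A B al be m c b' (delta_mx ord0 j) i s0.
    exact: ex_derive.
  set f := testf _ _ _ _ _ _ _ _.
  pose S y := radial2 A B al be b y * (y ord0 j - b ord0 j) * (y ord0 i - b ord0 i) +
    radial A B al be b y * (delta_mx ord0 j : 'rV[R]_n) ord0 i
    + 2 * m * (delta_mx ord0 j : 'rV[R]_n) ord0 i.
  have SE y : 0 < sqd b y -> S y = partial j (partial i f) y.
    move=> sy; rewrite /partial.
    have h := is_derive_partial_testf A B al be m c b' (delta_mx ord0 j) i sy.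
    by rewrite /f /S (@derive_val _ _ _ _ _ _ _ h) dotv_delta !mxE.
  change (partial j (partial i f) y @[y --> x] --> partial j (partial i f) x).
  rewrite -[X in _ --> X]SE//.
  have nS : \forall y \near x, S y = partial j (partial i f) y.
    by apply: (filterS _ (near_sqd_gt0 s0)) => y; exact: SE.
  apply: (cvg_trans (near_eq_cvg nS)).
  exact: (continuousD_at (continuousD_at
    (M _ _ _ (M _ _ _ h5 (@continuous_coordB b x j)) (@continuous_coordB b x i))
    (M _ _ _ h4 (k _))) (k _)).
Qed.

End test_functions.

(** * Taylor expansion of the test functions *)

Section taylor.
Context {R : realType}.

Lemma pow_mvt (be x y : R) : 0 < x -> 0 < y ->
  exists c : R, [/\ Num.min x y <= c, c <= Num.max x y &
    x `^ be - y `^ be = be * c `^ (be - 1) * (x - y)].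
Proof.
wlog xy : x y / x <= y => [hw x0 y0|x0 y0].
  have /orP[xy|yx] := le_total x y; first exact: hw.
  have [c [c1 c2 c3]] := hw _ _ yx y0 x0; exists c; split.
  - by rewrite minC.
  - by rewrite maxC.
  - by rewrite -opprB c3 -mulrN opprB.
rewrite min_l// max_r//.
have der z : z \in `]x, y[ -> is_derive z 1 (@powR R ^~ be) (be * z `^ (be - 1)).
  by rewrite in_itv /= => /andP[xz _]; apply: is_derive1_powR; exact: lt_trans xz.
have cont : {within `[x, y], continuous (@powR R ^~ be)}.
  apply: continuous_in_subspaceT => z; rewrite inE /= in_itv /= => /andP[xz _].
  by apply: continuous_powR; exact: lt_le_trans xz.
have [c cxy cE] := MVT_segment xy der cont.
move: cxy; rewrite in_itv /= => /andP[? ?]; exists c; split => //.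
by rewrite -opprB cE -mulrN opprB.
Qed.

(** Two applications of the mean value theorem. The interval is that of the
    values of [|x + z|^2 / |x|^2] when [|z| <= |x| / 2]. *)
Lemma pow_taylor (be : R) : exists2 C : R, 0 <= C & forall x : R,
  1 / 4 <= x <= 4 -> `|x `^ be - 1 - be * (x - 1)| <= C * (x - 1) ^+ 2.
Proof.
exists (`|be| * (`|be - 1| * 4 `^ `|be - 1 - 1|)).
  by rewrite !mulr_ge0 ?powR_ge0.
move=> x /andP[x1 x4].
have x0 : 0 < x by apply: lt_le_trans x1; rewrite divr_gt0.
have bnd (y z c : R) : 1/4 <= y <= 4 -> 1/4 <= z <= 4 -> Num.min y z <= c -> c <= Num.max y z ->
    1/4 <= c <= 4.
  move=> /andP[? ?] /andP[? ?] h1 h2; apply/andP; split.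
    by apply: le_trans h1; rewrite le_min; apply/andP.
  by apply: (le_trans h2); rewrite ge_max; apply/andP.
have b1 : 1/4 <= (1 : R) <= 4 by apply/andP; split; lra.
have bx : 1/4 <= x <= 4 by apply/andP.
have [c [c1 c2]] := pow_mvt be x0 ltr01; rewrite powR1 => ->.
have bc := bnd _ _ _ bx b1 c1 c2; have c0 : 0 < c by lra.
have [d [d1 d2]] := pow_mvt (be - 1) c0 ltr01; rewrite powR1 => dE.
have bd := bnd _ _ _ bc b1 d1 d2; have d0 : 0 < d by lra.
rewrite -mulrBl -[X in _ - X]mulr1 -mulrBr dE !normrM.
have cx : `|c - 1| <= `|x - 1|.
  have [x1'|/ltW x1'] := leP 1 x.
    rewrite min_r// in c1; rewrite max_l// in c2.
    by rewrite !ger0_norm ?subr_ge0// lerD2r.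
  rewrite min_l// in c1; rewrite max_r// in c2.
  by rewrite !ler0_norm ?subr_le0// lerN2 lerD2r.
have dp : `|d `^ (be - 1 - 1)| <= 4 `^ `|be - 1 - 1|.
  rewrite ger0_norm ?powR_ge0//.
  have [b0|/ltW b0] := leP 0 (be - 1 - 1); first by rewrite (ger0_norm b0); apply: ler_pow => //; lra.
  rewrite ler0_norm//; have d4 : 4^-1 <= d by lra.
  by apply: (le_trans (ler_pow_neg b0 _ d4)); rewrite ?invr_gt0// powV.
rewrite -[(x - 1) ^+ 2]real_normK ?num_real// expr2 !mulrA.
apply: ler_wpM2r => //; rewrite -!mulrA.
do 2 (apply: ler_wpM2l => //); exact: ler_pM.
Qed.

End taylor.

Section taylor_testf.
Context {R : realType} {n : nat}.
Implicit Types (x z b : 'rV[R]_n).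

Lemma sqd_addr b x z : sqd b (x + z) = sqd b x + 2 * dotv (x - b) z + enorm z ^+ 2.
Proof.
by rewrite /sqd (_ : x + z - b = x - b + z) ?enormD_sqr// addrAC.
Qed.

Lemma sqd_powE (ga : R) b x : sqd_pow (ga / 2) b x = enorm (x - b) `^ ga.
Proof.
by rewrite /sqd_pow /sqd -powR_mulrn ?enorm_ge0// -powRrM mulrC divfK.
Qed.

(** By homogeneity this is [pow_taylor] at the ratio [w] of the squared
    distances. *)
Lemma sqd_pow_taylor (ga : R) : exists2 C : R, 0 <= C & forall b x z,
  0 < enorm (x - b) -> enorm z <= enorm (x - b) / 2 ->
  `|sqd_pow (ga / 2) b (x + z) - sqd_pow (ga / 2) b x
     - ga / 2 * sqd_pow (ga / 2 - 1) b x * (2 * dotv (x - b) z)|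
   <= C * enorm (x - b) `^ (ga - 2) * enorm z ^+ 2.
Proof.
set be := ga / 2.
have [C C0 hC] := pow_taylor be.
exists (C * (25 / 4) + `|be|); first by rewrite addr_ge0// mulr_ge0// divr_ge0.
move=> b x z t0 zt; set t := enorm (x - b) in t0 zt *.
have t20 : 0 < t ^+ 2 by rewrite exprn_gt0.
pose w := sqd b (x + z) / t ^+ 2.
have sx : sqd b x = t ^+ 2 by [].
have wE : sqd b (x + z) = t ^+ 2 * w by rewrite /w mulrC divfK// gt_eqF.
have w1 : w - 1 = (2 * dotv (x - b) z + enorm z ^+ 2) / t ^+ 2.
  by rewrite /w sqd_addr sx; field; rewrite gt_eqF.
have dle : `|dotv (x - b) z| <= t * enorm z by exact: dotv_le.
have z0 := enorm_ge0 z.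
have w0 : 1/4 <= w <= 4.
  have lo : t / 2 <= enorm (x - b + z).
    have := enorm_ge_sub (x - b) z; rewrite -/t; lra.
  have hi : enorm (x - b + z) <= 2 * t.
    have := enormD (x - b) z; rewrite -/t; lra.
  have -> : w = (enorm (x - b + z) / t) ^+ 2.
    by rewrite /w /sqd expr_div_n (_ : x + z - b = x - b + z)// addrAC.
  set y := enorm _ / t.
  have y1 : 1/2 <= y by rewrite /y ler_pdivlMr//; lra.
  have y2 : y <= 2 by rewrite /y ler_pdivrMr.
  apply/andP; split; nra.
have w2 : (w - 1) ^+ 2 <= 25 / 4 * (enorm z ^+ 2 / t ^+ 2).
  rewrite w1 expr_div_n.
  have num : (2 * dotv (x - b) z + enorm z ^+ 2) ^+ 2 <= 25 / 4 * (t ^+ 2 * enorm z ^+ 2).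
    have : `|2 * dotv (x - b) z + enorm z ^+ 2| <= 5 / 2 * (t * enorm z).
      apply: (le_trans (ler_normD _ _)); rewrite normrM (ger0_norm (ler0n _ 2)).
      have zz : enorm z ^+ 2 <= t / 2 * enorm z by rewrite expr2 ler_wpM2r.
      rewrite (ger0_norm (sqr_ge0 (enorm z))); lra.
    move=> h; rewrite -[X in X <= _]real_normK ?num_real//.
    have -> : 25 / 4 * (t ^+ 2 * enorm z ^+ 2) = (5 / 2 * (t * enorm z)) ^+ 2 by field.
    by rewrite ler_pXn2r// nnegrE// (le_trans _ h).
  rewrite ler_pdivrMr ?exprn_gt0//.
  rewrite (_ : _ * t ^+ 2 ^+ 2 = 25 / 4 * (t ^+ 2 * enorm z ^+ 2))//.
  by field; rewrite gt_eqF.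
have tp : (t ^+ 2) `^ be = t `^ (ga - 2) * t ^+ 2.
  rewrite -[t ^+ 2 in RHS]powR_mulrn ?(ltW t0)// -powD// subrK.
  by rewrite -powR_mulrn ?(ltW t0)// -powRrM /be mulrC divfK.
have tp1 : (t ^+ 2) `^ (be - 1) = t `^ (ga - 2).
  by rewrite powB// tp powRr1 ?(ltW t20)// mulfK// gt_eqF.
rewrite /sqd_pow sx wE powRM ?(ltW t20)//; last by lra.
rewrite tp1 tp.
have -> : t `^ (ga - 2) * t ^+ 2 * w `^ be - t `^ (ga - 2) * t ^+ 2 -
    be * t `^ (ga - 2) * (2 * dotv (x - b) z) =
  t `^ (ga - 2) * (t ^+ 2 * (w `^ be - 1 - be * (w - 1)) + be * enorm z ^+ 2).
  by rewrite w1; field; rewrite gt_eqF.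
rewrite normrM (ger0_norm (powR_ge0 _ _)).
rewrite [X in _ <= X](_ : _ = t `^ (ga - 2) * ((C * (25 / 4) + `|be|) * enorm z ^+ 2)); last by ring.
apply: ler_wpM2l; first exact: powR_ge0.
apply: (le_trans (ler_normD _ _)); rewrite mulrDl; apply: lerD.
  rewrite normrM (ger0_norm (ltW t20)).
  apply: (@le_trans _ _ (t ^+ 2 * (C * (25 / 4 * (enorm z ^+ 2 / t ^+ 2))))).
    apply: ler_wpM2l; first exact: ltW.
    by apply: (le_trans (hC _ w0)); apply: ler_wpM2l.
  by rewrite le_eqVlt; apply/orP; left; apply/eqP; field; rewrite gt_eqF.
by rewrite normrM (ger0_norm (sqr_ge0 (enorm z))).
Qed.

(** The second derivatives are of the order of [t^(ga - 2)] at distance [t] from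
    the singular point, and the increment stays away from that point. *)
Lemma testf_taylor (ga de : R) : exists2 C : R, 0 <= C & forall A B m c b b' x z f,
  f = testf A B (ga / 2) (de / 2) m c b b' ->
  0 < enorm (x - b) -> enorm z <= enorm (x - b) / 2 ->
  `|f (x + z) - f x - dotv (grad f x) z| <=
  (C * (`|A| * enorm (x - b) `^ (ga - 2) + `|B| * enorm (x - b) `^ (de - 2)) + `|m|)
    * enorm z ^+ 2.
Proof.
have [C1 C10 h1] := sqd_pow_taylor ga; have [C2 C20 h2] := sqd_pow_taylor de.
exists (C1 + C2); first exact: addr_ge0.
move=> A B m c b b' x z f -> t0 zt.
rewrite grad_testf; last by rewrite /sqd exprn_gt0.
rewrite dotvDl !dotvZl.
have {}h1 := h1 _ _ _ t0 zt; have {}h2 := h2 _ _ _ t0 zt.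
rewrite /testf sqd_addr /radial.
set X1 := _ - _ - _ in h1; set X2 := _ - _ - _ in h2.
rewrite (_ : _ - _ - _ = A * X1 + B * X2 + m * enorm z ^+ 2); last first.
  rewrite /X1 /X2; move: (sqd_pow (ga / 2) b (x + z)) (sqd_pow (ga / 2) b x)
    (sqd_pow (ga / 2 - 1) b x) (sqd_pow (de / 2) b (x + z)) (sqd_pow (de / 2) b x)
    (sqd_pow (de / 2 - 1) b x) (sqd b' x) (dotv (x - b) z) (dotv (x - b') z) (enorm z).
  by move=> *; ring.
set T1 := enorm (x - b) `^ (ga - 2) in h1 *; set T2 := enorm (x - b) `^ (de - 2) in h2 *.
have T10 : 0 <= T1 by exact: powR_ge0.
have T20 : 0 <= T2 by exact: powR_ge0.
apply: (le_trans (ler_normD _ _)).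
apply: (@le_trans _ _ ((`|A| * (C1 * T1 * enorm z ^+ 2) + `|B| * (C2 * T2 * enorm z ^+ 2)) +
   `|m| * enorm z ^+ 2)).
  apply: lerD; last by rewrite normrM (ger0_norm (sqr_ge0 _)).
  by apply: (le_trans (ler_normD _ _)); rewrite !normrM; apply: lerD; apply: ler_wpM2l.
rewrite mulrDl lerD2r.
have -> : `|A| * (C1 * T1 * enorm z ^+ 2) + `|B| * (C2 * T2 * enorm z ^+ 2) =
  (`|A| * (C1 * T1) + `|B| * (C2 * T2)) * enorm z ^+ 2 by ring.
apply: ler_wpM2r; first exact: sqr_ge0.
have : 0 <= `|A| * T1 * C2 by rewrite !mulr_ge0.
have : 0 <= `|B| * T2 * C1 by rewrite !mulr_ge0.
lra.
Qed.

End taylor_testf.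

(** * Decomposition of the integrals into three regions *)

Section integral_tools.
Context d (T : measurableType d) (R : realType).
Variable mu : {measure set T -> \bar R}.
Implicit Types f g : T -> R.

Lemma normr_Rintegral_le (D : set T) f (c : R) : measurable D ->
  mu.-integrable D (EFin \o f) -> (\int[mu]_(x in D) (`|f x|)%:E <= c%:E)%E ->
  `|\int[mu]_(x in D) f x| <= c.
Proof.
move=> mD intf fc; apply: (le_trans (le_normr_Rintegral mD intf)).
rewrite -lee_fin /Rintegral fineK//.
by apply: integrable_fin_num => //; exact: integrable_norm.
Qed.

Lemma Rintegral_le (D : set T) f (c : R) : measurable D ->
  mu.-integrable D (EFin \o f) -> (\int[mu]_(x in D) (`|f x|)%:E <= c%:E)%E ->
  \int[mu]_(x in D) f x <= c.
Proof.
by move=> mD intf fc; apply: (le_trans (ler_norm _)); exact: normr_Rintegral_le.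
Qed.

Lemma integrable_of_bound (D : set T) f (c : R) : measurable D ->
  measurable_fun setT f -> (\int[mu]_(x in D) (`|f x|)%:E <= c%:E)%E ->
  mu.-integrable D (EFin \o f).
Proof.
move=> mD mf fc; apply/integrableP; split.
  by apply/measurable_EFinP; exact: measurable_funTS.
by apply: le_lt_trans fc _; rewrite ltry.
Qed.

Lemma integrable_setU (D E : set T) f : measurable D -> measurable E ->
  measurable_fun setT f ->
  mu.-integrable D (EFin \o f) -> mu.-integrable E (EFin \o f) ->
  [disjoint D & E] -> mu.-integrable (D `|` E) (EFin \o f).
Proof.
move=> mD mE mf /integrableP[_ fD] /integrableP[_ fE] DE.
apply/integrableP; split; first by apply/measurable_EFinP; exact: measurable_funTS.
rewrite ge0_integral_setU//; first exact: lte_add_pinfty.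
apply: measurableT_comp => //.
by apply/measurable_EFinP; exact: measurable_funTS.
Qed.

End integral_tools.

Section three_regions.
Context {R : realType} {n : nat}.
Notation mu := (lebesgue_rV R n).

Definition mid_region (r d : R) : set 'rV[R]_n := [set z | r <= enorm z < d].
Definition far_region (d : R) : set 'rV[R]_n := [set z | d <= enorm z].

Lemma measurable_mid_region r d : measurable (mid_region r d).
Proof.
rewrite (_ : mid_region r d = [set z : 'rV[R]_n | enorm z \in `[r, d[]).
  exact: measurable_preimage_itv measurable_enorm1.
by apply/seteqP; split => x /=; rewrite in_itv.
Qed.

Lemma measurable_far_region d : measurable (far_region d).
Proof.
rewrite (_ : far_region d = [set z : 'rV[R]_n | enorm z \in `[d, +oo[]).
  exact: measurable_preimage_itv measurable_enorm1.
by apply/seteqP; split => x /=; rewrite in_itv /= andbT.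
Qed.

Lemma three_regions (r d : R) : r <= d ->
  (eball 0 r `|` mid_region r d) `|` far_region d = [set: 'rV[R]_n].
Proof.
move=> rd; apply/seteqP; split => // z _.
rewrite /eball /mid_region /far_region /= subr0.
have [zr|rz] := ltP (enorm z) r; first by left; left.
by have [zd|dz] := ltP (enorm z) d; [left; right|right].
Qed.

Lemma disjoint_inner_mid (r d : R) : [disjoint eball (0 : 'rV[R]_n) r & mid_region r d].
Proof.
apply/disj_setPS => z [] /=; rewrite /eball /mid_region /= subr0.
by move=> zr /andP[rz _]; have := lt_le_trans zr rz; rewrite ltxx.
Qed.

Lemma disjoint_far (r d : R) : r <= d ->
  [disjoint eball (0 : 'rV[R]_n) r `|` mid_region r d & far_region d].
Proof.
move=> rd; apply/disj_setPS => z [] /=; rewrite /eball /mid_region /far_region /= subr0.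
move=> [zr|/andP[_ zd]] dz.
  by have := lt_le_trans zr (le_trans rd dz); rewrite ltxx.
by have := lt_le_trans zd dz; rewrite ltxx.
Qed.

Lemma integrable_three_regions (f : 'rV[R]_n -> R) (r d : R) : r <= d ->
  measurable_fun setT f ->
  mu.-integrable (eball 0 r) (EFin \o f) ->
  mu.-integrable (mid_region r d) (EFin \o f) ->
  mu.-integrable (far_region d) (EFin \o f) ->
  mu.-integrable setT (EFin \o f).
Proof.
move=> rd mf f1 f2 f3; rewrite -(three_regions rd).
have m1 := @measurable_eball R n 0 r; have m2 := measurable_mid_region r d.
have m3 := measurable_far_region d.
apply: integrable_setU => //; first exact: measurableU.
  by apply: integrable_setU => //; exact: disjoint_inner_mid.
exact: disjoint_far.
Qed.

Lemma Rintegral_three_regions (f : 'rV[R]_n -> R) (r d : R) : r <= d ->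
  mu.-integrable setT (EFin \o f) ->
  \int[mu]_z f z = \int[mu]_(z in eball 0 r) f z +
    \int[mu]_(z in mid_region r d) f z + \int[mu]_(z in far_region d) f z.
Proof.
move=> rd intf; rewrite -[in LHS](three_regions rd).
have m1 := @measurable_eball R n 0 r; have m2 := measurable_mid_region r d.
have m3 := measurable_far_region d.
have m12 : measurable (eball (0 : 'rV[R]_n) r `|` mid_region r d) by exact: measurableU.
rewrite Rintegral_setU//; last 2 first.
- by rewrite (three_regions rd).
- exact: disjoint_far.
rewrite Rintegral_setU//; last exact: disjoint_inner_mid.
by apply: integrableS intf.
Qed.

(** Only in the intermediate region are the two integrands compared with each
    other; [mid] is the error of that comparison and [k] the gain on [Q]. *)
Lemma Rintegral_diff_le (f g mid : 'rV[R]_n -> R) (Q : set 'rV[R]_n)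
    (r d k I1 I2 I3 vol : R) :
  r <= d -> mu.-integrable setT (EFin \o f) -> mu.-integrable setT (EFin \o g) ->
  measurable Q -> Q `<=` mid_region r d -> mu Q = vol%:E ->
  (forall z, mid_region r d z -> f z - g z <= mid z - k * \1_Q z) ->
  measurable_fun setT mid -> (forall z, 0 <= mid z) ->
  (\int[mu]_(z in eball 0 r) (`|f z|)%:E <= I1%:E)%E ->
  (\int[mu]_(z in eball 0 r) (`|g z|)%:E <= I1%:E)%E ->
  (\int[mu]_(z in mid_region r d) (mid z)%:E <= I2%:E)%E ->
  (\int[mu]_(z in far_region d) (`|f z|)%:E <= I3%:E)%E ->
  (\int[mu]_(z in far_region d) (`|g z|)%:E <= I3%:E)%E ->
  \int[mu]_z f z - \int[mu]_z g z <= 2 * I1 + I2 + 2 * I3 - k * vol.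
Proof.
move=> rd intf intg mQ Qm Qvol fg mmid mid0 f1 g1 h2 f3 g3.
rewrite (Rintegral_three_regions rd intf) (Rintegral_three_regions rd intg).
have m1 := @measurable_eball R n 0 r; have m2 := measurable_mid_region r d.
have m3 := measurable_far_region d.
have sub D h : measurable D -> mu.-integrable setT (EFin \o h) ->
  mu.-integrable D (EFin \o h) by move=> mD; exact: integrableS.
have := normr_Rintegral_le m1 (sub _ _ m1 intf) f1.
have := normr_Rintegral_le m1 (sub _ _ m1 intg) g1.
have := normr_Rintegral_le m3 (sub _ _ m3 intf) f3.
have := normr_Rintegral_le m3 (sub _ _ m3 intg) g3.
rewrite !ler_norml => /andP[? ?] /andP[? ?] /andP[? ?] /andP[? ?].
have intmid : mu.-integrable (mid_region r d) (EFin \o mid).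
  apply: (integrable_of_bound (c := I2)) => //.
  by under eq_integral do rewrite ger0_norm//.
have m1Q : measurable_fun setT (\1_Q : 'rV[R]_n -> R) by exact: measurable_indic.
have intQ1 : mu.-integrable (mid_region r d) (EFin \o (\1_Q : 'rV[R]_n -> R)).
  apply: (sub _ _ m2); apply: (integrable_of_bound (c := vol)) => //.
  under eq_integral do rewrite ger0_norm//.
  by rewrite integral_indic// setIT [X in (X <= _)%E]Qvol.
have intQ : mu.-integrable (mid_region r d) (EFin \o (fun z => k * \1_Q z)).
  exact: (integrableZl m2 k intQ1).
have : \int[mu]_(z in mid_region r d) f z - \int[mu]_(z in mid_region r d) g z <=
    \int[mu]_(z in mid_region r d) mid z -
    \int[mu]_(z in mid_region r d) (k * \1_Q z).
  rewrite -!RintegralB//; try exact: sub.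
  apply: le_Rintegral => //.
  - by have := integrableB m2 (sub _ _ m2 intf) (sub _ _ m2 intg).
  - by have := integrableB m2 intmid intQ.
have -> : \int[mu]_(z in mid_region r d) (k * \1_Q z) = k * vol.
  rewrite RintegralZl//.
  congr (_ * _); rewrite /Rintegral integral_indic// setIidl// [X in fine X]Qvol//.
have : \int[mu]_(z in mid_region r d) mid z <= I2.
  apply: Rintegral_le => //.
  by under eq_integral do rewrite ger0_norm//.
lra.
Qed.

(** When [e] is positive the integral is bounded; otherwise it may diverge as the
    inner radius [r] tends to 0, and [nu] measures how fast. *)
Lemma mid_integral (e nu : R) : 0 <= nu -> 0 < e + nu ->
  exists2 C : R, 0 <= C & forall r d : R, 0 < r -> d <= 1 ->
  (\int[mu]_(z in mid_region r d) (enorm z `^ (e - n%:R))%:E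
    <= (C * r `^ (- nu))%:E)%E.
Proof.
move=> nu0 enu; have [C C0 hC] := @integral_power_near R n _ enu.
exists C => // r d r0 d1.
apply: (@le_trans _ _ (\int[mu]_(z in mid_region r d)
    ((r `^ (- nu))%:E * (enorm z `^ (e + nu - n%:R))%:E))%E).
  apply: ge0_le_integral => //.
  - exact: measurable_mid_region.
  - by move=> z _; rewrite lee_fin powR_ge0.
  - by apply/measurable_EFinP; apply: measurable_funTS; exact: measurable_enorm_pow.
  - apply/measurable_EFinP; apply: measurable_funTS; apply: measurable_funM => //.
    exact: measurable_enorm_pow.
  - move=> z /= /andP[rz _]; have z0 : 0 < enorm z by exact: lt_le_trans rz.
    rewrite -EFinM lee_fin.
    have -> : enorm z `^ (e - n%:R) = enorm z `^ (- nu) * enorm z `^ (e + nu - n%:R).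
      by rewrite -powD//; congr (_ `^ _); ring.
    rewrite ler_wpM2r ?powR_ge0// ler_pow_neg//.
    by rewrite oppr_le0.
apply: (@le_trans _ _ (\int[mu]_(z in pball 1)
    ((r `^ (- nu))%:E * (enorm z `^ (e + nu - n%:R))%:E))%E).
  apply: ge0_subset_integral => //.
  - exact: measurable_mid_region.
  - exact: measurable_pball.
  - apply/measurable_EFinP; apply: measurable_funTS; apply: measurable_funM => //.
    exact: measurable_enorm_pow.
  - by move=> z _; rewrite lee_fin mulr_ge0 ?powR_ge0.
  - move=> z /= /andP[rz zd]; rewrite /pball /= (lt_le_trans r0 rz)/=.
    by rewrite (le_trans (ltW zd)).
rewrite ge0_integralZl//; first last.
- by rewrite lee_fin powR_ge0.
- by move=> z _; rewrite lee_fin powR_ge0.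
- by apply/measurable_EFinP; apply: measurable_funTS; exact: measurable_enorm_pow.
- exact: measurable_pball.
apply: (@le_trans _ _ ((r `^ (- nu))%:E * (C * 1 `^ (e + nu))%:E)%E).
  by apply: lee_wpmul2l; [rewrite lee_fin powR_ge0|exact: hC].
by rewrite -EFinM lee_fin powR1 mulr1 mulrC.
Qed.

Lemma pow_add_le (a b k : R) : 0 <= k -> 0 <= a -> 0 <= b ->
  (a + b) `^ k <= 2 `^ k * (a `^ k + b `^ k).
Proof.
move=> k0; wlog ab : a b / a <= b => [hw a0 b0|a0 b0].
  have /orP[/hw|/hw h] := le_total a b; first exact.
  by rewrite addrC (addrC (a `^ k)) h.
apply: (@le_trans _ _ ((2 * b) `^ k)).
  by apply: ler_pow => //; [exact: addr_ge0|lra].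
rewrite powRM// ler_wpM2l ?powR_ge0// lerDr powR_ge0//.
Qed.

(** The weight [|z|^(-n-sp)] on [|z| >= d] is comparable to the one that defines the
    tail space, centred at the origin instead of [x]. *)
Lemma tail_bound (p s : R) (u : 'rV[R]_n -> R) (d U : R) :
  1 < p -> 0 < s -> measurable_fun setT u -> Ltail p s u -> 0 < d -> 0 <= U ->
  exists2 C : R, 0 <= C & forall (x : 'rV[R]_n) (c : R), enorm x <= 2 -> `|c| <= U ->
  (\int[mu]_(z in far_region d) (`|J p (u (x + z) - c) * kern p s z|)%:E
    <= C%:E)%E.
Proof.
move=> p1 s0 mu_ [_ tail] d0 U0; set N := n%:R + s * p in tail *.
have N0 : 0 <= N by rewrite addr_ge0// mulr_ge0// ltW// (lt_trans _ p1).
pose h (y : 'rV[R]_n) : R := `|u y| `^ (p - 1) / (1 + enorm y) `^ N.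
have h0 y : 0 <= h y by rewrite divr_ge0 ?powR_ge0.
have mh : measurable_fun setT h.
  rewrite (_ : h = fun y => `|u y| `^ (p - 1) * (1 + enorm y) `^ (- N)).
    apply: measurable_funM.
      apply: (measurableT_comp (measurable_powR (p - 1))).
      exact: measurableT_comp.
    apply: (measurableT_comp (measurable_powR (- N))).
    by apply: measurable_funD => //; exact: measurable_enorm1.
  by apply/funext => y; rewrite /h powRN.
pose Tl : R := fine (\int[mu]_y (h y)%:E)%E.
have TlE : (\int[mu]_y (h y)%:E)%E = Tl%:E.
  rewrite /Tl fineK// ge0_fin_numE//.
  by apply: integral_ge0 => y _; rewrite lee_fin.
have Tl0 : 0 <= Tl by rewrite -lee_fin -TlE; apply: integral_ge0 => y _; rewrite lee_fin.
have sp0 : 0 < s * p by rewrite mulr_gt0// (lt_trans _ p1).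
have [Cf Cf0 hCf] := @integral_power_far R n _ sp0.
pose D : R := 3 / d + 1.
(* [1 + |x + z| <= 3 + |z| <= D |z|] for [|z| >= d] *)
have D0 : 0 < D by rewrite addr_gt0// divr_gt0.
pose A : R := 2 `^ (p - 1) * D `^ N.
pose B : R := 2 `^ (p - 1) * U `^ (p - 1).
have A0 : 0 <= A by rewrite mulr_ge0 ?powR_ge0.
have B0 : 0 <= B by rewrite mulr_ge0 ?powR_ge0.
exists (A * Tl + B * (Cf * d `^ (- (s * p)))).
  by rewrite addr_ge0// mulr_ge0// mulr_ge0// powR_ge0.
move=> x c x2 cU.
have mF : measurable (far_region d) by exact: measurable_far_region.
have mhx : measurable_fun setT (fun z => h (x + z)) by exact: measurable_translate.
apply: (@le_trans _ _ (\int[mu]_(z in far_region d)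
   (A%:E * (h (x + z))%:E + B%:E * (enorm z `^ (- N))%:E))%E).
  apply: ge0_le_integral => //.
  - apply/measurable_EFinP; apply: measurable_funTS; apply: measurableT_comp => //.
    apply: measurable_funM; last exact: measurable_kern.
    by apply: measurable_J; apply: measurable_funB => //; exact: measurable_translate.
  - apply/measurable_EFinP; apply: measurable_funTS; apply: measurable_funD.
      exact: measurable_funM.
    by apply: measurable_funM => //; exact: measurable_enorm_pow.
  - move=> z dz'; have dz : d <= enorm z by exact: dz'.
    have z0 : 0 < enorm z by exact: lt_le_trans dz.
    rewrite -!EFinM -EFinD lee_fin normrM normJ// (ger0_norm (kern_ge0 _ _ _)).
    rewrite kernE -/N.
    have zD : 1 + enorm (x + z) <= D * enorm z.
      have := enormD x z; rewrite /D mulrDl mul1r.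
      have : 3 <= 3 / d * enorm z by rewrite mulrAC ler_pdivlMr//; lra.
      lra.
    have z1 : 0 < 1 + enorm (x + z) by have := enorm_ge0 (x + z); lra.
    have kz : enorm z `^ (- N) <= D `^ N * (1 + enorm (x + z)) `^ (- N).
      have N0' : - N <= 0 by rewrite oppr_le0.
      have := ler_pow_neg N0' z1 zD; rewrite powRM ?(ltW D0) ?(ltW z0)// powRN.
      by rewrite mulrC ler_pdivrMr ?powR_gt0// mulrC.
    apply: (@le_trans _ _ (2 `^ (p - 1) * (`|u (x + z)| `^ (p - 1) + U `^ (p - 1)) *
        enorm z `^ (- N))).
      apply: ler_wpM2r; first exact: powR_ge0.
      apply: (@le_trans _ _ ((`|u (x + z)| + U) `^ (p - 1))).
        apply: ler_pow => //; first lra.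
        by apply: (le_trans (ler_normB _ _)); rewrite lerD2l.
      by apply: pow_add_le => //; lra.
    rewrite mulrDr mulrDl; apply: lerD; last by rewrite /B.
    rewrite /A /h -!mulrA; apply: ler_wpM2l; first exact: powR_ge0.
    rewrite mulrCA; apply: ler_wpM2l; first exact: powR_ge0.
    by rewrite -powRN.
rewrite ge0_integralD//; first last.
- apply/measurable_EFinP; apply: measurable_funTS.
  by apply: measurable_funM => //; exact: measurable_enorm_pow.
- by move=> z _; rewrite -EFinM lee_fin mulr_ge0// powR_ge0.
- apply/measurable_EFinP; apply: measurable_funTS; exact: measurable_funM.
- by move=> z _; rewrite -EFinM lee_fin mulr_ge0.
rewrite EFinD; apply: leeD.
  rewrite ge0_integralZl//; last 2 first.
  - by apply/measurable_EFinP; exact: measurable_funTS.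
  - by move=> z _; rewrite lee_fin.
  rewrite (EFinM A); apply: lee_wpmul2l => //; rewrite -TlE.
  apply: (@le_trans _ _ (\int[mu]_z (h (x + z))%:E)%E).
    apply: ge0_subset_integral => //.
    - exact/measurable_EFinP.
    - by move=> z _; rewrite lee_fin.
  have E := @ge0_integral_affine R n 1 x (fun y => (h y)%:E) setT (expr1n R 2)
    measurableT (proj2 (measurable_EFinP _ _) mh) (fun y _ => h0 y).
  rewrite E preimage_setT le_eqVlt; apply/orP; left; apply/eqP.
  by apply: eq_integral => z _; rewrite scale1r (addrC z).
rewrite ge0_integralZl//; last 2 first.
- by apply/measurable_EFinP; apply: measurable_funTS; exact: measurable_enorm_pow.
- by move=> z _; rewrite lee_fin powR_ge0.
rewrite (EFinM B); apply: lee_wpmul2l => //; exact: hCf.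
Qed.

End three_regions.

(** * The profile of the penalty *)

Section profile.
Context {R : realType}.
Variables (ga ka th : R).

(** [t^ga] is strictly concave enough only for [ga < 1]; for [ga = 1] the concavity
    comes from the second term. *)
Definition phi (t : R) : R := t `^ ga - ka * t `^ (ga + th).

Definition profile_params : Prop :=
  [/\ 0 < ga < 1, ka = 0 & th = 0] \/ [/\ ga = 1, ka = 1 / 4 & 0 < th <= 1].

Hypothesis par : profile_params.

Lemma profile_ga : 0 < ga <= 1.
Proof. by case: par => -[]; [move=> /andP[g0 /ltW ->] _ _; rewrite g0|move=> ->]; rewrite ?ltr01 ?lexx. Qed.

Lemma profile_ka : 0 <= ka <= 1 / 4.
Proof. by case: par => -[_ -> _]; apply/andP; split; lra. Qed.

Lemma profile_th : 0 <= th <= 1.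
Proof.
by case: par => -[_ _]; [move=> ->|move=> /andP[/ltW h1 h2]]; apply/andP; split; lra.
Qed.

Lemma phiE (t : R) : 0 < t -> phi t = t `^ ga * (1 - ka * t `^ th).
Proof. by move=> t0; rewrite /phi powD//; ring. Qed.

Lemma pow_le1 (t a : R) : 0 <= a -> 0 <= t -> t <= 1 -> t `^ a <= 1.
Proof. by move=> a0 t0 t1; have := ler_pow a0 t0 t1; rewrite powR1. Qed.

Lemma phi_le (t : R) : phi t <= t `^ ga.
Proof.
have /andP[k0 _] := profile_ka.
by rewrite /phi lerBlDr lerDl mulr_ge0// powR_ge0.
Qed.

Lemma phi_ge (t : R) : 0 < t -> t <= 1 -> t `^ ga / 2 <= phi t.
Proof.
move=> t0 t1; rewrite phiE// ler_wpM2l ?powR_ge0//.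
have /andP[k0 k1] := profile_ka; have /andP[th0 _] := profile_th.
have := pow_le1 th0 (ltW t0) t1; have := powR_ge0 t th; nra.
Qed.

(** Strict concavity of the profile along the axis: the second difference
    [phi 0 + phi (2 t) - 2 phi t] is negative, with room for a perturbation of
    relative size [eta]. In units of [t^ga], [X] bounds [phi t - phi d1] from below
    for [d1 <= eta t], and [Y] bounds [phi d2 - phi t] from above for
    [|d2 - 2 t| <= eta t]. For [ga = 1] all the margins shrink like [t^th]. *)
Lemma profile_concave : exists ce c3 : R,
  [/\ 0 < ce, ce <= 1 / 2, 0 < c3, c3 <= 1 / 4 & forall t, 0 < t -> t <= 1 ->
    let eta := ce * t `^ th in
    let X := 1 - ka * t `^ th - eta `^ ga in
    let Y := (2 + eta) `^ ga - ka * (2 - eta) `^ (ga + th) * t `^ th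
             - 1 + ka * t `^ th in
    1 / 2 <= X /\ Y <= X - 2 * c3 * t `^ th].
Proof.
case: par => -[].
- move=> /andP[g0 g1] k0 t0; rewrite k0 t0.
  have pg : 2 `^ ga < 2 :> R.
    have h : (1 : R) < 2 by rewrite ltr1n.
    have := @gt0_ltr_powR R (1 - ga) _ 1 2; rewrite powR1 subr_gt0 !nnegrE => h1.
    have {}h1 := h1 g1 ler01 (ler0n _ 2) h.
    have E : 2 `^ ga * 2 `^ (1 - ga) = 2 :> R.
      by rewrite -powD// addrC subrK powRr1.
    by rewrite -[X in _ < X]E -[X in X < _]mulr1 ltr_pM2l ?powR_gt0.
  pose ep : R := Num.min ((2 - 2 `^ ga) / 4) (1 / 4).
  have ep0 : 0 < ep by rewrite lt_min; apply/andP; split; lra.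
  have ep1 : ep <= (2 - 2 `^ ga) / 4 by rewrite ge_min lexx.
  have ep2 : ep <= 1 / 4 by rewrite ge_min lexx orbT.
  have ceg : (ep `^ ga^-1) `^ ga = ep by rewrite -powRrM mulVf ?gt_eqF// powRr1// ltW.
  exists (ep `^ ga^-1), (ep / 4); split.
  + exact: powR_gt0.
  + apply: (@le_trans _ _ ep); last lra.
    by apply: ge1r_powR; [rewrite ep0/=; lra|rewrite invf_ge1// ltW].
  + by rewrite divr_gt0.
  + lra.
  move=> t _ _; rewrite powRr0 !mulr1 /= ceg !mul0r !subr0 addr0; split; first lra.
  have := @pow_subadditive R 2 (ep `^ ga^-1) ga g0 (ltW g1) (ler0n _ 2) (powR_ge0 _ _).
  rewrite ceg; lra.
- move=> -> -> /andP[th0 th1].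
  pose de : R := 2 `^ th - 1.
  have de0 : 0 < de.
    rewrite subr_gt0; have := @gt0_ltr_powR R th th0 1 2; rewrite powR1.
    by apply; rewrite ?nnegrE// ltr1n.
  have de1 : de <= 1.
    rewrite lerBlDr; have := @ler_powR R 2 (ler1n _ 2) th 1 th1.
    by rewrite powRr1//; lra.
  exists (de / 12), (de / 8); split; [lra|lra|lra|lra|].
  move=> t t0 t1 /=; set T := t `^ th.
  have T0 : 0 <= T by exact: powR_ge0.
  have T1 : T <= 1 by exact: pow_le1 (ltW th0) (ltW t0) t1.
  set eta := de / 12 * T.
  have eta0 : 0 <= eta by rewrite mulr_ge0//; lra.
  have eta1 : eta <= de / 12 by rewrite /eta ler_piMr//; lra.
  rewrite !powRr1//; last by lra.
  split; first lra.
  have r1 : 1 <= 1 + th by lra.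
  have x0 : 0 <= 1 - eta / 2 by lra.
  have B := bernoulli_ge r1 x0.
  have E : (2 - eta) `^ (1 + th) = 2 `^ (1 + th) * (1 - eta / 2) `^ (1 + th).
    by rewrite -powRM//; congr (_ `^ _); field.
  have E2 : 2 `^ (1 + th) = 2 * (de + 1) :> R by rewrite powD// powRr1// /de; ring.
  have low : 2 * (de + 1) - 4 * eta <= (2 - eta) `^ (1 + th).
    rewrite E E2; set P := (1 - eta / 2) `^ _ in B *.
    have B2 : 1 - eta <= P by apply: le_trans B; nra.
    have := ler_wpM2l (_ : 0 <= 2 * (de + 1)) B2; nra.
  have := ler_wpM2r T0 low; rewrite /eta; nra.
Qed.

End profile.

Lemma sub_le_opp (R : realDomainType) (a b x y g c : R) :
  c <= g -> - y <= b -> a <= - x -> g <= x - y -> a - b <= - c.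
Proof. lra. Qed.

Section pointwise.
Context {R : realType}.
Variable p : R.
Hypothesis p1 : 1 < p.

(** The exponent of [|z|] gained when increments of size [|z|^g0] are compared up
    to an error [|z|^(1 + sg)]: [J] is locally Lipschitz for [p >= 2], and only
    [(p - 1)]-Hoelder continuous for [p < 2]. *)
Definition mid_exponent (g0 sg : R) : R :=
  if 2 <= p then g0 * (p - 2) + 1 + sg else (1 + sg) * (p - 1).

(** At the maximum of the doubled function, the increments [A] and [b] of [u] at
    the two points satisfy [A <= b + e] with a small error [e]. *)
Lemma mid_pointwise (g0 sg K0 K1 : R) : 0 <= g0 -> g0 <= 1 -> 0 <= sg ->
  0 <= K0 -> 0 <= K1 ->
  exists2 C : R, 0 <= C & forall rho A b e : R, 0 < rho -> rho <= 1 -> A <= b + e ->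
    `|b| <= K0 * rho `^ g0 -> `|e| <= K1 * rho `^ (1 + sg) ->
    J p A - J p b <= C * rho `^ mid_exponent g0 sg.
Proof.
move=> g00 g01 sg0 K00 K10; rewrite /mid_exponent.
have le1 A b e : A <= b + e -> J p A - J p b <= `|J p (b + e) - J p b|.
  move=> h; apply: (@le_trans _ _ (J p (b + e) - J p b)); last exact: ler_norm.
  by rewrite lerD2r J_mono.
have [p2|p2] := leP 2 p.
- exists ((p - 1) * (K0 + K1) `^ (p - 2) * K1).
    by rewrite !mulr_ge0 ?powR_ge0//; lra.
  move=> rho A b e r0 r1 /le1 h hb he; apply: (le_trans h).
  apply: (le_trans (J_diff_ge2 p1 p2 _ _)).
  rewrite (_ : b + e - b = e); last by ring.
  have ple : rho `^ (1 + sg) <= rho `^ g0.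
    by apply: ger_powR; [rewrite r0|lra].
  have mx : Num.max `|b + e| `|b| <= (K0 + K1) * rho `^ g0.
    have hb' : `|b| <= (K0 + K1) * rho `^ g0.
      by apply: (le_trans hb); rewrite ler_wpM2r ?powR_ge0// lerDl.
    rewrite ge_max hb' andbT (le_trans (ler_normD _ _))// mulrDl lerD//.
    by rewrite (le_trans he)// ler_wpM2l.
  apply: (@le_trans _ _ ((p - 1) * ((K0 + K1) * rho `^ g0) `^ (p - 2) * (K1 * rho `^ (1 + sg)))).
    apply: ler_pM => //.
      by rewrite mulr_ge0 ?powR_ge0//; lra.
    apply: ler_wpM2l; first lra.
    by apply: ler_pow => //; lra.
  rewrite powRM ?addr_ge0 ?powR_ge0// -powRrM.
  rewrite (_ : rho `^ (g0 * (p - 2) + 1 + sg) = rho `^ (g0 * (p - 2)) * rho `^ (1 + sg)); last first.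
    by rewrite -powD//; congr (_ `^ _); ring.
  by rewrite le_eqVlt; apply/orP; left; apply/eqP; ring.
- exists (2 * K1 `^ (p - 1)); first by rewrite mulr_ge0 ?powR_ge0.
  move=> rho A b e r0 r1 /le1 h hb he; apply: (le_trans h).
  apply: (le_trans (J_diff_le2 p1 (ltW p2) _ _)).
  rewrite (_ : b + e - b = e); last by ring.
  rewrite powRrM -mulrA -powRM ?powR_ge0//.
  apply: ler_wpM2l => //; apply: ler_pow => //.
  by rewrite subr_ge0 ltW.
Qed.

(** For increments near [y - x] the concavity of
    the profile makes the difference of the increments strictly negative: moving
    [x] onto [y] removes almost all of the penalty [phi t], while moving [y] by the
    same vector doubles the distance, which raises the penalty by strictly less. *)
Lemma gain_pointwise (ga ka th : R) : profile_params ga ka th ->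
  exists ce c3 c4 : R, [/\ 0 < ce, ce <= 1 / 2, 0 < c3, 0 < c4 &
  forall t L A b e d1 d2 : R, 0 < t -> t <= 1 -> 0 < L ->
    0 <= d1 -> d1 <= ce * t `^ th * t ->
    (2 - ce * t `^ th) * t <= d2 -> d2 <= (2 + ce * t `^ th) * t ->
    `|e| <= c3 * t `^ th * (L * t `^ ga) ->
    A <= L * (phi ga ka th d1 - phi ga ka th t) + e ->
    L * (phi ga ka th t - phi ga ka th d2) <= b ->
    J p A - J p b <= - (c4 * t `^ th * (L * t `^ ga) `^ (p - 1))].
Proof.
move=> par; have [ce [c3 [ce0 ce1 c30 c31 H]]] := profile_concave par.
have /andP[g0 g1] := profile_ga par; have /andP[k0 k1] := profile_ka par.
have /andP[th0 th1] := profile_th par.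
pose c4 : R := Num.min 1 (p - 1) * c3 * (1 / 4) `^ (p - 1).
exists ce, c3, c4; split => //.
  by rewrite !mulr_gt0 ?powR_gt0// lt_min ltr01 subr_gt0.
move=> t L A b e d1 d2 t0 t1 L0 d10 d1e d2l d2u eE hA hb.
have [] := H t t0 t1; rewrite -/(c3).
set T := t `^ th in d1e d2l d2u eE *; set eta := ce * T in d1e d2l d2u *.
set X := 1 - _ - _; set Y := _ - 1 + _ => X2 YX.
have T0 : 0 <= T by exact: powR_ge0.
have T1 : T <= 1 by exact: pow_le1 th0 (ltW t0) t1.
have eta0 : 0 <= eta by rewrite mulr_ge0// ltW.
have eta1 : eta <= 1 / 2 by apply: le_trans ce1; rewrite /eta ler_piMr// ltW.
set La := L * t `^ ga in eE *.
have La0 : 0 < La by rewrite mulr_gt0// powR_gt0.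
have p1' : phi ga ka th d1 <= eta `^ ga * t `^ ga.
  apply: (le_trans (phi_le par _)); rewrite -powRM ?(ltW t0)//.
  by apply: ler_pow => //; exact: ltW.
have p2' : phi ga ka th d2 <= ((2 + eta) `^ ga - ka * (2 - eta) `^ (ga + th) * T) * t `^ ga.
  have e2 : 0 <= 2 - eta by lra.
  have e3 : 0 <= 2 + eta by lra.
  have d20 : 0 <= d2 by apply: le_trans d2l; rewrite mulr_ge0// ltW.
  rewrite /phi mulrBl; apply: lerB.
    by rewrite -powRM ?(ltW t0)//; apply: ler_pow => //; exact: ltW.
  rewrite -!mulrA; apply: ler_wpM2l => //.
  rewrite (_ : T * t `^ ga = t `^ (ga + th)); last by rewrite powD// mulrC.
  rewrite -powRM ?(ltW t0)//; apply: ler_pow => //; first by rewrite addr_ge0// ltW.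
  by rewrite mulr_ge0// ltW.
have X1 : X <= 1.
  have := powR_ge0 eta ga; rewrite /X; have : 0 <= ka * T by rewrite mulr_ge0.
  lra.
have cT : c3 * T <= 1 / 4 by apply: le_trans c31; rewrite ler_piMr// ltW.
have cT0 : 0 <= c3 * T by rewrite mulr_ge0// ltW.
pose X' := X - c3 * T.
have X'0 : 1 / 4 <= X' by rewrite /X'; lra.
have hA' : A <= - (X' * La).
  apply: (le_trans hA); rewrite (phiE ga ka th t0) -/T.
  have : L * phi ga ka th d1 <= L * (eta `^ ga * t `^ ga) by rewrite ler_wpM2l// ltW.
  have := ler_norm e; rewrite /X' /X /La -/T in eE *.
  lra.
have hb' : - (Y * La) <= b.
  apply: le_trans hb; rewrite (phiE ga ka th t0) -/T.
  have : L * phi ga ka th d2 <= L * (((2 + eta) `^ ga - ka * (2 - eta) `^ (ga + th) * T) * t `^ ga).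
    by rewrite ler_wpM2l// ltW.
  rewrite /Y /La; lra.
have XLa : 0 < X' * La by rewrite mulr_gt0//; lra.
have YXd : Y * La <= X' * La * (1 - c3 * T).
  rewrite mulrAC ler_wpM2r ?(ltW La0)//.
  have : X' * (c3 * T) <= c3 * T by rewrite ler_piMl//; rewrite /X'; lra.
  rewrite /X' in X'0 *; lra.
have del : 0 <= c3 * T <= 1 by rewrite cT0; lra.
have := J_gap p1 XLa del YXd.
have := J_mono p1 hA'; have := J_mono p1 hb'; rewrite !JN.
have : c4 * T * La `^ (p - 1) <= Num.min 1 (p - 1) * (c3 * T) * (X' * La) `^ (p - 1).
  rewrite /c4 (@powRM _ X' La) ?(ltW La0)//; last by lra.
  have m0 : 0 <= Num.min 1 (p - 1) by rewrite le_min ler01 subr_ge0 ltW.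
  rewrite (_ : _ * T * _ = Num.min 1 (p - 1) * (c3 * T) * ((1 / 4) `^ (p - 1) * La `^ (p - 1))); last by ring.
  apply: ler_wpM2l; first by rewrite mulr_ge0.
  apply: ler_wpM2r; first exact: powR_ge0.
  by apply: ler_pow; [rewrite subr_ge0 ltW|lra|lra].
exact: sub_le_opp.
Qed.

End pointwise.

(** * The test functions and their inner integrals *)

Section test_inner.
Context {R : realType} {n : nat}.
Notation mu := (lebesgue_rV R n).
Implicit Types (x b z : 'rV[R]_n).

(** A two-sided bound survives a power of either sign. *)
Lemma pow_comparable (k1 k2 X a b : R) : 0 < k1 -> 0 <= k2 -> 0 < X ->
  k1 * X <= a -> a <= k2 * X -> a `^ b <= (k1 `^ b + k2 `^ b) * X `^ b.
Proof.
move=> k10 k20 X0 h1 h2; rewrite mulrDl -!powRM ?(ltW X0) ?(ltW k10)//.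
have kX0 : 0 < k1 * X by exact: mulr_gt0.
have [b0|/ltW b0] := leP 0 b.
  apply: (@le_trans _ _ ((k2 * X) `^ b)); last by rewrite lerDr powR_ge0.
  by apply: ler_pow => //; exact: le_trans (ltW kX0) h1.
apply: (@le_trans _ _ ((k1 * X) `^ b)); last by rewrite lerDl powR_ge0.
exact: ler_pow_neg.
Qed.

Lemma measurable_sqd b : measurable_fun setT (fun x => sqd b x).
Proof.
apply: measurable_funX; apply: measurable_enorm.
rewrite [X in measurable_fun _ X](_ : _ = (fun x : 'rV[R]_n => 1 *: x + (- b)%R)).
  exact: measurable_affine_rV.
by apply/funext => x; rewrite scale1r.
Qed.

Lemma measurable_testf (A B al be m c : R) b b' :
  measurable_fun setT (testf A B al be m c b b').
Proof.
have mpow (k : R) : measurable_fun setT (sqd_pow k b).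
  exact: (measurableT_comp (measurable_powR k) (measurable_sqd b)).
have mmul (k : R) f : measurable_fun setT f -> measurable_fun setT (fun x : 'rV[R]_n => k * f x).
  by move=> mf; exact: measurable_funM.
have m1 := mmul A _ (mpow al); have m2 := mmul B _ (mpow be).
have m3 := mmul m _ (measurable_sqd b').
exact: (measurable_funD (measurable_funD (measurable_funD m1 m2) m3) (measurable_cst c)).
Qed.

Variables (ga ka th : R).
Hypothesis par : profile_params ga ka th.

(** [e = 1] is the test function from above, [e = -1] the one from below. *)
Definition test (e L m c : R) b b' : 'rV[R]_n -> R :=
  testf (e * L) (- (e * L * ka)) (ga / 2) ((ga + th) / 2) m c b b'.

Lemma testE (e L m c : R) b b' x :
  test e L m c b b' x = e * L * phi ga ka th (enorm (x - b)) + m * sqd b' x + c.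
Proof. by rewrite /test /testf !sqd_powE /phi; ring. Qed.

(** The gradient of the radial part is of order [L t^(ga - 1) >= L], so that for
    large [L] the localization cannot cancel it: the test functions are
    admissible without any condition at critical points. *)
Lemma grad_test_bounds (e L m c : R) b b' x : `|e| = 1 -> 0 < L -> 0 <= m ->
  8 * m <= ga * L -> 0 < enorm (x - b) -> enorm (x - b) <= 1 ->
  enorm (x - b') <= 1 ->
  ga / 4 * (L * enorm (x - b) `^ (ga - 1)) <= enorm (grad (test e L m c b b') x) /\
  enorm (grad (test e L m c b b') x) <= 2 * (L * enorm (x - b) `^ (ga - 1)).
Proof.
move=> e1 L0 m0 mL t0 t1 xb'; set t := enorm (x - b) in t0 t1 *.
have s0 : 0 < sqd b x by rewrite /sqd exprn_gt0.
rewrite /test grad_testf// /radial.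
rewrite (_ : ga / 2 - 1 = (ga - 2) / 2); last by field.
rewrite (_ : (ga + th) / 2 - 1 = (ga + th - 2) / 2); last by field.
rewrite !sqd_powE -/t.
have /andP[g0 g1] := profile_ga par; have /andP[k0 k1] := profile_ka par.
have /andP[th0 th1] := profile_th par.
have tth : t `^ th <= 1 by exact: pow_le1 th0 (ltW t0) t1.
have tth0 : 0 <= t `^ th by exact: powR_ge0.
set Rad := (X in X *: (x - b)).
have RadE : Rad = e * (L * t `^ (ga - 2) * (ga - ka * (ga + th) * t `^ th)).
  rewrite /Rad (_ : t `^ (ga + th - 2) = t `^ (ga - 2) * t `^ th).
    by field.
  by rewrite -powD//; congr (_ `^ _); ring.
have fac1 : ga / 2 <= ga - ka * (ga + th) * t `^ th.
  have : ka * (ga + th) <= ga / 2 by case: par => -[]; [move=> _ -> _|move=> -> -> /andP[? ?]]; lra.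
  have : 0 <= ka * (ga + th) by rewrite mulr_ge0// addr_ge0// ltW.
  nra.
have fac2 : ga - ka * (ga + th) * t `^ th <= 1.
  have : 0 <= ka * (ga + th) * t `^ th by rewrite !mulr_ge0// addr_ge0// ltW.
  lra.
set F := ga - _ in RadE fac1 fac2.
set X := L * t `^ (ga - 1).
have XE : L * t `^ (ga - 2) * t = X.
  by rewrite /X -mulrA -{2}(powRr1 (ltW t0)) -powD//; congr (_ * _ `^ _); ring.
have X0 : 0 < X by rewrite /X mulr_gt0// powR_gt0.
have LX : L <= X.
  rewrite /X ler_peMr ?(ltW L0)//.
  by have := ler_pow_neg (_ : ga - 1 <= 0) t0 t1; rewrite powR1; apply; lra.
have n1 : enorm (Rad *: (x - b)) = F * X.
  rewrite enormZ -/t RadE normrM e1 mul1r normrM (@ger0_norm _ F); last lra.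
  rewrite ger0_norm; last by rewrite mulr_ge0 ?powR_ge0// ltW.
  by rewrite -XE; ring.
have n2 : enorm ((2 * m) *: (x - b')) <= 2 * m.
  by rewrite enormZ ger0_norm ?mulr_ge0// ler_piMr// mulr_ge0.
have m4 : 2 * m <= ga / 4 * X by have := ler_wpM2l (ltW g0) LX; lra.
split.
  have := enorm_ge_sub (Rad *: (x - b)) ((2 * m) *: (x - b')); rewrite n1.
  have := ler_wpM2r (ltW X0) fac1; lra.
have := enormD (Rad *: (x - b)) ((2 * m) *: (x - b')); rewrite n1.
have := ler_wpM2r (ltW X0) fac2; nra.
Qed.

Lemma C2_test (e L m c : R) b b' x (r : R) : r <= enorm (x - b) ->
  C2_on (eball x r) (test e L m c b b').
Proof.
move=> rt; apply: C2_testf => y; rewrite /eball /= => yr.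
rewrite /sqd exprn_gt0//.
have -> : y - b = (x - b) + (y - x) by rewrite [RHS]addrC addrA subrK.
apply: lt_le_trans (enorm_ge_sub _ _).
by rewrite subr_gt0; exact: lt_le_trans yr rt.
Qed.

(** [inner_bound] for the test functions: gradient [L t^(ga-1)] and second
    derivatives [L t^(ga-2)] combine to [(L t^ga)^(p-1) t^(-p)]. *)
Lemma inner_test (p s m : R) : 1 < p -> 0 < s < 1 -> 0 <= m ->
  exists C cm L1 : R, [/\ 0 <= C, 0 < cm, cm <= 1 / 4, 1 <= L1 &
  forall (e L m' c : R) b b' x (r : R),
    `|e| = 1 -> L1 <= L -> 0 <= m' -> m' <= m ->
    0 < enorm (x - b) -> enorm (x - b) <= 1 -> enorm (x - b') <= 1 ->
    0 < r -> r <= cm * enorm (x - b) ->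
    let f := test e L m' c b b' in
    grad f x != 0 /\
    (\int[mu]_(z in eball 0 r)
      (`|J p (f (x + z)%R - f x) - J p (dotv (grad f x) z)| * kern p s z)%:E <=
     (C * (L * enorm (x - b) `^ ga) `^ (p - 1) *
       enorm (x - b) `^ (- p) * r `^ (p - s * p))%:E)%E].
Proof.
move=> p1 s01 m0.
have /andP[g0 g1] := profile_ga par; have /andP[k0 k1] := profile_ka par.
have /andP[th0 th1] := profile_th par.
have [Ci Ci0 hCi] := @inner_bound R n p s p1 s01.
have [CT CT0 hCT] := @testf_taylor R n ga (ga + th).
pose CM : R := 2 * CT + 1.
have CM1 : 1 <= CM by rewrite /CM; lra.
pose cm : R := ga / (4 * CM).
have cm0 : 0 < cm by rewrite divr_gt0//; lra.
have cmE : CM * cm = ga / 4 by rewrite /cm; field; rewrite gt_eqF//; lra.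
have cm1 : cm <= 1 / 4.
  rewrite /cm ler_pdivrMr; last lra.
  lra.
pose L1 : R := 8 * m / ga + m + 1.
have mg : 0 <= 8 * m / ga by rewrite divr_ge0 ?mulr_ge0// ltW.
exists (Ci * ((ga / 4) `^ (p - 2) + 2 `^ (p - 2)) * CM), cm, L1; split => //.
- by rewrite !mulr_ge0 ?addr_ge0 ?powR_ge0//; lra.
- by rewrite /L1; lra.
move=> e L m' c b b' x r e1 LL1 m'0 m'm t0 t1 xb' r0 rc f.
set t := enorm (x - b) in t0 t1 rc *.
have L0 : 0 < L by apply: lt_le_trans LL1; rewrite /L1; lra.
have mL : m <= L by apply: le_trans LL1; rewrite /L1; lra.
have mgL : 8 * m' <= ga * L.
  have h : 8 * m / ga <= L by apply: le_trans LL1; rewrite /L1; lra.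
  by move: h; rewrite ler_pdivrMr//; lra.
have [gl gu] := grad_test_bounds c e1 L0 m'0 mgL t0 t1 xb'.
rewrite -/f -/t in gl gu.
set a := grad f x in gl gu *; set X := L * t `^ (ga - 1) in gl gu.
have X0 : 0 < X by rewrite mulr_gt0// powR_gt0.
have ea0 : 0 < enorm a by apply: lt_le_trans gl; rewrite mulr_gt0// divr_gt0.
have a0 : a != 0 by rewrite -enorm_gt0.
split=> //.
pose M : R := CM * (L * t `^ (ga - 2)).
have M0 : 0 <= M by rewrite mulr_ge0 ?mulr_ge0 ?powR_ge0//; lra.
have XE : L * t `^ (ga - 2) * t = X.
  by rewrite /X -mulrA -{2}(powRr1 (ltW t0)) -powD//; congr (_ * _ `^ _); ring.
have Mr : M * r <= enorm a.
  apply: le_trans gl; apply: (@le_trans _ _ (M * (cm * t))); first exact: ler_wpM2l.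
  by rewrite /M -cmE -XE le_eqVlt; apply/orP; left; apply/eqP; ring.
have tay z : enorm z < r -> `|f (x + z) - f x - dotv a z| <= M * enorm z ^+ 2.
  move=> zr; have zt : enorm z <= t / 2.
    rewrite (le_trans (ltW zr))// (le_trans rc)//.
    have : cm * t <= 1 / 4 * t by rewrite ler_wpM2r// ltW.
    lra.
  apply: (le_trans (hCT _ _ _ _ _ _ _ _ _ erefl t0 zt)); rewrite -/t.
  apply: ler_wpM2r; first exact: sqr_ge0.
  rewrite normrN !normrM e1 !mul1r (gtr0_norm L0) (ger0_norm k0) (ger0_norm m'0).
  have h1 : t `^ (ga + th - 2) <= t `^ (ga - 2).
    by apply: ger_powR; [rewrite t0|lra].
  have h2 : 1 <= t `^ (ga - 2).
    by have := ler_pow_neg (_ : ga - 2 <= 0) t0 t1; rewrite powR1; apply; lra.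
  have h3 : L <= L * t `^ (ga - 2) by rewrite ler_peMr// ltW.
  have h4 : L * ka * t `^ (ga + th - 2) <= L * t `^ (ga - 2).
    rewrite -mulrA ler_wpM2l ?(ltW L0)//; apply: le_trans h1.
    by rewrite ler_piMl ?powR_ge0//; lra.
  rewrite /M /CM; have := ler_wpM2l CT0 h4; nra.
have mg' : measurable_fun setT (fun z => f (x + z) - f x).
  apply: measurable_funB => //; apply: measurable_translate.
  exact: measurable_testf.
apply: (le_trans (hCi a M r (fun z => f (x + z) - f x) a0 M0 r0 Mr mg' tay)).
rewrite lee_fin.
have g4 : 0 < ga / 4 by rewrite divr_gt0.
have pc := pow_comparable (p - 2) g4 (ler0n R 2) X0 gl gu.
set Kp : R := (ga / 4) `^ (p - 2) + 2 `^ (p - 2) in pc *.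
apply: (@le_trans _ _ (Ci * (Kp * X `^ (p - 2)) * M * r `^ (p - s * p))).
  apply: ler_wpM2r; first exact: powR_ge0.
  by apply: ler_wpM2r => //; apply: ler_wpM2l.
have E : (L * t `^ ga) `^ (p - 1) * t `^ (- p) = X `^ (p - 2) * (L * t `^ (ga - 2)).
  rewrite /X !powRM ?powR_ge0 ?(ltW L0)// -!powRrM.
  rewrite (_ : L `^ (p - 1) = L `^ (p - 2) * L); last first.
    by rewrite (_ : p - 1 = (p - 2) + 1) ?powD// ?powRr1 ?(ltW L0)//; ring.
  rewrite -!mulrA; congr (_ * _); rewrite [RHS]mulrCA; congr (_ * _).
  by rewrite -!powD//; congr (_ `^ _); ring.
rewrite -[X in _ <= X * _]mulrA E /M le_eqVlt; apply/orP; left; apply/eqP; ring.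
Qed.

End test_inner.

(** * Functions patched near a point *)

Section patched.
Context {R : realType} {n : nat}.
Notation mu := (lebesgue_rV R n).
Variable u : 'rV[R]_n -> R.
Hypothesis n0 : (0 < n)%N.
Hypothesis mu_ : measurable_fun setT u.
Implicit Types (x a z : 'rV[R]_n) (f : 'rV[R]_n -> R).

Definition glued f x (r : R) : 'rV[R]_n -> R := patch u (eball x r) f.

Lemma glued_in f x (r : R) z : enorm z < r -> glued f x r (x + z) = f (x + z).
Proof.
by move=> zr; rewrite /glued /patch mem_set// /eball /= addrC addKr.
Qed.

Lemma glued_out f x (r : R) z : r <= enorm z -> glued f x r (x + z) = u (x + z).
Proof.
move=> zr; rewrite /glued /patch memNset// /eball /= addrC addKr.
by apply/negP; rewrite -leNgt.
Qed.

Lemma glued_center f x (r : R) : 0 < r -> glued f x r x = f x.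
Proof. by move=> r0; have := @glued_in f x r 0; rewrite enorm0 addr0; apply. Qed.

Lemma measurable_glued f x (r : R) :
  measurable_fun setT f -> measurable_fun setT (glued f x r).
Proof.
move=> mf; have mB : measurable (eball x r) by exact: measurable_eball.
rewrite (_ : glued f x r = fun y => if y \in eball x r then f y else u y).
  apply: measurable_fun_ifT => //.
  apply: (measurable_fun_bool true); rewrite setTI.
  rewrite (_ : _ @^-1` _ = eball x r)//.
  by apply/seteqP; split => y /= h; [exact: set_mem|exact: mem_set].
by apply/funext => y; rewrite /glued /patch.
Qed.

Lemma pv_glued_in (p s : R) f x a (r : R) z : 0 < r -> enorm z < r ->
  pv_integrand p s (glued f x r) x a r z =
  (J p (f (x + z) - f x) - J p (dotv a z)) * kern p s z.
Proof.
move=> r0 zr; rewrite /pv_integrand glued_in// glued_center// indicE mem_set ?mul1r//.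
by rewrite /eball /= subr0.
Qed.

Lemma pv_glued_out (p s : R) f x a (r : R) z : 0 < r -> f x = u x -> r <= enorm z ->
  pv_integrand p s (glued f x r) x a r z = J p (u (x + z) - u x) * kern p s z.
Proof.
move=> r0 fu zr; rewrite /pv_integrand glued_out// glued_center// indicE memNset.
  by rewrite mul0r subr0 fu.
by rewrite /eball /= subr0; apply/negP; rewrite -leNgt.
Qed.

Definition operator_value (p s : R) f x (r : R) : R :=
  - (1 - s) * \int[mu]_z pv_integrand p s (glued f x r) x (grad f x) r z.

(** Smooth inside and [u] outside: the three regions give absolute integrability,
    and with it the value of the operator as a real number. *)
Lemma pv_glued_integrable (p s : R) f x (r d U I1 I3 : R) : 1 < p -> 0 < s ->
  measurable_fun setT f -> f x = u x -> 0 < r -> r <= d -> 0 <= U ->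
  (forall z, enorm z < d -> `|u (x + z) - u x| <= U) ->
  (\int[mu]_(z in eball 0 r)
      (`|J p (f (x + z)%R - f x) - J p (dotv (grad f x) z)| * kern p s z)%:E
    <= I1%:E)%E ->
  (\int[mu]_(z in far_region d) (`|J p (u (x + z)%R - u x) * kern p s z|)%:E
    <= I3%:E)%E ->
  let F := pv_integrand p s (glued f x r) x (grad f x) r in
  [/\ mu.-integrable setT (EFin \o F),
      (\int[mu]_(z in eball 0 r) (`|F z|)%:E <= I1%:E)%E,
      (\int[mu]_(z in far_region d) (`|F z|)%:E <= I3%:E)%E &
      frac_plaplacian p s (glued f x r) x = (operator_value p s f x r)%:E].
Proof.
move=> p1 s0 mf fu r0 rd U0 hU h1 h3 F.
have mF : measurable_fun setT F.
  by apply: measurable_pv_integrand; exact: measurable_glued.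
have f1 : (\int[mu]_(z in eball 0 r) (`|F z|)%:E <= I1%:E)%E.
  apply: le_trans h1; rewrite le_eqVlt; apply/orP; left; apply/eqP.
  apply: eq_integral => z; rewrite inE /eball /= subr0 => zr.
  by rewrite /F pv_glued_in// normrM (ger0_norm (kern_ge0 _ _ _)).
have f3 : (\int[mu]_(z in far_region d) (`|F z|)%:E <= I3%:E)%E.
  apply: le_trans h3; rewrite le_eqVlt; apply/orP; left; apply/eqP.
  apply: eq_integral => z; rewrite inE /far_region /= => dz.
  by rewrite /F pv_glued_out// (le_trans rd).
have N0 : - (n%:R + s * p) <= 0.
  by rewrite oppr_le0 addr_ge0// mulr_ge0// ltW// (lt_trans _ p1).
have intF : mu.-integrable setT (EFin \o F).
  apply: (integrable_three_regions rd) => //.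
  - by apply: (integrable_of_bound (c := I1)) => //; exact: measurable_eball.
  - apply: (integrable_of_bound (c := U `^ (p - 1) * r `^ (- (n%:R + s * p)) * (2 * d) ^+ n)) => //.
      exact: measurable_mid_region.
    rewrite EFinM; apply: (@integral_le_cst _ _ _ mu _ (fun z => `|F z|)).
    + exact: measurable_mid_region.
    + by rewrite mulr_ge0 ?powR_ge0.
    + exact: measurableT_comp.
    + move=> z /andP[rz zd]; rewrite normr_ge0 /= /F pv_glued_out// normrM normJ//.
      rewrite kernE (ger0_norm (powR_ge0 _ _)); apply: ler_pM; rewrite ?powR_ge0//.
        by apply: ler_pow; rewrite ?subr_ge0 ?(ltW p1)//; exact: hU.
      by rewrite ler_pow_neg.
    + apply: (le_trans _ (@eball_volume_le R n 0 d _)); last first.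
        by apply: le_trans rd; exact: ltW.
      apply: le_measure.
      * by rewrite inE; exact: measurable_mid_region.
      * by rewrite inE; exact: measurable_eball.
      * by move=> z /andP[_ zd]; rewrite /eball /= subr0.
  - by apply: (integrable_of_bound (c := I3)) => //; exact: measurable_far_region.
split => //.
by apply: frac_plaplacianE => //; exact: measurable_glued.
Qed.

End patched.

(** * Off-diagonal maxima of the doubled function *)

Section doubling.
Context {R : realType} {n : nat}.
Notation mu := (lebesgue_rV R n).
Variable u : 'rV[R]_n -> R.
Variables (ga ka th m d U g0 K0 : R).
Hypothesis n0 : (0 < n)%N.
Hypothesis mu_ : measurable_fun setT u.
Hypothesis par : profile_params ga ka th.
Hypothesis m0 : 0 < m.
Hypothesis d01 : 0 < d <= 1.
Hypothesis U0 : 0 <= U.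
Hypothesis K00 : 0 <= K0.
Hypothesis g001 : 0 <= g0 <= 1.
Implicit Types (x y z : 'rV[R]_n).

(** [(x, y)] is an off-diagonal maximum point of the doubled function
    [u x - u y - L phi(|x - y|) - m |x - b|^2] in a neighbourhood of size [d],
    where [u] is bounded by [U] and [g0]-Hoelder continuous. *)
Record doubling (L : R) (b x y : 'rV[R]_n) : Prop := Doubling {
  dbl_loc : enorm (x - b) <= 1;
  dbl_pos : 0 < enorm (x - y);
  dbl_close : 2 * enorm (x - y) < d;
  dbl_x2 : enorm x <= 2;
  dbl_y2 : enorm y <= 2;
  dbl_bndx : forall z, enorm z < d -> `|u (x + z)| <= U;
  dbl_bndy : forall z, enorm z < d -> `|u (y + z)| <= U;
  dbl_hoelder : forall z, enorm z < d -> `|u (y + z) - u y| <= K0 * enorm z `^ g0;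
  dbl_hoelderxy : `|u x - u y| <= K0 * enorm (x - y) `^ g0;
  dbl_gt0 : L * phi ga ka th (enorm (x - y)) + m * sqd b x <= u x - u y;
  dbl_max : forall z z', enorm z < d -> enorm z' < d ->
    u (x + z) - u (y + z') - L * phi ga ka th (enorm (x + z - (y + z')))
      - m * sqd b (x + z) <=
    u x - u y - L * phi ga ka th (enorm (x - y)) - m * sqd b x }.

(** The doubled function with [y] frozen, up to the constant that makes it touch
    [u] at [x]. *)
Definition top_test (L : R) b x y : 'rV[R]_n -> R :=
  test ga ka th 1 L m (u x - L * phi ga ka th (enorm (x - y)) - m * sqd b x) y b.

(** The doubled function with [x] frozen. The last argument keeps the centre of the
    localization, whose coefficient is 0, within distance 1 of [y]. *)
Definition bot_test (L : R) x y : 'rV[R]_n -> R :=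
  test ga ka th (-1) L 0 (u y + L * phi ga ka th (enorm (x - y))) x y.

Lemma top_testE L b x y z :
  top_test L b x y z - u x = L * (phi ga ka th (enorm (z - y)) - phi ga ka th (enorm (x - y)))
    + m * (sqd b z - sqd b x).
Proof.
rewrite /top_test testE; move: (phi _ _ _ (enorm (z - y))) (phi _ _ _ (enorm (x - y))) => P Q.
by move: (sqd b z) (sqd b x) (u x) => S1 S2 w; ring.
Qed.

Lemma top_test_center L b x y : top_test L b x y x = u x.
Proof. by apply/eqP; rewrite -subr_eq0 top_testE !subrr !mulr0 addr0. Qed.

Lemma bot_testE L x y z :
  bot_test L x y z - u y = L * (phi ga ka th (enorm (x - y)) - phi ga ka th (enorm (z - x))).
Proof.
rewrite /bot_test testE; move: (phi _ _ _ (enorm (z - x))) (phi _ _ _ (enorm (x - y))) => P Q.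
by move: (sqd y z) (u y) => S w; ring.
Qed.

Lemma bot_test_center L x y : bot_test L x y y = u y.
Proof. by apply/eqP; rewrite -subr_eq0 bot_testE enormB subrr mulr0. Qed.

Lemma measurable_top_test L b x y : measurable_fun setT (top_test L b x y).
Proof. exact: measurable_testf. Qed.

Lemma measurable_bot_test L x y : measurable_fun setT (bot_test L x y).
Proof. exact: measurable_testf. Qed.

Section at_maximum.
Variables (L : R) (b x y : 'rV[R]_n).
Hypothesis dbl : doubling L b x y.
Hypothesis L0 : 0 < L.
Let t := enorm (x - y).

Let t0 : 0 < t. Proof. exact: (dbl_pos dbl). Qed.

Lemma dbl_t1 : t <= 1.
Proof. have := dbl_close dbl; case/andP: d01 => _; rewrite -/t; lra. Qed.

Let xx0 : enorm (0 : 'rV[R]_n) < d.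
Proof. by rewrite enorm0; case/andP: d01. Qed.

Lemma top_test_ge z : enorm z < d -> u (x + z) <= top_test L b x y (x + z).
Proof.
move=> zd; have := dbl_max dbl zd xx0; rewrite addr0.
have := top_testE L b x y (x + z).
move: (top_test _ _ _ _ _) (phi _ _ _ _) (phi _ _ _ _) (sqd b _) (sqd b x) => T P Q S1 S2.
move: (u _) (u _) (u _) => A B C; lra.
Qed.

Lemma bot_test_le z : enorm z < d -> bot_test L x y (y + z) <= u (y + z).
Proof.
move=> zd; have := dbl_max dbl xx0 zd; rewrite addr0 (enormB x (y + z)).
have := bot_testE L x y (y + z).
move: (bot_test _ _ _ _) (phi _ _ _ _) (phi _ _ _ _) (sqd b x) => T P Q S1.
move: (u _) (u _) (u _) => A B C; lra.
Qed.

(** The Hoelder bound on [u x - u y] leaves little room for the localization term.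
    This is where the regularity already known enters. *)
Lemma dbl_loc_le : enorm (x - b) <= Num.sqrt (K0 / m) * t `^ (g0 / 2).
Proof.
have h : m * sqd b x <= K0 * t `^ g0.
  apply: le_trans (dbl_hoelderxy dbl); apply: le_trans (ler_norm _).
  apply: le_trans (dbl_gt0 dbl); rewrite lerDr mulr_ge0 ?(ltW L0)//.
  by apply: le_trans (phi_ge par t0 dbl_t1); rewrite divr_ge0 ?powR_ge0.
rewrite -(@ler_pXn2r _ 2)// ?nnegrE ?mulr_ge0 ?enorm_ge0 ?sqrtr_ge0 ?powR_ge0//.
have Km : 0 <= K0 / m by rewrite divr_ge0// ltW.
rewrite exprMn (sqr_sqrtr Km).
have -> : (t `^ (g0 / 2)) ^+ 2 = t `^ g0.
  by rewrite -powR_mulrn ?powR_ge0// -powRrM divfK.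
rewrite [X in _ <= X](_ : _ = K0 * t `^ g0 / m); last by ring.
by rewrite ler_pdivlMr// mulrC.
Qed.

Definition loc_error z : R := m * (sqd b (x + z) - sqd b x).

Lemma loc_error_le z :
  `|loc_error z| <= m * (2 * Num.sqrt (K0 / m) * t `^ (g0 / 2) * enorm z + enorm z ^+ 2).
Proof.
rewrite /loc_error sqd_addr normrM (gtr0_norm m0) ler_wpM2l ?(ltW m0)//.
rewrite (_ : _ - _ = 2 * dotv (x - b) z + enorm z ^+ 2); last by ring.
apply: (le_trans (ler_normD _ _)); rewrite (ger0_norm (sqr_ge0 (enorm z))) lerD2r.
rewrite normrM (ger0_norm (ler0n R 2)) -!mulrA ler_wpM2l//.
rewrite mulrA; apply: (le_trans (dotv_le _ _)).
by apply: ler_wpM2r; [exact: enorm_ge0|exact: dbl_loc_le].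
Qed.

(** Moving both points by [z] leaves the penalty unchanged. *)
Lemma dbl_increment z : enorm z < d -> u (x + z) - u x <= u (y + z) - u y + loc_error z.
Proof.
move=> zd; have := dbl_max dbl zd zd.
rewrite (_ : x + z - (y + z) = x - y); last by rewrite opprD addrACA subrr addr0.
rewrite /loc_error; move: (phi _ _ _ _) (sqd _ _) (sqd _ _) => P S1 S2.
move: (u _) (u _) (u _) (u _) => A B C D; lra.
Qed.

(** Moving the first point alone. *)
Lemma dbl_increment_x z : enorm z < d ->
  u (x + z) - u x <=
  L * (phi ga ka th (enorm (x - y + z)) - phi ga ka th t) + loc_error z.
Proof.
move=> zd; have := top_test_ge zd; have := top_testE L b x y (x + z).
rewrite (_ : x + z - y = x - y + z); last by rewrite addrAC.
rewrite /loc_error -/t; move: (top_test _ _ _ _ _) (phi _ _ _ _) (phi _ _ _ _) => T P Q.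
move: (u _) (u _) => A B; lra.
Qed.

(** Moving the second point alone. *)
Lemma dbl_increment_y z : enorm z < d ->
  L * (phi ga ka th t - phi ga ka th (enorm (x - y - z))) <= u (y + z) - u y.
Proof.
move=> zd; have := bot_test_le zd; have := bot_testE L x y (y + z).
rewrite (enormB (y + z)) (_ : x - (y + z) = x - y - z); last by rewrite opprD addrA.
rewrite -/t; move: (bot_test _ _ _ _) (phi _ _ _ _) (phi _ _ _ _) => T P Q.
move: (u _) (u _) => A B; lra.
Qed.

End at_maximum.
End doubling.

(** * Difference of the operators at the two points of a maximum *)

Lemma gap_arith (R : realType) (F G I1 I2 I3 g J3 : R) :
  F - G <= 2 * I1 + I2 + 2 * I3 - g -> I1 <= g / 4 -> I3 <= J3 ->
  g / 2 - (I2 + 2 * J3) <= G - F.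
Proof. lra. Qed.

Section operator_gap.
Context {R : realType} {n : nat}.
Notation mu := (lebesgue_rV R n).
Variable u : 'rV[R]_n -> R.
Variables (ga ka th m d U g0 K0 : R).
Hypothesis n0 : (0 < n)%N.
Hypothesis mu_ : measurable_fun setT u.
Hypothesis par : profile_params ga ka th.
Hypothesis m0 : 0 < m.
Hypothesis d01 : 0 < d <= 1.
Hypothesis U0 : 0 <= U.
Hypothesis K00 : 0 <= K0.
Hypothesis g001 : 0 <= g0 <= 1.
Implicit Types (x y z : 'rV[R]_n).
Notation doubling := (doubling u ga ka th m d U g0 K0).
Notation top_test := (top_test u ga ka th m).
Notation bot_test := (bot_test u ga ka th).

(** Outside the inner ball [t^(g0/2)] is controlled by a power of [|z|], which makes
    the localization error of higher order than linear in [|z|]. *)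
Lemma loc_error_mid (c thp : R) : 0 < c -> 0 <= thp ->
  exists2 K1 : R, 0 <= K1 & forall (L : R) b x y z, 0 < L -> doubling L b x y ->
  c * enorm (x - y) `^ (1 + thp) <= enorm z -> enorm z <= 1 ->
  `|loc_error m b x z| <= K1 * enorm z `^ (1 + g0 / (2 * (1 + thp))).
Proof.
move=> c0 thp0; set sg := g0 / (2 * (1 + thp)).
have /andP[g00 g01] := g001.
have t1 : 0 < 1 + thp by lra.
have sg0 : 0 <= sg by rewrite divr_ge0// mulr_ge0// ltW.
have sg1 : sg <= 1 by rewrite ler_pdivrMr ?mulr_gt0//; lra.
set S := Num.sqrt (K0 / m).
have S0 : 0 <= S by exact: sqrtr_ge0.
exists (m * (2 * S * c `^ (- sg) + 1)).
  by rewrite mulr_ge0 ?(ltW m0)// addr_ge0// mulr_ge0 ?powR_ge0// mulr_ge0.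
move=> L b x y z L0 dbl; have t0 := dbl_pos dbl; set t := enorm (x - y) in t0 * => rz z1.
have z0 : 0 < enorm z by apply: lt_le_trans rz; rewrite mulr_gt0// powR_gt0.
apply: (le_trans (loc_error_le par m0 d01 K00 dbl L0 z)).
rewrite -[X in _ <= X]mulrA ler_wpM2l ?(ltW m0)// -/t -/S.
rewrite [X in _ <= X](_ : _ = 2 * S * c `^ (- sg) * enorm z `^ (1 + sg) + enorm z `^ (1 + sg)); last by ring.
(* from [t^(1 + thp) <= |z| / c] *)
have h1 : t `^ (g0 / 2) <= c `^ (- sg) * enorm z `^ sg.
  have : (t `^ (1 + thp)) `^ sg <= (c^-1 * enorm z) `^ sg.
    apply: ler_pow => //; first exact: powR_ge0.
    by rewrite mulrC ler_pdivlMr// mulrC.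
  rewrite powRM ?invr_ge0 ?(ltW c0) ?(ltW z0)// powV ?(ltW c0)// -powRrM.
  by congr (_ `^ _ <= _); rewrite /sg; field; rewrite gt_eqF.
apply: lerD.
  rewrite powD// powRr1 ?(ltW z0)//.
  rewrite [X in _ <= X](_ : _ = 2 * S * (c `^ (- sg) * enorm z `^ sg) * enorm z); last by ring.
  by rewrite ler_wpM2r ?(ltW z0)// ler_wpM2l// mulr_ge0.
rewrite -powR_mulrn ?(ltW z0)//.
by apply: ger_powR; [rewrite z0|rewrite -[2%:R]/(1 + 1); lra].
Qed.

Lemma loc_error_near : exists2 Ke : R, 0 <= Ke & forall (L : R) b x y z, 0 < L ->
  doubling L b x y -> enorm z <= 2 * enorm (x - y) ->
  `|loc_error m b x z| <= Ke * enorm (x - y) `^ (1 + g0 / 2).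
Proof.
have /andP[g00 g01] := g001.
set S := Num.sqrt (K0 / m).
have S0 : 0 <= S by exact: sqrtr_ge0.
exists (m * (4 * S + 4)); first by rewrite mulr_ge0 ?(ltW m0)//; lra.
move=> L b x y z L0 dbl zt; have t0 := dbl_pos dbl; have t1 := dbl_t1 d01 dbl.
set t := enorm (x - y) in zt t0 t1 *.
apply: (le_trans (loc_error_le par m0 d01 K00 dbl L0 z)).
rewrite -[X in _ <= X]mulrA ler_wpM2l ?(ltW m0)// -/t -/S.
have z0 := enorm_ge0 z.
have E : t `^ (1 + g0 / 2) = t * t `^ (g0 / 2) by rewrite powD// powRr1 ?(ltW t0).
have h2 : enorm z ^+ 2 <= 4 * t `^ (1 + g0 / 2).
  apply: (@le_trans _ _ (4 * t ^+ 2)).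
    by rewrite (_ : 4 * t ^+ 2 = (2 * t) ^+ 2); [rewrite ler_pXn2r ?nnegrE//; lra|ring].
  rewrite ler_wpM2l// -powR_mulrn ?(ltW t0)//.
  by apply: ger_powR; [rewrite t0|lra].
rewrite [X in _ <= X](_ : _ = 4 * S * t `^ (1 + g0 / 2) + 4 * t `^ (1 + g0 / 2)); last by ring.
apply: lerD => //.
rewrite E [X in _ <= X](_ : _ = 2 * S * t `^ (g0 / 2) * (2 * t)); last by ring.
by rewrite ler_wpM2l// mulr_ge0 ?powR_ge0// mulr_ge0.
Qed.

Lemma inner_value (p s thp : R) : 1 < p -> 0 < s < 1 -> 0 <= thp ->
  exists Ci cm L1 : R, [/\ 0 <= Ci, 0 < cm, cm <= 1 / 4, 1 <= L1 &
  forall (c L : R) b x y, 0 < c -> c <= cm -> L1 <= L -> doubling L b x y ->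
    let t := enorm (x - y) in let r := c * t `^ (1 + thp) in
    let I1 := Ci * c `^ (p - s * p) * (L * t `^ ga) `^ (p - 1)
                * t `^ (thp * (p - s * p) - s * p) in
    let f := top_test L b x y in let g := bot_test L x y in
    [/\ grad f x != 0, grad g y != 0,
    (\int[mu]_(z in eball 0 r)
      (`|J p (f (x + z)%R - f x) - J p (dotv (grad f x) z)| * kern p s z)%:E <= I1%:E)%E &
    (\int[mu]_(z in eball 0 r)
      (`|J p (g (y + z)%R - g y) - J p (dotv (grad g y) z)| * kern p s z)%:E <= I1%:E)%E]].
Proof.
move=> p1 s01 thp0.
have [Ci [cm [L1 [Ci0 cm0 cm4 L11 H]]]] := @inner_test R n _ _ _ par _ _ _ p1 s01 (ltW m0).
exists Ci, cm, L1; split => //.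
move=> c L b x y c0 ccm LL1 dbl t r I1 f g.
have t0 : 0 < t := dbl_pos dbl; have t1 : t <= 1 := dbl_t1 d01 dbl.
have ps0 : 0 <= p - s * p by move: s01 => /andP[? ?]; nra.
have r0 : 0 < r by rewrite mulr_gt0// powR_gt0.
have tt : t `^ (1 + thp) <= t.
  by rewrite -[leRHS](powRr1 (ltW t0)); apply: ger_powR; [rewrite t0|lra].
have rcm : r <= cm * t.
  by apply: ler_pM => //; [exact: ltW|exact: powR_ge0].
have bnd : Ci * (L * t `^ ga) `^ (p - 1) * t `^ (- p) * r `^ (p - s * p) <= I1.
  rewrite /r (powRM _ (ltW c0) (powR_ge0 _ _)) -powRrM.
  rewrite [leLHS](_ : _ = Ci * (L * t `^ ga) `^ (p - 1) * c `^ (p - s * p) *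
      (t `^ (- p) * t `^ ((1 + thp) * (p - s * p)))); last by ring.
  rewrite -powD// (_ : - p + _ = thp * (p - s * p) - s * p); last by ring.
  by rewrite le_eqVlt; apply/orP; left; apply/eqP; rewrite /I1; ring.
have h1 : `|1 : R| = 1 by rewrite normr1.
have h2 : `|-1 : R| = 1 by rewrite normrN normr1.
have [gx ix] := H 1 L m (u x - L * phi ga ka th t - m * sqd b x) y b x r
  h1 LL1 (ltW m0) (lexx _) t0 t1 (dbl_loc dbl) r0 rcm.
have ty : enorm (y - x) = t by rewrite enormB.
have yy : enorm (y - y) <= 1 by rewrite subrr enorm0.
have [gy iy] := H (-1) L 0 (u y + L * phi ga ka th t) x y y r
  h2 LL1 (lexx _) (ltW m0) (eq_ind_r (fun v => 0 < v) t0 ty)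
  (eq_ind_r (fun v => v <= 1) t1 ty) yy r0 (eq_ind_r (fun v => r <= cm * v) rcm ty).
rewrite ty in iy.
split => //.
- by apply: (le_trans ix); rewrite lee_fin.
- by apply: (le_trans iy); rewrite lee_fin.
Qed.

(** [Q] is a cube around [y - x] of side comparable to [t^(1 + th)]; the gain is the
    product of the pointwise gain, the kernel at distance [t] and the volume. *)
Lemma gain_value (p s : R) : 1 < p -> 0 < s -> th <= g0 / 2 ->
  exists k0 L1 : R, [/\ 0 < k0, 1 <= L1 &
  forall (L : R) b x y, L1 <= L -> doubling L b x y ->
    let t := enorm (x - y) in
    exists Q k vol, [/\ measurable Q, Q `<=` mid_region (t / 2) d, mu Q = vol%:E,
      forall z, Q z ->
        J p (u (x + z) - u x) * kern p s z - J p (u (y + z) - u y) * kern p s z <= - k &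
      k0 * (L * t `^ ga) `^ (p - 1) * t `^ (th * n.+1%:R - s * p) = k * vol]].
Proof.
move=> p1 s0 thg.
have [Ke Ke0 hKe] := loc_error_near.
have [ce [c3 [c4 [ce0 ce1 c30 c40 H]]]] := gain_pointwise p1 par.
have /andP[ga0 ga1] := profile_ga par; have /andP[th0 th1] := profile_th par.
have nR0 : 0 < n%:R :> R by rewrite ltr0n.
set N := n%:R + s * p.
have N0 : 0 <= N by rewrite addr_ge0// mulr_ge0//; lra.
exists (c4 * 2 `^ (- N) * (ce / n%:R) ^+ n), (Ke / c3 + 1).
have q0 : 0 <= Ke / c3 by rewrite divr_ge0// ltW.
split; first by rewrite !mulr_gt0 ?powR_gt0 ?exprn_gt0 ?divr_gt0.
  by lra.
move=> L b x y LL1 dbl t.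
have t0 : 0 < t := dbl_pos dbl; have t1 : t <= 1 := dbl_t1 d01 dbl.
have L0 : 0 < L by lra.
have LK : Ke <= c3 * L.
  have h : Ke / c3 <= L by lra.
  by move: h; rewrite ler_pdivrMr// mulrC.
set eta := ce * t `^ th.
have tth0 : 0 < t `^ th by exact: powR_gt0.
have tth1 : t `^ th <= 1 by exact: pow_le1 th0 (ltW t0) t1.
have eta0 : 0 < eta by exact: mulr_gt0.
have eta1 : eta <= 1 / 2 by rewrite /eta; nra.
have et0 : 0 < eta * t by exact: mulr_gt0.
have et1 : eta * t <= t / 2 by rewrite mulrC; apply: le_trans (ler_wpM2l (ltW t0) eta1) _; lra.
pose Q := box (y - x) (eta * t / (2 * n%:R)).
have inQ z : Q z -> [/\ enorm (x - y + z) <= eta * t,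
   (2 - eta) * t <= enorm (x - y - z), enorm (x - y - z) <= (2 + eta) * t,
   t / 2 <= enorm z & enorm z <= 3 / 2 * t].
  move=> Qz; have := box_sub_eball n0 et0 Qz; rewrite /eball /= => /ltW.
  rewrite opprB (addrC z) => e1.
  have E : x - y - z = 2%:R *: (x - y) - (x - y + z).
    by rewrite scaler_nat mulr2n opprD addrA addrK.
  have E2 : z = (x - y + z) - (x - y) by rewrite addrC addKr.
  have n2 : enorm (2%:R *: (x - y)) = 2 * t by rewrite enormZ ger0_norm.
  have a1 := enorm_ge_sub (2%:R *: (x - y)) (- (x - y + z)).
  have a2 := enormD (2%:R *: (x - y)) (- (x - y + z)).
  rewrite -E n2 enormN in a1 a2.
  have a3 := enorm_ge_sub (- (x - y)) (x - y + z).
  have a4 := enormD (- (x - y)) (x - y + z).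
  rewrite addKr enormN -/t in a3 a4.
  move: (enorm (x - y - z)) (enorm (x - y + z)) (enorm z) e1 a1 a2 a3 a4 et1 => v1 v2 v3.
  by move=> e1 a1 a2 a3 a4 et1; split; lra.
pose k := c4 * t `^ th * (L * t `^ ga) `^ (p - 1) * (2 * t) `^ (- N).
exists Q, k, ((2 * (eta * t / (2 * n%:R))) ^+ n); split.
- exact: measurable_box.
- move=> z /inQ[_ _ _ z1 z2]; rewrite /mid_region /= z1/=.
  have := dbl_close dbl; rewrite -/t.
  by move: (enorm z) z2 t0 => v z2 t0; lra.
- by apply: box_volume; rewrite divr_ge0 ?(ltW et0)// mulr_ge0.
- move=> z /inQ[e1 e2 e3 z1 z2].
  have zd : enorm z < d.
    by have := dbl_close dbl; rewrite -/t; move: (enorm z) z2 t0 => v z2 t0; lra.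
  have z2' : enorm z <= 2 * t by move: (enorm z) z2 t0 => v z2 t0; lra.
  have err : `|loc_error m b x z| <= c3 * t `^ th * (L * t `^ ga).
    apply: (le_trans (hKe L b x y z L0 dbl z2')); rewrite -/t.
    have : t `^ (1 + g0 / 2) <= t `^ th * t `^ ga.
      by rewrite -powD//; apply: ger_powR; [rewrite t0|lra].
    move=> h; apply: (@le_trans _ _ (c3 * L * (t `^ th * t `^ ga))).
      by apply: ler_pM => //; exact: powR_ge0.
    by rewrite le_eqVlt; apply/orP; left; apply/eqP; ring.
  have J1 := H t L _ _ _ _ _ t0 t1 L0 (enorm_ge0 _) e1 e2 e3 err
    (dbl_increment_x d01 dbl zd) (dbl_increment_y d01 dbl zd).
  rewrite -mulrBl; have kz : (2 * t) `^ (- N) <= kern p s z.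
    rewrite kernE; apply: ler_pow_neg => //; first by rewrite oppr_le0.
    by apply: lt_le_trans z1; rewrite divr_gt0.
  rewrite -(opprK (_ - _)) mulNr lerN2 /k; apply: ler_pM.
  + by rewrite !mulr_ge0 ?powR_ge0// ltW.
  + exact: powR_ge0.
  + by rewrite -lerN2 opprK.
  + exact: kz.
- rewrite /k (@powRM _ 2 t (- N))// ?(ltW t0)//.
  have -> : 2 * (eta * t / (2 * n%:R)) = ce / n%:R * (t `^ th * t).
    by rewrite /eta; field; rewrite gt_eqF.
  have TT : t `^ th * t = t `^ (th + 1) by rewrite powD// powRr1// ltW.
  rewrite TT (exprMn _ (ce / n%:R)) -(powR_mulrn n (powR_ge0 t (th + 1))) -powRrM.
  rewrite (_ : th * n.+1%:R - s * p = th + - N + (th + 1) * n%:R); last first.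
    by rewrite /N -(natr1 n); ring.
  by rewrite !(powD _ _ t0); ring.
Qed.

(** The operator of order [s] and growth [p] at the two points of the maximum:
    the gain near [y - x] is of the order of the inner integrals, and wins once
    the constant [c] in the radius [c t^(1 + thp)] of the inner ball is small
    enough. The remaining errors are bounded, or blow up at most like
    [t^(- (1 + thp) nu)]. *)
Lemma operator_gap (p s thp nu : R) : 1 < p -> 0 < s < 1 -> Ltail p s u ->
  0 <= thp -> th <= g0 / 2 -> th * n.+1%:R <= thp * (p - s * p) -> 0 <= nu ->
  0 < mid_exponent p g0 (g0 / (2 * (1 + thp))) - s * p + nu ->
  exists cm c5 : R, [/\ 0 < cm, cm <= 1 / 4, 0 < c5 & forall c : R, 0 < c -> c <= cm ->
  exists C7 L1 : R, [/\ 0 <= C7, 1 <= L1 &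
  forall (L : R) b x y, L1 <= L -> doubling L b x y ->
    let t := enorm (x - y) in let r := c * t `^ (1 + thp) in
    let f := top_test L b x y in let g := bot_test L x y in
    let V1 := operator_value u p s f x r in let V2 := operator_value u p s g y r in
    [/\ grad f x != 0, grad g y != 0,
      frac_plaplacian p s (glued u f x r) x = V1%:E,
      frac_plaplacian p s (glued u g y r) y = V2%:E &
      c5 * (L * t `^ ga) `^ (p - 1) * t `^ (th * n.+1%:R - s * p)
        - C7 * t `^ (- ((1 + thp) * nu)) <= V1 - V2]]].
Proof.
move=> p1 s01 tail thp0 thg thn nu0 enu.
have /andP[s0 s1] := s01; have /andP[d0 d1] := d01; have /andP[g00 g01] := g001.
have [Ci [cm [L1 [Ci0 cm0 cm4 L11 Hin]]]] := inner_value p1 s01 thp0.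
have [k0 [L2 [k00 L21 Hg]]] := gain_value p1 s0 thg.
have U20 : 0 <= 2 * U by rewrite mulr_ge0.
have [I3 I30 H3] := tail_bound p1 s0 mu_ tail d0 U20.
have [C2 C20 H2] := @mid_integral R n _ _ nu0 enu.
have ps0 : 0 < p - s * p by rewrite -[X in X - _](mul1r p) -mulrBl mulr_gt0 ?subr_gt0//; lra.
set sg := g0 / (2 * (1 + thp)) in enu H2.
have sg0 : 0 <= sg by rewrite divr_ge0// mulr_ge0// addr_ge0.
(* small enough for twice the inner integrals to be at most half of the gain *)
pose cm' := Num.min cm ((k0 / (4 * Ci + 1)) `^ (p - s * p)^-1).
have Ci4 : 0 < 4 * Ci + 1 by lra.
have kC0 : 0 < k0 / (4 * Ci + 1) by rewrite divr_gt0.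
exists cm', ((1 - s) * (k0 / 2)); split.
- by rewrite lt_min cm0/= powR_gt0.
- by rewrite ge_min cm4.
- by rewrite mulr_gt0 ?divr_gt0// subr_gt0.
move=> c c0; rewrite le_min => /andP[ccm ck].
have ck' : Ci * c `^ (p - s * p) <= k0 / 4.
  have kE : ((k0 / (4 * Ci + 1)) `^ (p - s * p)^-1) `^ (p - s * p) = k0 / (4 * Ci + 1).
    by rewrite -powRrM mulVf ?gt_eqF// powRr1// ltW.
  have : c `^ (p - s * p) <= k0 / (4 * Ci + 1).
    by rewrite -kE; apply: ler_pow => //; exact: ltW.
  rewrite ler_pdivlMr//; have := powR_ge0 c (p - s * p).
  by move: (c `^ _) => X; lra.
have [K1 K10 HK] := loc_error_mid c0 thp0.
have [Cm Cm0 Hmid] := mid_pointwise p1 g00 g01 sg0 K00 K10.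
set e := mid_exponent p g0 sg - s * p in enu H2.
pose mid z := Cm * enorm z `^ (e - n%:R).
pose C7 := (1 - s) * (Cm * (C2 * c `^ (- nu)) + 2 * I3).
have C70 : 0 <= C7.
  by rewrite mulr_ge0 ?subr_ge0 ?(ltW s1)// addr_ge0// ?mulr_ge0 ?powR_ge0.
exists C7, (L1 + L2); split => //; first lra.
move=> L b x y LL dbl t r f g V1 V2.
have LL1 : L1 <= L by lra.
have LL2 : L2 <= L by lra.
have L0 : 0 < L by lra.
have t0 : 0 < t := dbl_pos dbl; have t1 : t <= 1 := dbl_t1 d01 dbl.
have [gx gy ix iy] := Hin c L b x y c0 ccm LL1 dbl.
have [Q [k [vol [mQ Qm Qv HQ kv]]]] := Hg L b x y LL2 dbl.
rewrite -/t -/r -/f -/g in gx gy ix iy Qm kv.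
set I1 := Ci * _ * _ * _ in ix iy.
have r0 : 0 < r by rewrite mulr_gt0// powR_gt0.
have tt : t `^ (1 + thp) <= t.
  by rewrite -[leRHS](powRr1 (ltW t0)); apply: ger_powR; [rewrite t0|rewrite lerDl].
have rt : r <= t / 2.
  have : r <= 1 / 4 * t by apply: ler_pM => //; [exact: ltW|exact: powR_ge0|exact: le_trans cm4].
  by move=> /le_trans; apply; rewrite mul1r mulrC ler_wpM2l ?(ltW t0)//; lra.
have rd : r <= d.
  by have := dbl_close dbl; rewrite -/t; move: rt t0; move: (t) (r) => t' r'; lra.
have bx0 : `|u x| <= U by have := dbl_bndx dbl (z := 0); rewrite enorm0 addr0; apply.
have by0 : `|u y| <= U by have := dbl_bndy dbl (z := 0); rewrite enorm0 addr0; apply.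
have hx z : enorm z < d -> `|u (x + z) - u x| <= 2 * U.
  move=> zd; apply: (le_trans (ler_normB _ _)); rewrite mulr2n mulrDl mul1r.
  by apply: lerD => //; exact: (dbl_bndx dbl).
have hy z : enorm z < d -> `|u (y + z) - u y| <= 2 * U.
  move=> zd; apply: (le_trans (ler_normB _ _)); rewrite mulr2n mulrDl mul1r.
  by apply: lerD => //; exact: (dbl_bndy dbl).
have fx : f x = u x := top_test_center _ _ _ _ _ _ _ _ _.
have gyE : g y = u y := bot_test_center _ _ _ _ _ _ _.
have fx3 : (\int[mu]_(z in far_region d) (`|J p (u (x + z)%R - f x) * kern p s z|)%:E <= I3%:E)%E.
  apply: H3; [exact: dbl_x2 dbl|rewrite fx; apply: (le_trans bx0)].
  by rewrite mulr2n mulrDl mul1r lerDl.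
have gy3 : (\int[mu]_(z in far_region d) (`|J p (u (y + z)%R - g y) * kern p s z|)%:E <= I3%:E)%E.
  apply: H3; [exact: dbl_y2 dbl|rewrite gyE; apply: (le_trans by0)].
  by rewrite mulr2n mulrDl mul1r lerDl.
rewrite fx in fx3; rewrite gyE in gy3.
have [iF iF1 iF3 EF] := pv_glued_integrable n0 mu_ p1 s0
  (measurable_top_test u ga ka th m L b x y) fx r0 rd U20 hx ix fx3.
have [iG iG1 iG3 EG] := pv_glued_integrable n0 mu_ p1 s0
  (measurable_bot_test u ga ka th L x y) gyE r0 rd U20 hy iy gy3.
split; [exact: gx|exact: gy|exact: EF|exact: EG|].
set F := pv_integrand p s (glued u f x r) x (grad f x) r in iF iF1 iF3.
set G := pv_integrand p s (glued u g y r) y (grad g y) r in iG iG1 iG3.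
have FG z : mid_region r d z -> F z - G z <= mid z - k * \1_Q z.
  move=> /andP[rz zd].
  rewrite /F /G pv_glued_out// pv_glued_out//.
  have z0 : 0 < enorm z by exact: lt_le_trans rz.
  have mid0 : 0 <= mid z by rewrite /mid mulr_ge0 ?powR_ge0.
  rewrite indicE; have [Qz|nQz] := boolP (z \in Q); rewrite /= ?mulr1 ?mulr0 ?subr0.
    by apply: (le_trans (HQ z (set_mem Qz))); rewrite lerDr.
  rewrite -mulrBl.
  have z1 : enorm z <= 1 by rewrite (le_trans (ltW zd)).
  have h := Hmid (enorm z) _ _ _ z0 z1 (dbl_increment dbl zd)
    (dbl_hoelder dbl zd) (HK L b x y z L0 dbl rz z1).
  apply: (@le_trans _ _ (Cm * enorm z `^ (mid_exponent p g0 sg) * kern p s z)).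
    by apply: ler_wpM2r => //; exact: kern_ge0.
  rewrite /mid kernE -mulrA -powD// le_eqVlt; apply/orP; left; apply/eqP.
  by rewrite /e; congr (_ * _ `^ _); ring.
have Qr : Q `<=` mid_region r d.
  by move=> z /Qm /andP[h1 h2]; rewrite /mid_region /= h2 (le_trans rt h1).
have mmid : measurable_fun setT mid.
  by apply: measurable_funM => //; exact: measurable_enorm_pow.
have mid0 z : 0 <= mid z by rewrite mulr_ge0 ?powR_ge0.
have i2 : (\int[mu]_(z in mid_region r d) (mid z)%:E <= (Cm * (C2 * r `^ (- nu)))%:E)%E.
  have Cm0' : (0 <= Cm%:E)%E by rewrite lee_fin.
  rewrite EFinM; apply: le_trans (lee_wpmul2l Cm0' (H2 r d r0 d1)).
  rewrite -ge0_integralZl//.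
  - exact: measurable_mid_region.
  - by apply/measurable_EFinP; apply: measurable_funTS; exact: measurable_enorm_pow.
  by move=> z _; rewrite lee_fin powR_ge0.
have main := Rintegral_diff_le rd iF iG mQ Qr Qv FG mmid mid0 iF1 iG1 i2 iF3 iG3.
rewrite -kv in main.
have E1 : r `^ (- nu) = c `^ (- nu) * t `^ (- ((1 + thp) * nu)).
  rewrite /r powRM ?powR_ge0 ?(ltW c0)// -powRrM.
  by congr (_ * _ `^ _); ring.
rewrite E1 in main.
have E2 : 1 <= t `^ (- ((1 + thp) * nu)).
  have := ler_pow_neg (_ : - ((1 + thp) * nu) <= 0) t0 t1; rewrite powR1; apply.
  by rewrite oppr_le0 mulr_ge0// addr_ge0.
have E3 : I1 <= k0 / 4 * (L * t `^ ga) `^ (p - 1) * t `^ (th * n.+1%:R - s * p).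
  rewrite /I1; apply: ler_pM.
  - by rewrite !mulr_ge0 ?powR_ge0.
  - exact: powR_ge0.
  - by apply: ler_wpM2r => //; exact: powR_ge0.
  - by apply: ger_powR; [rewrite t0|rewrite lerD2r].
rewrite /V1 /V2 /operator_value -/F -/G.
move: main E3; move: (\int[mu]_z F z) (\int[mu]_z G z) (I1) => iF' iG' I1' main E3.
have h4 : I3 <= I3 * t `^ (- ((1 + thp) * nu)) by rewrite ler_peMr.
move: main E3 h4; rewrite /C7.
move: (t `^ (- ((1 + thp) * nu))) ((L * t `^ ga) `^ (p - 1)) => W Y.
move: (t `^ (th * n.+1%:R - s * p)) (c `^ (- nu)) => Z cnu.
move=> main E3 h4.
rewrite [X in _ <= X](_ : _ = (1 - s) * (iG' - iF')); last by ring.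
rewrite [X in X <= _](_ : _ = (1 - s) * (k0 / 2 * Y * Z -
   (Cm * (C2 * cnu) + 2 * I3) * W)); last by ring.
apply: ler_wpM2l; first by rewrite subr_ge0 ltW.
have E4 : Cm * (C2 * (cnu * W)) = Cm * (C2 * cnu) * W by ring.
have E5 : (Cm * (C2 * cnu) + 2 * I3) * W = Cm * (C2 * cnu) * W + 2 * (I3 * W) by ring.
have E6 : k0 / 4 * Y * Z = k0 * Y * Z / 4 by field.
have E7 : k0 / 2 * Y * Z = k0 * Y * Z / 2 by field.
rewrite E4 in main; rewrite E6 in E3; rewrite E5 E7.
exact: gap_arith main E3 h4.
Qed.

(** The coefficient of one of the operators varies by [t^a] between the two points;
    this is the size of the operator there. In the intermediate region the factor
    [t^a] is traded for a power of [|z|], which improves integrability. *)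
Lemma operator_abs (p s thp a nu : R) : 1 < p -> 0 < s < 1 -> Ltail p s u ->
  0 <= thp -> 0 <= a -> 0 <= nu ->
  0 < g0 * (p - 1) - s * p + a / (1 + thp) + nu ->
  exists cm : R, [/\ 0 < cm, cm <= 1 / 4 & forall c : R, 0 < c -> c <= cm ->
  exists C6 C7 L1 : R, [/\ 0 <= C6, 0 <= C7, 1 <= L1 &
  forall (L : R) b x y (t r : R), L1 <= L -> doubling L b x y ->
    t = enorm (x - y) -> r = c * t `^ (1 + thp) ->
    t `^ a * `|operator_value u p s (bot_test L x y) y r| <=
    C6 * t `^ a * (L * t `^ ga) `^ (p - 1) * t `^ (- (s * p))
      + C7 * t `^ (- ((1 + thp) * nu))]].
Proof.
move=> p1 s01 tail thp0 a0 nu0 enu.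
have /andP[s0 s1] := s01; have /andP[d0 d1] := d01; have /andP[g00 g01] := g001.
have [Ci [cm [L1 [Ci0 cm0 cm4 L11 Hin]]]] := inner_value p1 s01 thp0.
have U20 : 0 <= 2 * U by rewrite mulr_ge0.
have [I3 I30 H3] := tail_bound p1 s0 mu_ tail d0 U20.
have [C2 C20 H2] := @mid_integral R n _ _ nu0 enu.
set e := g0 * (p - 1) - s * p + a / (1 + thp) in enu H2.
have ps0 : 0 < p - s * p by rewrite -[X in X - _](mul1r p) -mulrBl mulr_gt0 ?subr_gt0//; lra.
have thp1 : 0 < 1 + thp by rewrite (lt_le_trans ltr01)// lerDl.
exists cm; split => // c c0 ccm.
pose Km := K0 `^ (p - 1) * c `^ (- (a / (1 + thp))).
have Km0 : 0 <= Km by rewrite mulr_ge0 ?powR_ge0.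
exists (Ci * c `^ (p - s * p)), (Km * (C2 * c `^ (- nu)) + I3), L1.
have C60 : 0 <= Ci * c `^ (p - s * p) by rewrite mulr_ge0 ?powR_ge0.
split => //; first by rewrite addr_ge0// !mulr_ge0 ?powR_ge0.
move=> L b x y t r LL1 dbl tE rE; set g := bot_test L x y.
have t0 : 0 < t by rewrite tE; exact: dbl_pos dbl.
have t1 : t <= 1 by rewrite tE; apply: (dbl_t1 d01 dbl).
have [_ gy _ iy] := Hin c L b x y c0 ccm LL1 dbl.
rewrite -tE -rE -/g in gy iy.
set I1 := Ci * _ * _ * _ in iy.
have r0 : 0 < r by rewrite rE mulr_gt0// powR_gt0.
have tt : t `^ (1 + thp) <= t.
  by rewrite -[leRHS](powRr1 (ltW t0)); apply: ger_powR; [rewrite t0|rewrite lerDl].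
have rd : r <= d.
  have : r <= 1 / 4 * t by rewrite rE; apply: ler_pM => //; [exact: ltW|exact: powR_ge0|exact: le_trans cm4].
  by have := dbl_close dbl; rewrite -tE; move: t0 => /[swap]; move: (t) (r) => t' r'; lra.
have by0 : `|u y| <= U by have := dbl_bndy dbl (z := 0); rewrite enorm0 addr0; apply.
have hy z : enorm z < d -> `|u (y + z) - u y| <= 2 * U.
  move=> zd; apply: (le_trans (ler_normB _ _)); rewrite mulr2n mulrDl mul1r.
  by apply: lerD => //; exact: (dbl_bndy dbl).
have gyE : g y = u y := bot_test_center _ _ _ _ _ _ _.
have gy3 : (\int[mu]_(z in far_region d) (`|J p (u (y + z)%R - u y) * kern p s z|)%:E <= I3%:E)%E.
  apply: H3; [exact: dbl_y2 dbl|apply: (le_trans by0)].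
  by rewrite mulr2n mulrDl mul1r lerDl.
have [iG iG1 iG3 EG] := pv_glued_integrable n0 mu_ p1 s0
  (measurable_bot_test u ga ka th L x y) gyE r0 rd U20 hy iy gy3.
set G := pv_integrand p s (glued u g y r) y (grad g y) r in iG iG1 iG3.
have mmid := @measurable_mid_region R n r d.
have Gmid z : mid_region r d z -> `|G z| <= t `^ (- a) * Km * enorm z `^ (e - n%:R).
  move=> /andP[rz zd]; move: (rz); rewrite {1}rE => rz'; rewrite /G pv_glued_out//.
  have z0 : 0 < enorm z by exact: lt_le_trans rz.
  rewrite normrM (normJ p1) (ger0_norm (kern_ge0 _ _ _)) kernE.
  have h1 : `|u (y + z) - u y| `^ (p - 1) <= K0 `^ (p - 1) * enorm z `^ (g0 * (p - 1)).
    rewrite powRrM -powRM ?powR_ge0//; apply: ler_pow => //; first by rewrite subr_ge0 ltW.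
    exact: (dbl_hoelder dbl).
  (* from [t^(1 + thp) <= |z| / c] *)
  have h2 : t `^ a <= c `^ (- (a / (1 + thp))) * enorm z `^ (a / (1 + thp)).
    have : (t `^ (1 + thp)) `^ (a / (1 + thp)) <= (c^-1 * enorm z) `^ (a / (1 + thp)).
      apply: ler_pow => //; first by rewrite divr_ge0// ltW.
        exact: powR_ge0.
      by rewrite mulrC ler_pdivlMr// mulrC.
    rewrite powRM ?invr_ge0 ?(ltW c0) ?(ltW z0)// powV ?(ltW c0)// -powRrM.
    by congr (_ `^ _ <= _); field; rewrite gt_eqF.
  apply: (@le_trans _ _ (t `^ (- a) * t `^ a *
     (K0 `^ (p - 1) * enorm z `^ (g0 * (p - 1)) * enorm z `^ (- (n%:R + s * p))))).
    rewrite -powD// addNr powRr0 mul1r; apply: ler_wpM2r; first exact: powR_ge0.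
    exact: h1.
  rewrite -2!(mulrA (t `^ (- a))); apply: ler_wpM2l; first exact: powR_ge0.
  apply: (le_trans (ler_wpM2r _ h2)); first by rewrite !mulr_ge0 ?powR_ge0.
  rewrite [leLHS](_ : _ = Km * (enorm z `^ (a / (1 + thp)) *
    (enorm z `^ (g0 * (p - 1)) * enorm z `^ (- (n%:R + s * p))))); last by rewrite /Km; ring.
  rewrite -!powD// le_eqVlt; apply/orP; left; apply/eqP.
  by congr (_ * _ `^ _); rewrite /e; ring.
have ta0 : 0 <= t `^ (- a) * Km by rewrite mulr_ge0 ?powR_ge0.
have G2 : (\int[mu]_(z in mid_region r d) (`|G z|)%:E <= (t `^ (- a) * Km * (C2 * r `^ (- nu)))%:E)%E.
  apply: (@le_trans _ _ (\int[mu]_(z in mid_region r d)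
      ((t `^ (- a) * Km)%:E * (enorm z `^ (e - n%:R))%:E))%E).
    apply: ge0_le_integral => //.
    - apply/measurable_EFinP; apply: measurableT_comp => //; apply: measurable_funTS.
      by apply/measurable_EFinP; exact: (measurable_int mu iG).
    - apply/measurable_EFinP; apply: measurable_funTS; apply: measurable_funM => //.
      exact: measurable_enorm_pow.
  have ta0' : (0 <= (t `^ (- a) * Km)%:E)%E by rewrite lee_fin.
  rewrite (EFinM (t `^ (- a) * Km)); apply: le_trans (lee_wpmul2l ta0' (H2 r d r0 d1)).
  rewrite -ge0_integralZl//.
  - by apply/measurable_EFinP; apply: measurable_funTS; exact: measurable_enorm_pow.
  by move=> z _; rewrite lee_fin powR_ge0.
have sub D : measurable D -> mu.-integrable D (EFin \o G) by move=> mD; exact: integrableS iG.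
have m1 := @measurable_eball R n 0 r; have m3 := @measurable_far_region R n d.
have b1 := normr_Rintegral_le m1 (sub _ m1) iG1.
have b2 := normr_Rintegral_le mmid (sub _ mmid) G2.
have b3 := normr_Rintegral_le m3 (sub _ m3) iG3.
have Gle : `|\int[mu]_z G z| <= I1 + t `^ (- a) * Km * (C2 * r `^ (- nu)) + I3.
  rewrite (Rintegral_three_regions rd iG).
  by apply: (le_trans (ler_normD _ _)); apply: lerD => //; apply: (le_trans (ler_normD _ _)); exact: lerD.
have Vle : `|operator_value u p s g y r| <= I1 + t `^ (- a) * Km * (C2 * r `^ (- nu)) + I3.
  rewrite /operator_value -/G normrM; apply: le_trans Gle; rewrite ler_piMl//.
  by rewrite normrN ger0_norm ?subr_ge0 ?(ltW s1)// lerBlDr lerDl ltW.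
apply: (le_trans (ler_wpM2l (powR_ge0 t a) Vle)); rewrite !mulrDr (mulrDl _ I3) addrA.
have ta : t `^ a * t `^ (- a) = 1 by rewrite -powD// subrr powRr0.
apply: lerD; first apply: lerD.
- rewrite /I1 [leLHS](_ : _ = Ci * c `^ (p - s * p) * t `^ a * (L * t `^ ga) `^ (p - 1) *
    t `^ (thp * (p - s * p) - s * p)); last by ring.
  apply: ler_wpM2l; first by rewrite !mulr_ge0 ?powR_ge0.
  by apply: ger_powR; [rewrite t0|rewrite lerDr mulr_ge0// ltW].
- rewrite !mulrA ta mul1r rE powRM ?powR_ge0 ?(ltW c0)// -powRrM.
  rewrite !mulrA le_eqVlt; apply/orP; left; apply/eqP.
  by congr (_ * _ `^ _); ring.
- have h1 : t `^ a <= 1 by exact: pow_le1 a0 (ltW t0) t1.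
  have h2 : 1 <= t `^ (- ((1 + thp) * nu)).
    have := ler_pow_neg (_ : - ((1 + thp) * nu) <= 0) t0 t1; rewrite powR1; apply.
    by rewrite oppr_le0 mulr_ge0// ltW.
  rewrite mulrC; apply: ler_wpM2l => //; exact: le_trans h2.
Qed.

End operator_gap.

(** * Exclusion of off-diagonal maxima *)

Section exponents.
Context {R : realType}.
Variables (n : nat) (p q s1 s2 alpha : R).

(** The conditions under which Hoelder regularity of exponent [g0] improves to
    exponent [ga]. The balls of the inner regions have radius of the order of
    [t^(1 + thp)], and [t^th] is the relative strength of the concavity of the
    profile. The main term of the operator of growth [p] is
    [L^(p-1) t^(ga (p-1) + th (n+1) - s1 p)]: it must not vanish as [t] tends to 0
    and must dominate all the errors. *)
Record exponents (ga th thp g0 : R) : Prop := Exponents {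
  exp_thp : 0 <= thp;
  exp_th : th <= g0 / 2;
  exp_inner_p : th * n.+1%:R <= thp * (p - s1 * p);
  exp_inner_q : th * n.+1%:R <= thp * (q - s2 * q);
  exp_main : 0 <= s1 * p - ga * (p - 1) - th * n.+1%:R;
  exp_mid_p : 0 < mid_exponent p g0 (g0 / (2 * (1 + thp))) - s1 * p +
     (s1 * p - ga * (p - 1) - th * n.+1%:R) / (1 + thp);
  exp_mid_q : 0 < mid_exponent q g0 (g0 / (2 * (1 + thp))) - s2 * q +
     Num.max 0 (s2 * q - ga * (q - 1) - th * n.+1%:R) / (1 + thp);
  exp_coeff : 0 < g0 * (q - 1) - s2 * q + alpha / (1 + thp) +
     (s1 * p - ga * (p - 1) - th * n.+1%:R) / (1 + thp);
  exp_gap : th * n.+1%:R < alpha + s1 * p - s2 * q }.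

End exponents.

Lemma pow_large (R : realType) (e M : R) : 0 < e ->
  exists2 L0 : R, 1 <= L0 & forall L : R, L0 <= L -> M <= L `^ e.
Proof.
move=> e0; exists ((`|M| + 1) `^ e^-1 + 1) => [|L LL].
  by rewrite lerDr powR_ge0.
have M1 : 0 <= `|M| + 1 by rewrite addr_ge0.
apply: (@le_trans _ _ (((`|M| + 1) `^ e^-1) `^ e)).
  rewrite -powRrM mulVf ?gt_eqF// powRr1//.
  by apply: (le_trans (ler_norm M)); rewrite lerDl.
apply: ler_pow; [exact: ltW|exact: powR_ge0|].
by apply: le_trans LL; rewrite lerDl.
Qed.

(** The two viscosity inequalities subtracted, with the second coefficient [X2]
    replaced by the first one in front of [W2]. *)
Lemma viscosity_arith (R : realType) (V1 V2 W1 W2 X1 X2 C Xi K A0 B0 C7 Cq T : R) :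
  V1 + X1 * W1 <= C -> - C <= V2 + X2 * W2 -> 0 <= X1 -> X1 <= Xi -> 0 <= Cq ->
  - Cq <= W1 - W2 -> A0 - C7 <= V1 - V2 -> `|X1 - X2| <= K * T ->
  K * (T * `|W2|) <= A0 / 2 + B0 ->
  A0 / 2 <= C7 + B0 + Xi * Cq + 2 * C.
Proof.
move=> h1 h2 x0 x1 c0 h3 h4 h5 h6.
have h7 : - (Xi * Cq) <= X1 * (W1 - W2) by nra.
have h8 : - (K * (T * `|W2|)) <= (X1 - X2) * W2.
  rewrite lerNl; apply: (le_trans (ler_norm _)); rewrite normrN normrM mulrA.
  by apply: ler_wpM2r.
have E : V1 - V2 + X1 * (W1 - W2) + (X1 - X2) * W2 = (V1 + X1 * W1) - (V2 + X2 * W2) by ring.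
lra.
Qed.

Section contradiction.
Context {R : realType} {n : nat}.
Variables (p q s1 s2 alpha C : R) (xi u : 'rV[R]_n -> R).
Variables (ga ka th thp m d U g0 K0 : R).
Hypothesis n0 : (0 < n)%N.
Hypothesis mu_ : measurable_fun setT u.
Hypothesis p1 : 1 < p.
Hypothesis pq : p <= q.
Hypothesis s101 : 0 < s1 < 1.
Hypothesis s201 : 0 < s2 < 1.
Hypothesis a01 : 0 < alpha <= 1.
Hypothesis C0 : 0 <= C.
Hypothesis xiH : hoelder_on (eball 0 2) alpha xi.
Hypothesis xi0 : forall x, eball 0 2 x -> 0 <= xi x.
Hypothesis up : Ltail p s1 u.
Hypothesis uq : Ltail q s2 u.
Hypothesis visc : viscosity_solution p q s1 s2 C xi u (eball 0 2).
Hypothesis par : profile_params ga ka th.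
Hypothesis m0 : 0 < m.
Hypothesis d01 : 0 < d <= 1.
Hypothesis U0 : 0 <= U.
Hypothesis K00 : 0 <= K0.
Hypothesis g001 : 0 <= g0 <= 1.
Hypothesis ex : exponents n p q s1 s2 alpha ga th thp g0.
Notation doubling := (doubling u ga ka th m d U g0 K0).
Notation top_test := (top_test u ga ka th m).
Notation bot_test := (bot_test u ga ka th).

Let q1 : 1 < q. Proof. exact: lt_le_trans pq. Qed.

Let thp1 : 0 < 1 + thp.
Proof. by rewrite (lt_le_trans ltr01)// lerDl (exp_thp ex). Qed.

Lemma coefficient_bounds : exists K Xi : R, [/\ 0 <= K, 0 <= Xi,
  forall x y, eball 0 2 x -> eball 0 2 y -> `|xi x - xi y| <= K * enorm (x - y) `^ alpha &
  forall x, eball 0 2 x -> xi x <= Xi].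
Proof.
have [K hK] := xiH; have /andP[al0 al1] := a01.
have B0 : eball (0 : 'rV[R]_n) 2 0 by rewrite /eball /= subrr enorm0.
have hK' x y : eball 0 2 x -> eball 0 2 y -> `|xi x - xi y| <= `|K| * enorm (x - y) `^ alpha.
  move=> hx hy; apply: (le_trans (hK x y hx hy)).
  by apply: ler_wpM2r; [exact: powR_ge0|exact: ler_norm].
exists `|K|, (xi 0 + `|K| * 2 `^ alpha); split => //.
  by rewrite addr_ge0 ?mulr_ge0 ?powR_ge0// xi0.
move=> x hx; rewrite -lerBlDl; apply: (le_trans (ler_norm _)).
apply: (le_trans (hK' x 0 hx B0)); rewrite ler_wpM2l//.
by apply: ler_pow; [exact: ltW|exact: enorm_ge0|exact: ltW hx].
Qed.

Lemma viscosity_at_maximum (L : R) b x y (r V1 V2 W1 W2 : R) : 0 < L ->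
  doubling L b x y -> 0 < r -> r <= enorm (x - y) -> r <= d ->
  eball x r `<=` eball 0 2 -> eball y r `<=` eball 0 2 ->
  let f := top_test L b x y in let g := bot_test L x y in
  grad f x != 0 -> grad g y != 0 ->
  frac_plaplacian p s1 (glued u f x r) x = V1%:E ->
  frac_plaplacian p s1 (glued u g y r) y = V2%:E ->
  frac_plaplacian q s2 (glued u f x r) x = W1%:E ->
  frac_plaplacian q s2 (glued u g y r) y = W2%:E ->
  V1 + xi x * W1 <= C /\ - C <= V2 + xi y * W2.
Proof.
move=> L0 dbl r0 rt rd bx by_ f g gx gy EV1 EV2 EW1 EW2.
have adm_f : admissible p q s1 s2 x r f.
  split; first exact: C2_test.
  by left; right; apply/eqP.
have adm_g : admissible p q s1 s2 y r g.
  split; last by left; right; apply/eqP.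
  by apply: C2_test; rewrite enormB.
have fx : f x = u x := top_test_center _ _ _ _ _ _ _ _ _.
have gyE : g y = u y := bot_test_center _ _ _ _ _ _ _.
have [topv _] := visc r0 bx adm_f fx.
have [_ botv] := visc r0 by_ adm_g gyE.
split.
- have : (double_phase p q s1 s2 xi (patch u (eball x r) f) x <= C%:E)%E.
    apply: topv => z zr; have := top_test_ge d01 dbl (z := z - x).
    by rewrite (addrC x) subrK; apply; exact: lt_le_trans zr rd.
  by rewrite /double_phase -/(glued u f x r) EV1 EW1.
- have : ((- C)%:E <= double_phase p q s1 s2 xi (patch u (eball y r) g) y)%E.
    apply: botv => z zr; have := bot_test_le d01 dbl (z := z - y).
    by rewrite (addrC y) subrK; apply; exact: lt_le_trans zr rd.
  by rewrite /double_phase -/(glued u g y r) EV2 EW2.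
Qed.

(** Subtracting the viscosity inequalities at [x] and [y], the main term of
    [operator_gap] for [p] is at most a constant plus errors of the order of
    [t^(-mup)], while it carries in addition the factor [L^(p-1)]. The operator of
    growth [q] has a favourable sign up to a constant, and since
    [L t^ga <= 4 U] its coefficient term is smaller than the main term by the
    factor [t^kap], with [kap > 0] by the gap condition and [t] small for large
    [L]. *)
Lemma no_doubling : exists2 L0 : R, 1 <= L0 & forall (L : R) b x y, L0 <= L ->
  doubling L b x y -> eball x d `<=` eball 0 2 -> eball y d `<=` eball 0 2 -> False.
Proof.
have [K [Xi [K_0 Xi0 HK HXi]]] := coefficient_bounds.
have /andP[al0 al1] := a01; have /andP[ga0 ga1] := profile_ga par.
have /andP[th0 th1] := profile_th par.
have q10 : 0 < q - 1 by rewrite subr_gt0.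
have p10 : 0 < p - 1 by rewrite subr_gt0.
pose mup := s1 * p - ga * (p - 1) - th * n.+1%:R.
have mup0 : 0 <= mup := exp_main ex.
pose muq := Num.max 0 (s2 * q - ga * (q - 1) - th * n.+1%:R).
have muq0 : 0 <= muq by rewrite le_max lexx.
have nup0 : 0 <= mup / (1 + thp) by rewrite divr_ge0// ltW.
have nuq0 : 0 <= muq / (1 + thp) by rewrite divr_ge0// ltW.
have [cp [c5 [cp0 cp4 c50 Hp]]] := operator_gap n0 mu_ par m0 d01 U0 K00 g001 p1 s101
  up (exp_thp ex) (exp_th ex) (exp_inner_p ex) nup0 (exp_mid_p ex).
have [cq [c5q [cq0 cq4 c5q0 Hq]]] := operator_gap n0 mu_ par m0 d01 U0 K00 g001 q1 s201
  uq (exp_thp ex) (exp_th ex) (exp_inner_q ex) nuq0 (exp_mid_q ex).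
have [ca [ca0 ca4 Ha]] := operator_abs n0 mu_ par m0 d01 U0 K00 g001 q1 s201
  uq (exp_thp ex) (ltW al0) nup0 (exp_coeff ex).
pose c := Num.min cp (Num.min cq ca).
have c0 : 0 < c by rewrite !lt_min cp0 cq0.
have [c_p c_q c_a] : [/\ c <= cp, c <= cq & c <= ca].
  by split; rewrite !ge_min lexx ?orbT.
have [C7 [L1 [C70 L11 {}Hp]]] := Hp c c0 c_p.
have [Cq [L2 [Cq0 L21 {}Hq]]] := Hq c c0 c_q.
have [C6 [C8 [L3 [C60 C80 L31 {}Ha]]]] := Ha c c0 c_a.
(* threshold for the difference of the q-operators to be bounded below *)
have [L4 L41 hL4] := @pow_large R (q - 1) (Cq / c5q) q10.
(* threshold for the main term to exceed all the constants *)
pose M := C7 + K * C8 + Xi * Cq + 2 * C.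
have M0 : 0 <= M by rewrite !addr_ge0 ?mulr_ge0.
have [L5 L51 hL5] := @pow_large R (p - 1) (2 * M / c5 + 1) p10.
(* threshold for the coefficient term, through [t <= (4 U / L)^(1 / ga)] *)
pose kap := alpha + s1 * p - s2 * q - th * n.+1%:R.
have kap0 : 0 < kap by rewrite subr_gt0; exact: exp_gap ex.
pose Q := K * C6 * (4 * U) `^ (q - p).
have Q0 : 0 <= Q by rewrite !mulr_ge0 ?powR_ge0.
have kg0 : 0 < kap / ga by rewrite divr_gt0.
have [L6 L61 hL6] := @pow_large R (kap / ga) (2 * Q * (4 * U) `^ (kap / ga) / c5) kg0.
exists (Num.max L1 (Num.max L2 (Num.max L3 (Num.max L4 (Num.max L5 L6))))).
  by rewrite le_max L11.
move=> L b x y; rewrite !ge_max.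
move=> /andP[L1L /andP[L2L /andP[L3L /andP[L4L /andP[L5L L6L]]]]] dbl bx by_.
have L0 : 0 < L by apply: lt_le_trans L1L; exact: lt_le_trans L11.
have := Hp L b x y L1L dbl; have := Hq L b x y L2L dbl.
have t0 := dbl_pos dbl; have t1 := dbl_t1 d01 dbl; have tc := dbl_close dbl.
set t := enorm (x - y) in t0 t1 tc *; set r := c * t `^ (1 + thp).
set f := top_test L b x y; set g := bot_test L x y => /= -[_ _ EW1 EW2 Gq] [gx gy EV1 EV2 Gp].
have A := Ha L b x y t r L3L dbl erefl erefl; rewrite -/g in A.
move: EV1 EV2 EW1 EW2 Gp Gq A.
set V1 := operator_value u p s1 f x r; set V2 := operator_value u p s1 g y r.
set W1 := operator_value u q s2 f x r; set W2 := operator_value u q s2 g y r.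
move: V1 V2 W1 W2 => V1 V2 W1 W2 EV1 EV2 EW1 EW2 Gp Gq A.
have r0 : 0 < r by rewrite mulr_gt0// powR_gt0.
have tt : t `^ (1 + thp) <= t.
  by rewrite -[leRHS](powRr1 (ltW t0)); apply: ger_powR; [rewrite t0|rewrite lerDl (exp_thp ex)].
have rt : r <= t.
  rewrite -[leRHS]mul1r; apply: ler_pM => //; [exact: ltW|exact: powR_ge0|].
  by apply: (le_trans c_p); apply: (le_trans cp4); lra.
have td : t < d by move: tc t0; move: (t) (d) => t' d'; lra.
have rd : r <= d by rewrite (le_trans rt)// ltW.
have sub z : eball z d `<=` eball 0 2 -> eball z r `<=` eball (0 : 'rV[R]_n) 2.
  by move=> h w wr; apply: h; exact: lt_le_trans wr rd.
have [v1 v2] := viscosity_at_maximum L0 dbl r0 rt rd (sub _ bx) (sub _ by_)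
  gx gy EV1 EV2 EW1 EW2.
have d0 : 0 < d by case/andP: d01.
have Bx : eball 0 2 x by apply: bx; rewrite /eball /= subrr enorm0.
have By : eball 0 2 y by apply: by_; rewrite /eball /= subrr enorm0.
(* Either the main term of the q-operators absorbs their errors, or these are
   bounded. *)
set La := L * t `^ ga in Gp Gq A.
have gq : - Cq <= W1 - W2.
  apply: le_trans Gq.
  have [mq|mq] := leP 0 (s2 * q - ga * (q - 1) - th * n.+1%:R).
  - have Emq : muq = s2 * q - ga * (q - 1) - th * n.+1%:R by rewrite /muq max_r.
    have -> : - ((1 + thp) * (muq / (1 + thp))) = - muq by field; rewrite gt_eqF.
    have -> : c5q * La `^ (q - 1) * t `^ (th * n.+1%:R - s2 * q) =
        c5q * L `^ (q - 1) * t `^ (- muq).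
      rewrite /La powRM ?powR_ge0 ?(ltW L0)// -powRrM -!mulrA -powD//.
      by congr (_ * (_ * _ `^ _)); rewrite Emq; ring.
    rewrite -mulrBl; apply: (@le_trans _ _ 0); first by rewrite oppr_le0.
    rewrite mulr_ge0 ?powR_ge0// subr_ge0.
    by have := hL4 L L4L; rewrite ler_pdivrMr// mulrC.
  - have -> : muq = 0 by rewrite /muq max_l// ltW.
    rewrite mul0r mulr0 oppr0 powRr0 mulr1.
    by rewrite lerBrDr addNr !mulr_ge0 ?powR_ge0// ltW.
set W := t `^ (- mup).
have W1' : 1 <= W.
  have := ler_pow_neg (_ : - mup <= 0) t0 t1; rewrite powR1; apply.
  by rewrite oppr_le0.
have EW : - ((1 + thp) * (mup / (1 + thp))) = - mup by field; rewrite gt_eqF.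
rewrite EW -/W in Gp A.
set X := t `^ (th * n.+1%:R - s1 * p) in Gp.
have EX : La `^ (p - 1) * X = L `^ (p - 1) * W.
  rewrite /La powRM ?powR_ge0 ?(ltW L0)// -powRrM -!mulrA -powD//.
  by congr (_ * _ `^ _); rewrite /mup; ring.
rewrite -mulrA EX in Gp.
(* positivity of the doubled function at its maximum bounds [L t^ga] *)
have LaU : La <= 4 * U.
  have h := dbl_gt0 dbl; rewrite -/t in h.
  have bx0 : `|u x| <= U by have := dbl_bndx dbl (z := 0); rewrite enorm0 addr0; apply.
  have by0 : `|u y| <= U by have := dbl_bndy dbl (z := 0); rewrite enorm0 addr0; apply.
  have h2 := ler_wpM2l (ltW L0) (phi_ge par t0 t1).
  have h3 : 0 <= m * sqd b x by rewrite mulr_ge0 ?sqr_ge0 ?(ltW m0).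
  move: bx0 by0; rewrite !ler_norml => /andP[_ k1] /andP[k2 _].
  rewrite (_ : L * (t `^ ga / 2) = La / 2) in h2; last by rewrite /La; field.
  by move: h h2 h3 k1 k2; move: (phi _ _ _ _) (m * _) (u x) (u y) (La) => v1' v2' v3 v4 v5; lra.
have La0 : 0 < La by rewrite mulr_gt0// powR_gt0.
have coef : K * (t `^ alpha * `|W2|) <= c5 * (L `^ (p - 1) * W) / 2 + K * C8 * W.
  apply: (le_trans (ler_wpM2l K_0 A)); rewrite mulrDr (mulrA K C8) lerD2r.
  have E1 : La `^ (q - 1) <= (4 * U) `^ (q - p) * La `^ (p - 1).
    rewrite (_ : q - 1 = (q - p) + (p - 1)) ?(@powD _ La (q - p))//; last by ring.
    by apply: ler_wpM2r; [exact: powR_ge0|apply: ler_pow => //; [rewrite subr_ge0|exact: ltW]].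
  have E2 : t `^ alpha * t `^ (- (s2 * q)) = t `^ kap * X.
    by rewrite /X -!powD//; congr (_ `^ _); rewrite /kap; ring.
  have E3 : Q * t `^ kap <= c5 / 2.
    have tL : t `^ kap * L `^ (kap / ga) <= (4 * U) `^ (kap / ga).
      have -> : t `^ kap = (t `^ ga) `^ (kap / ga).
        by rewrite -powRrM; congr (_ `^ _); field; rewrite gt_eqF.
      rewrite mulrC -powRM ?powR_ge0 ?(ltW L0)//; apply: ler_pow; rewrite ?(ltW kg0)//.
      exact: ltW.
    have Lk0 : 0 < L `^ (kap / ga) by exact: powR_gt0.
    rewrite -(ler_pM2r Lk0) -mulrA; apply: (le_trans (ler_wpM2l Q0 tL)).
    have := hL6 L L6L; rewrite ler_pdivrMr// => h.
    rewrite [leRHS](_ : _ = L `^ (kap / ga) * c5 / 2); last by field.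
    by rewrite ler_pdivlMr// mulrC mulrA; exact: h.
  apply: (@le_trans _ _ (K * C6 * ((4 * U) `^ (q - p) * La `^ (p - 1)) * (t `^ alpha * t `^ (- (s2 * q))))).
    rewrite [leLHS](_ : _ = K * C6 * La `^ (q - 1) * (t `^ alpha * t `^ (- (s2 * q)))); last by ring.
    apply: ler_wpM2r; first by rewrite mulr_ge0 ?powR_ge0.
    by apply: ler_wpM2l => //; exact: mulr_ge0.
  rewrite E2 -EX [leLHS](_ : _ = (Q * t `^ kap) * (La `^ (p - 1) * X)); last by rewrite /Q; ring.
  rewrite [leRHS](_ : _ = c5 / 2 * (La `^ (p - 1) * X)); last by field.
  by apply: ler_wpM2r => //; rewrite mulr_ge0 ?powR_ge0.
have fin := viscosity_arith v1 v2 (xi0 Bx) (HXi _ Bx) Cq0 gq Gp (HK _ _ Bx By) coef.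
have := hL5 L L5L.
have : c5 * (L `^ (p - 1) * W) / 2 <= M * W.
  apply: (le_trans fin); rewrite /M.
  have h1 : Xi * Cq <= Xi * Cq * W by rewrite ler_peMr// mulr_ge0.
  have h2 : C <= C * W by rewrite ler_peMr.
  rewrite [leRHS](_ : _ = C7 * W + K * C8 * W + Xi * Cq * W + 2 * (C * W)); last by ring.
  by apply: lerD; [apply: lerD => //|rewrite ler_pM2l].
have W0 : 0 < W by apply: lt_le_trans W1'.
rewrite [X in X <= _](_ : _ = c5 * L `^ (p - 1) / 2 * W); last by field.
rewrite ler_pM2r//; set Y := L `^ (p - 1).
have -> : 2 * M / c5 = M / (c5 / 2) by field; rewrite gt_eqF.
move=> h1 h2; have : M / (c5 / 2) < Y by apply: lt_le_trans h2; rewrite ltrDl.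
rewrite ltr_pdivrMr ?divr_gt0// => h3; move: h1 h3.
rewrite (_ : Y * (c5 / 2) = c5 * Y / 2); last by field.
by move=> h1 h3; have := lt_le_trans h3 h1; rewrite ltxx.
Qed.

End contradiction.

(** * Existence of maxima of the doubled function *)

Section topology_rV.
Context {R : realType} {n : nat}.
Implicit Types (b x y : 'rV[R]_n).

Lemma continuous_enormB b : continuous (fun y : 'rV[R]_n => enorm (y - b)).
Proof.
move=> x; apply: (@continuous_comp _ _ _ (fun y : 'rV[R]_n => y - b) (fun y => enorm y)).
  by apply: continuousB => //; exact: cst_continuous.
exact: continuous_enorm.
Qed.

Lemma open_eball b (r : R) : open (eball b r).
Proof.
rewrite (_ : eball b r = (fun y : 'rV[R]_n => enorm (y - b)) @^-1` [set t | t < r])//.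
by apply: open_comp; [move=> x _; exact: continuous_enormB|exact: open_lt].
Qed.

Lemma compact_closed_eball b (r : R) : compact (closed_eball b r).
Proof.
apply: (@subclosed_compact _ _ [set v : 'rV[R]_n | forall i,
    `[b ord0 i - r, b ord0 i + r]%classic (v ord0 i)]).
- rewrite (_ : closed_eball b r = (fun y : 'rV[R]_n => enorm (y - b)) @^-1` [set t | t <= r])//.
  by apply: closed_comp; [move=> x _; exact: continuous_enormB|exact: closed_le].
- apply: (@rV_compact _ _ (fun i => `[b ord0 i - r, b ord0 i + r]%classic)) => i.
  exact: segment_compact.
- move=> x xr i /=; rewrite in_itv /= -ler_distlC distrC.
  by have := ler_coord_enorm (x - b) i; rewrite !mxE => /le_trans; apply.
Qed.

(** At the origin continuity comes from monotonicity; the power of a real number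
    is not continuous there from the left. *)
Lemma continuous_enorm_pow (a : R) : 0 < a -> continuous (fun y : 'rV[R]_n => enorm y `^ a).
Proof.
move=> a0 x; have [x0|] := ltP 0 (enorm x).
  apply: (@continuous_comp _ _ _ (fun y : 'rV[R]_n => enorm y) (@powR R ^~ a)).
    exact: continuous_enorm.
  exact: continuous_powR.
move=> x0; have {}x0 : enorm x = 0 by apply/eqP; rewrite eq_le x0 enorm_ge0.
apply/(@cvgrPdist_lt _ _ _ (nbhs x) (nbhs_filter x)) => e e0; rewrite x0 powR0 ?gt_eqF//.
have h : nbhs x (eball (0 : 'rV[R]_n) (e `^ a^-1)).
  apply: open_nbhs_nbhs; split; first exact: open_eball.
  by rewrite /eball /= subr0 x0 powR_gt0.
apply: (@filterS _ (nbhs x) (nbhs_filter x) _ _ _ h) => y.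
rewrite /eball /= subr0 => ye; rewrite sub0r normrN ger0_norm ?powR_ge0//.
have -> : e = (e `^ a^-1) `^ a by rewrite -powRrM mulVf ?gt_eqF// powRr1// ltW.
by apply: gt0_ltr_powR => //; rewrite nnegrE ?enorm_ge0 ?powR_ge0.
Qed.

Lemma continuous_inside (D E : set 'rV[R]_n) (u : 'rV[R]_n -> R) : open E -> E `<=` D ->
  {within D, continuous u} -> forall x, E x -> {for x, continuous u}.
Proof.
move=> oE ED cu x Ex; have := continuous_subspaceW ED cu.
by rewrite continuous_open_subspace// => /(_ x); apply; exact: mem_set.
Qed.

End topology_rV.

Section continuity_of_pairs.
Context {T1 T2 V : topologicalType}.
Implicit Types w : T1 * T2.

Lemma continuous_fst_at (f : T1 -> V) w : {for w.1, continuous f} ->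
  {for w, continuous (fun w : T1 * T2 => f w.1)}.
Proof. by move=> cf; apply: (@continuous_comp _ _ _ fst f) => //; exact: cvg_fst. Qed.

Lemma continuous_snd_at (f : T2 -> V) w : {for w.2, continuous f} ->
  {for w, continuous (fun w : T1 * T2 => f w.2)}.
Proof. by move=> cf; apply: (@continuous_comp _ _ _ snd f) => //; exact: cvg_snd. Qed.

Lemma continuous_comp_at (T : topologicalType) (g : T -> T1) (f : T1 -> V) (w : T) :
  {for w, continuous g} -> {for g w, continuous f} -> {for w, continuous (fun y => f (g y))}.
Proof. exact: continuous_comp. Qed.

End continuity_of_pairs.

Section maximum.
Context {R : realType} {n : nat}.
Variables (ga ka th : R).
Hypothesis par : profile_params ga ka th.

Definition doubled (u : 'rV[R]_n -> R) (L m : R) b (w : 'rV[R]_n * 'rV[R]_n) : R :=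
  u w.1 - u w.2 - L * phi ga ka th (enorm (w.1 - w.2)) - m * sqd b w.1.

Lemma continuous_doubled u (L m : R) b w : {for w.1, continuous u} ->
  {for w.2, continuous u} -> {for w, continuous (doubled u L m b)}.
Proof.
move=> c1 c2; have /andP[ga0 _] := profile_ga par; have /andP[th0 _] := profile_th par.
have k1 := continuous_fst_at (T2 := 'rV[R]_n) c1.
have k2 := continuous_snd_at (T1 := 'rV[R]_n) c2.
have kd : {for w, continuous (fun w : 'rV[R]_n * 'rV[R]_n => w.1 - w.2)}.
  have h1 : {for w, continuous (fun w : 'rV[R]_n * 'rV[R]_n => w.1)}.
    exact: (@continuous_fst_at _ _ _ id w (@cvg_id _ _)).
  have h2 : {for w, continuous (fun w : 'rV[R]_n * 'rV[R]_n => w.2)}.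
    exact: (@continuous_snd_at _ _ _ id w (@cvg_id _ _)).
  exact: (continuousB_at h1 h2).
have kp (a : R) : 0 < a ->
    {for w, continuous (fun w : 'rV[R]_n * 'rV[R]_n => enorm (w.1 - w.2) `^ a)}.
  move=> a0; exact: (continuous_comp_at kd (@continuous_enorm_pow R n a a0 _)).
have ks := continuous_fst_at (T2 := 'rV[R]_n) (@continuous_sqd R n b w.1).
have kl : {for w, continuous (fun w : 'rV[R]_n * 'rV[R]_n => L * phi ga ka th (enorm (w.1 - w.2)))}.
  apply: continuousM_at; first exact: continuous_cst_at.
  apply: (@continuousB_at _ _ R); first exact: kp.
  by apply: continuousM_at; [exact: continuous_cst_at|apply: kp; exact: ltr_wpDr].
apply: (@continuousB_at _ _ R); last by apply: continuousM_at => //; exact: continuous_cst_at.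
by apply: (@continuousB_at _ _ R) => //; apply: (@continuousB_at _ _ R).
Qed.

End maximum.

(** * One improvement of the Hoelder exponent *)

Section step.
Context {R : realType} {n : nat}.
Variables (p q s1 s2 alpha C : R) (xi u : 'rV[R]_n -> R).
Variable U : R.
Hypothesis n0 : (0 < n)%N.
Hypothesis mu_ : measurable_fun setT u.
Hypothesis p1 : 1 < p.
Hypothesis pq : p <= q.
Hypothesis s101 : 0 < s1 < 1.
Hypothesis s201 : 0 < s2 < 1.
Hypothesis a01 : 0 < alpha <= 1.
Hypothesis C0 : 0 <= C.
Hypothesis xiH : hoelder_on (eball 0 2) alpha xi.
Hypothesis xi0 : forall x, eball 0 2 x -> 0 <= xi x.
Hypothesis up : Ltail p s1 u.
Hypothesis uq : Ltail q s2 u.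
Hypothesis visc : viscosity_solution p q s1 s2 C xi u (eball 0 2).
Hypothesis ucont : forall x, eball 0 2 x -> {for x, continuous u}.
Hypothesis U0 : 0 <= U.
Hypothesis uU : forall x, eball 0 2 x -> `|u x| <= U.

Lemma doubled_max (ga ka th L m : R) b (rho : R) : profile_params ga ka th ->
  0 <= rho -> closed_eball b rho `<=` eball 0 2 ->
  exists x y, [/\ closed_eball b rho x, closed_eball b rho y &
    forall x' y', closed_eball b rho x' -> closed_eball b rho y' ->
      doubled ga ka th u L m b (x', y') <= doubled ga ka th u L m b (x, y)].
Proof.
move=> par rho0 sub.
have cK : compact (closed_eball b rho `*` closed_eball b rho).
  by apply: compact_setX; exact: compact_closed_eball.
have bb : closed_eball b rho b by rewrite /closed_eball /= subrr enorm0.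
have K0 : (closed_eball b rho `*` closed_eball b rho) !=set0 by exists (b, b).
have cD : {within closed_eball b rho `*` closed_eball b rho,
    continuous (doubled ga ka th u L m b)}.
  apply: continuous_in_subspaceT => w /set_mem[w1 w2].
  by apply: continuous_doubled => //; apply: ucont; exact: sub.
have [[x y] /set_mem[/= hx hy] hmax] := compact_EVT_max K0 cK cD.
exists x, y; split => // x' y' hx' hy'.
by apply: hmax; apply: mem_set.
Qed.

(** If the doubled function is positive somewhere near [(x0, x0)], the constants
    [m] and [L] force its maximum into the interior of the domain and off the
    diagonal, which [no_doubling] excludes. So it is nonpositive, and its value at
    [(x0, y)] is the Hoelder estimate at [x0]. *)
Lemma hoelder_step (ga ka th thp g0 : R) : profile_params ga ka th ->
  0 <= g0 <= 1 -> exponents n p q s1 s2 alpha ga th thp g0 ->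
  (forall rho : R, rho < 2 -> hoelder_on (eball 0 rho) g0 u) ->
  forall rho : R, rho < 2 -> hoelder_on (eball 0 rho) ga u.
Proof.
move=> par g001 ex hg0 rho rho2.
have /andP[ga0 ga1] := profile_ga par; have /andP[th0 _] := profile_th par.
pose d : R := Num.min ((2 - rho) / 4) (1 / 6).
have d0 : 0 < d by rewrite lt_min !divr_gt0// subr_gt0.
have d4 : d <= (2 - rho) / 4 by rewrite ge_min lexx.
have d6 : d <= 1 / 6 by rewrite ge_min lexx orbT.
have d1 : 0 < d <= 1 by rewrite d0/=; lra.
have [K hK] := hg0 (rho + 3 * d) ltac:(lra).
(* at distance [d] from [x0] the localization exceeds the oscillation of [u] *)
pose m := 2 * U / d ^+ 2 + 1.
have dd0 : 0 < d ^+ 2 by rewrite exprn_gt0.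
have q0 : 0 <= 2 * U / d ^+ 2 by rewrite divr_ge0 ?mulr_ge0// ltW.
have m0 : 0 < m by rewrite /m; lra.
have md : 2 * U < m * d ^+ 2.
  have -> : m * d ^+ 2 = 2 * U + d ^+ 2 by rewrite /m; field; rewrite gt_eqF.
  by rewrite ltrDl.
have [L0 L01 noD] := no_doubling n0 mu_ p1 pq s101 s201 a01 C0 xiH xi0 up uq visc par
  m0 d1 U0 (normr_ge0 K) g001 ex.
have dga0 : 0 < (d / 2) `^ ga by rewrite powR_gt0// divr_gt0.
(* the penalty exceeds the oscillation of [u] as soon as [|x - y| >= d / 2] *)
pose L := L0 + 4 * U / (d / 2) `^ ga + 1.
have q1 : 0 <= 4 * U / (d / 2) `^ ga by rewrite divr_ge0 ?mulr_ge0// ltW.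
have L0L : L0 <= L by rewrite /L; lra.
have Lpos : 0 < L by lra.
have Ld : 4 * U < L * (d / 2) `^ ga.
  by rewrite -ltr_pdivrMr// /L; lra.
have claim x0 y0 : enorm x0 < rho -> enorm (x0 - y0) <= 3 * d ->
    u x0 - u y0 <= L * enorm (x0 - y0) `^ ga.
  move=> x0r xy0.
  have sub : closed_eball x0 (3 * d) `<=` eball 0 2.
    move=> z; rewrite /closed_eball /eball /= subr0 => zx.
    have := enormD x0 (z - x0); rewrite addrC subrK => h.
    by move: h zx x0r d4; move: (enorm z) (enorm x0) (enorm (z - x0)) (d) => v1 v2 v3 d'; lra.
  have d30 : 0 <= 3 * d by rewrite mulr_ge0// ltW.
  have [x [y [hx hy hmax]]] := doubled_max L m par d30 sub.
  have [le0|gt0] := leP (doubled ga ka th u L m x0 (x, y)) 0.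
    have h0 : closed_eball x0 (3 * d) x0 by rewrite /closed_eball /= subrr enorm0.
    have hy0 : closed_eball x0 (3 * d) y0 by rewrite /closed_eball /= enormB.
    have := le_trans (hmax x0 y0 h0 hy0) le0; rewrite /doubled /= /sqd subrr enorm0 expr0n /=.
    rewrite mulr0 subr0 subr_le0 => /le_trans; apply.
    by apply: ler_wpM2l; [exact: ltW|exact: phi_le].
  exfalso.
  have ux := uU (sub _ hx); have uy := uU (sub _ hy).
  move: ux uy; rewrite !ler_norml => /andP[ux1 ux2] /andP[uy1 uy2].
  have t0 : 0 < enorm (x - y).
    rewrite lt_neqAle enorm_ge0 andbT eq_sym; apply/negP => /eqP xy.
    have {}xy : x = y by apply/eqP; rewrite -subr_eq0 -enorm_eq0 xy.
    have gt0h : 0 < ga + th by exact: ltr_wpDr.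
    have p0 : phi ga ka th 0 = 0 by rewrite /phi !powR0 ?gt_eqF// mulr0 subrr.
    move: gt0; rewrite /doubled /= xy !subrr enorm0 p0 mulr0 subrr sub0r oppr_gt0.
    by rewrite ltNge mulr_ge0 ?sqr_ge0// ltW.
  have t1 : enorm (x - y) <= 1.
    have := enormD (x - x0) (x0 - y); rewrite addrA subrK.
    move: hx hy; rewrite /closed_eball /= (enormB y) => hx hy.
    by move: hx hy d6; move: (enorm _) (enorm _) (enorm _) (d) => v1 v2 v3 v4; lra.
  have sq0 : 0 <= m * sqd x0 x by rewrite mulr_ge0 ?sqr_ge0 ?(ltW m0).
  have ph := ler_wpM2l (ltW Lpos) (phi_ge par t0 t1).
  have ph0 : 0 <= L * (enorm (x - y) `^ ga / 2) by rewrite mulr_ge0 ?divr_ge0 ?powR_ge0// ltW.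
  have gt0' := gt0; rewrite /doubled /= in gt0'.
  have tc : 2 * enorm (x - y) < d.
    rewrite ltNge; apply/negP => dt.
    have : (d / 2) `^ ga <= enorm (x - y) `^ ga.
      by apply: ler_pow; [exact: ltW|rewrite divr_ge0// ltW|rewrite ler_pdivrMr// mulrC].
    move=> /(ler_wpM2l (ltW Lpos)).
    rewrite mulrA in ph.
    by move: gt0' Ld ph sq0 ux2 uy1; move: (phi _ _ _ _) (L * _ `^ _) (L * (d / 2) `^ ga)
      (m * _) (u x) (u y) => v1 v2 v3 v4 v5 v6; lra.
  have xd : enorm (x - x0) < d.
    rewrite ltNge; apply/negP => dx.
    have : m * d ^+ 2 <= m * sqd x0 x.
      by rewrite ler_wpM2l ?(ltW m0)// /sqd ler_pXn2r// ?nnegrE ?enorm_ge0// ltW.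
    by move: gt0' md ph ph0 ux2 uy1; move: (L * phi _ _ _ _) (L * (_ / _)) (m * d ^+ 2)
      (m * sqd _ _) (u x) (u y) => v1 v2 v3 v4 v5 v6; lra.
  have yd : enorm (y - x0) < 3 / 2 * d.
    have := enormD (y - x) (x - x0); rewrite addrA subrK (enormB y x).
    by move: tc xd; move: (enorm _) (enorm _) (enorm _) (d) => v1 v2 v3 v4; lra.
  have inx z : enorm z < d -> enorm (x + z - x0) <= 2 * d.
    move=> zd; rewrite addrAC; apply: (le_trans (enormD _ _)).
    by move: zd xd; move: (enorm _) (enorm _) (d) => v1 v2 v3; lra.
  have iny z : enorm z < d -> enorm (y + z - x0) <= 5 / 2 * d.
    move=> zd; rewrite addrAC; apply: (le_trans (enormD _ _)).
    by move: zd yd; move: (enorm _) (enorm _) (d) => v1 v2 v3; lra.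
  have inx3 z : enorm z < d -> closed_eball x0 (3 * d) (x + z).
    by move=> /inx h; rewrite /closed_eball /=; move: h d0; move: (enorm _) (d) => v1 v2; lra.
  have iny3 z : enorm z < d -> closed_eball x0 (3 * d) (y + z).
    by move=> /iny h; rewrite /closed_eball /=; move: h d0; move: (enorm _) (d) => v1 v2; lra.
  have inK z : closed_eball x0 (3 * d) z -> eball 0 (rho + 3 * d) z.
    rewrite /closed_eball /eball /= subr0 => zx.
    have := enormD x0 (z - x0); rewrite addrC subrK => h.
    by move: h zx x0r; move: (enorm z) (enorm x0) (enorm (z - x0)) (d) => v1 v2 v3 d'; lra.
  have le2 z : closed_eball x0 (3 * d) z -> enorm z <= 2.
    by move=> /sub; rewrite /eball /= subr0 => /ltW.
  have hoel z z' : closed_eball x0 (3 * d) z -> closed_eball x0 (3 * d) z' ->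
      `|u z - u z'| <= `|K| * enorm (z - z') `^ g0.
    move=> hz hz'; apply: (le_trans (hK z z' (inK _ hz) (inK _ hz'))).
    by apply: ler_wpM2r; [exact: powR_ge0|exact: ler_norm].
  have dbl : doubling u ga ka th m d U g0 `|K| L x0 x y.
    split => //.
    - by move: xd d6; move: (enorm _) (d) => v1 v2; lra.
    - exact: le2.
    - exact: le2.
    - by move=> z zd; apply: uU; apply: sub; exact: inx3.
    - by move=> z zd; apply: uU; apply: sub; exact: iny3.
    - move=> z zd; have := hoel (y + z) y (iny3 _ zd) hy.
      by rewrite (addrC y) addrK.
    - exact: hoel.
    - by move: gt0'; move: (L * _) (m * _) (u x) (u y) => v1 v2 v3 v4; lra.
    - move=> z z' zd zd'; have := hmax (x + z) (y + z') (inx3 _ zd) (iny3 _ zd').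
      by rewrite /doubled /=.
  apply: (noD L x0 x y L0L dbl) => z zd; apply: sub.
  - by rewrite -(subrK x z) addrC; apply: inx3.
  - by rewrite -(subrK y z) addrC; apply: iny3.
exists (L + 2 * U / (3 * d) `^ ga) => x y hx hy.
move: (hx) (hy); rewrite /eball /= !subr0 => xr yr.
have d3 : 0 < (3 * d) `^ ga by rewrite powR_gt0// mulr_gt0.
have k0 : 0 <= 2 * U / (3 * d) `^ ga by rewrite divr_ge0 ?mulr_ge0// ltW.
have [xy|xy] := leP (enorm (x - y)) (3 * d).
  apply: (@le_trans _ _ (L * enorm (x - y) `^ ga)).
    rewrite ler_norml; apply/andP; split; last exact: claim.
    by rewrite lerNl opprB enormB; apply: claim => //; rewrite enormB.
  by apply: ler_wpM2r; [exact: powR_ge0|rewrite lerDl].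
have in2 (z : 'rV[R]_n) : enorm z < rho -> eball 0 2 z by rewrite /eball /= subr0 => /lt_trans; apply.
apply: (@le_trans _ _ (2 * U / (3 * d) `^ ga * enorm (x - y) `^ ga)); last first.
  by apply: ler_wpM2r; [exact: powR_ge0|rewrite lerDr ltW].
apply: (@le_trans _ _ (2 * U / (3 * d) `^ ga * (3 * d) `^ ga)).
  rewrite divfK ?gt_eqF//; apply: (le_trans (ler_normB _ _)).
  by have := uU (in2 _ xr); have := uU (in2 _ yr); lra.
rewrite ler_wpM2l//; apply: ler_pow; [exact: ltW|by rewrite mulr_ge0// ltW|exact: ltW].
Qed.

End step.

(** * Choice of the exponents *)

Section exponent_choices.
Context {R : realType}.
Variables (n : nat) (p q s1 s2 alpha : R).
Hypothesis p1 : 1 < p.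
Hypothesis pq : p <= q.
Hypothesis s101 : 0 < s1 < 1.
Hypothesis s201 : 0 < s2 < 1.
Hypothesis a01 : 0 < alpha <= 1.
Hypothesis gap : s2 * q < p * s1 + alpha.

(** With [ga < 1] the profile is a pure power, and for [g0 = ga] the error
    exponents strictly exceed [ga (p - 1)] and [ga (q - 1)]. So [g0] may be smaller
    by some [g], and as the conditions on [g] weaken when [ga] decreases, the same
    [g] serves for all smaller exponents. *)
Lemma exponents_lt1 (ga g0 g : R) : 0 < ga < 1 -> ga * (p - 1) <= s1 * p ->
  0 <= g0 <= 1 -> 0 <= g -> ga - g <= g0 -> g * q < 1 - ga ->
  g * q < alpha + s1 * p - s2 * q -> exponents n p q s1 s2 alpha ga 0 0 g0.
Proof.
move=> /andP[ga0 ga1] gas /andP[g00 g01] g_0 gg h1 h2.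
have p1' := p1; have pq' := pq; have q1 : 1 < q by exact: lt_le_trans pq.
have mid r : 1 < r -> r <= q -> ga * (r - 1) < mid_exponent r g0 (g0 / (2 * (1 + 0))).
  move=> r1 rq; rewrite /mid_exponent addr0 mulr1; case: (leP 2 r) => r2.
    have k1 : 0 <= (g0 - (ga - g)) * (r - 2) by rewrite mulr_ge0 ?subr_ge0.
    have k2 : g * r <= g * q by rewrite ler_wpM2l.
    move: k1 k2; nra.
  have k1 : 0 < (1 + g0 / 2 - ga) * (r - 1) by rewrite mulr_gt0//; lra.
  move: k1; lra.
have mp := mid p p1 pq; have mq := mid q q1 (lexx _).
rewrite addr0 in mp mq.
split; rewrite ?mul0r ?addr0 ?divr1 ?subr0 //.
- by rewrite divr_ge0.
- lra.
- lra.
- have : s2 * q - ga * (q - 1) <= Num.max 0 (s2 * q - ga * (q - 1)).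
    by rewrite le_max lexx orbT.
  move: (Num.max _ _) (mid_exponent _ _ _) mq => M E mq h; lra.
- have k1 : 0 <= (g0 - (ga - g)) * (q - 1) by rewrite mulr_ge0 ?subr_ge0// ltW.
  have k2 : 0 <= ga * (q - p) by rewrite mulr_ge0 ?subr_ge0// ltW.
  have k3 : g * (q - 1) <= g * q by rewrite ler_wpM2l//; lra.
  nra.
- by have := gap; lra.
Qed.

(** In the limit [g0 = 1], [thp = th = 0] all the inequalities that involve the
    operators hold strictly; [de] is a perturbation of the parameters, small
    against the margins, that makes [th] positive. *)
Lemma exponents_lipschitz : 1 < s1 * p / (p - 1) ->
  exists th thp g0 : R, [/\ 0 < th <= 1, 0 < g0 < 1 &
    exponents n p q s1 s2 alpha 1 th thp g0].
Proof.
move=> sp1.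
have p1' := p1; have pq' := pq; have q1 : 1 < q by exact: lt_le_trans pq.
have /andP[s10 s11] := s101; have /andP[s20 s21] := s201; have /andP[a0 a1] := a01.
pose w := s1 * p - (p - 1).
pose gp := alpha + s1 * p - s2 * q.
have w0 : 0 < w.
  by rewrite subr_gt0; move: sp1; rewrite ltr_pdivlMr ?subr_gt0// mul1r.
have gp0 : 0 < gp by rewrite /gp; have := gap; lra.
pose M := Num.min (Num.min 1 (p - 1)) (Num.min gp w).
have M0 : 0 < M by rewrite !lt_min ltr01 subr_gt0 p1 gp0 w0.
have [M1 Mp Mg Mw] : [/\ M <= 1, M <= p - 1, M <= gp & M <= w].
  by rewrite /M; split; rewrite !ge_min lexx ?orbT.
pose de := M / (8 * q).
have deM : de * q = M / 8 by rewrite /de; field; rewrite gt_eqF//; lra.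
have de0 : 0 < de by rewrite divr_gt0// mulr_gt0//; lra.
have dep : de * p <= de * q by rewrite ler_wpM2l// ltW.
have deq : de <= de * q by rewrite ler_peMr// ltW.
(* the exponents of the inner radius, which limit [th] *)
pose k := Num.min (p - s1 * p) (q - s2 * q).
have k0 : 0 < k by rewrite lt_min; apply/andP; split; nra.
have kp : k <= p - s1 * p by rewrite ge_min lexx.
have kq : k <= q - s2 * q by rewrite ge_min lexx orbT.
have n1 : 1 <= n.+1%:R :> R by rewrite ler1n.
have n0 : 0 < n.+1%:R :> R by rewrite ltr0n.
pose th := de * k / n.+1%:R.
have thn : th * n.+1%:R = de * k by rewrite /th divfK// gt_eqF.
have th0 : 0 < th by rewrite divr_gt0// mulr_gt0.
have thk : th <= de * k by rewrite /th ler_pdivrMr// ler_peMr// mulr_ge0// ltW.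
have dk : de * k <= de * p.
  rewrite ler_wpM2l ?(ltW de0)// (le_trans kp)// lerBlDr lerDl mulr_ge0// ltW//; lra.
have de1 : 0 < 1 + de by lra.
(* dividing by [1 + de] costs at most a factor [1 - de] *)
have dv A : 0 <= A -> A - A * de <= A / (1 + de).
  move=> A0; rewrite ler_pdivlMr//; have : 0 <= A * de ^+ 2 by rewrite mulr_ge0 ?sqr_ge0.
  nra.
pose sg := (1 - de) / (2 * (1 + de)).
have sgE : 1 / 2 - de <= sg.
  rewrite /sg ler_pdivlMr ?mulr_gt0//; have := sqr_ge0 de; nra.
have mid r : p <= r -> r <= q -> r - 1 + de + de * k < mid_exponent r (1 - de) sg.
  move=> pr rq; have der : de * r <= de * q by rewrite ler_wpM2l// ltW.
  rewrite /mid_exponent; case: (leP 2 r) => r2; first nra.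
  have h : (1 / 2 - de) * (r - 1) <= sg * (r - 1) by rewrite ler_wpM2r//; lra.
  nra.
have w1 : w <= 1 by rewrite /w; nra.
exists th, de, (1 - de); split; [lra|lra|].
split; rewrite ?thn ?mul1r -/sg.
- exact: ltW.
- lra.
- by rewrite ler_wpM2l// ltW.
- by rewrite ler_wpM2l// ltW.
- by rewrite -/w; lra.
- rewrite -/w; have := mid p (lexx _) pq; have := dv (w - de * k) ltac:(lra).
  have : (w - de * k) * de <= de.
    by rewrite ler_piMl//; [exact: ltW|]; have : 0 < de * k by [exact: mulr_gt0]; lra.
  move: (mid_exponent _ _ _) ((w - _) / _) ((w - _) * de) => E1 E2 E3.
  rewrite /w; lra.
- set X := s2 * q - (q - 1) - de * k; have := mid q pq (lexx _).
  have X1 : X <= 1 by rewrite /X; have : 0 < de * k by [exact: mulr_gt0]; nra.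
  have : X - de <= Num.max 0 X / (1 + de).
    have mx0 : 0 <= Num.max 0 X by rewrite le_max lexx.
    apply: le_trans (dv _ mx0); apply: lerB; first by rewrite le_max lexx orbT.
    by rewrite ler_piMl ?(ltW de0)// ge_max ler01.
  move: (mid_exponent _ _ _) (Num.max _ _ / _) => E1 E2; rewrite /X; lra.
- rewrite -/w; have := dv (w - de * k) ltac:(lra); have := dv alpha (ltW a0).
  have : (w - de * k) * de <= de.
    by rewrite ler_piMl//; [exact: ltW|]; have : 0 < de * k by [exact: mulr_gt0]; lra.
  have : alpha * de <= de by rewrite ler_piMl// ltW.
  move: ((w - _) / _) ((w - _) * de) (alpha / _) (alpha * de) => E1 E2 E3 E4.
  rewrite (_ : (1 - de) * (q - 1) = q - 1 - (de * q - de)); last by ring.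
  move: Mg dk dep deq deM pq'; rewrite /w /gp.
  move: (de * k) (de * p) (de * q) (s1 * p) (s2 * q) => F1 F2 F3 F4 F5; lra.
- by move: Mg; rewrite /gp; lra.
Qed.

End exponent_choices.

(** * Iteration of the improvement *)

Section bootstrap.
Context {R : realType} {n : nat}.
Variables (p q s1 s2 alpha C : R) (xi u : 'rV[R]_n -> R).
Variable U : R.
Hypothesis n0 : (0 < n)%N.
Hypothesis mu_ : measurable_fun setT u.
Hypothesis p1 : 1 < p.
Hypothesis pq : p <= q.
Hypothesis s101 : 0 < s1 < 1.
Hypothesis s201 : 0 < s2 < 1.
Hypothesis a01 : 0 < alpha <= 1.
Hypothesis C0 : 0 <= C.
Hypothesis xiH : hoelder_on (eball 0 2) alpha xi.
Hypothesis xi0 : forall x, eball 0 2 x -> 0 <= xi x.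
Hypothesis gap : s2 * q < p * s1 + alpha.
Hypothesis up : Ltail p s1 u.
Hypothesis uq : Ltail q s2 u.
Hypothesis visc : viscosity_solution p q s1 s2 C xi u (eball 0 2).
Hypothesis ucont : forall x, eball 0 2 x -> {for x, continuous u}.
Hypothesis U0 : 0 <= U.
Hypothesis uU : forall x, eball 0 2 x -> `|u x| <= U.

Let step := hoelder_step n0 mu_ p1 pq s101 s201 a01 C0 xiH xi0 up uq visc ucont U0 uU.

(** Boundedness is regularity of exponent 0, since [t^0 = 1]; each step raises the
    exponent by the fixed amount [g] until it reaches [ga]. *)
Lemma hoelder_lt1 (ga : R) : 0 < ga < 1 -> ga * (p - 1) <= s1 * p ->
  forall rho : R, rho < 2 -> hoelder_on (eball 0 rho) ga u.
Proof.
move=> /andP[ga0 ga1] gas.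
have p10 : 0 < p - 1 by rewrite subr_gt0.
have q0 : 0 < q by rewrite (lt_le_trans _ pq)// (lt_trans ltr01).
pose g := Num.min (1 - ga) (alpha + s1 * p - s2 * q) / (2 * q).
have gp0 : 0 < alpha + s1 * p - s2 * q.
  by rewrite subr_gt0 addrC (mulrC s1).
have M0 : 0 < Num.min (1 - ga) (alpha + s1 * p - s2 * q) by rewrite lt_min subr_gt0 ga1.
have g0 : 0 < g by rewrite divr_gt0// mulr_gt0.
have gM : g * q < Num.min (1 - ga) (alpha + s1 * p - s2 * q).
  have -> : g * q = Num.min (1 - ga) (alpha + s1 * p - s2 * q) / 2.
    by rewrite /g; field; rewrite gt_eqF.
  by rewrite ltr_pdivrMr// ltr_pMr// ltr1n.
move: gM; rewrite lt_min => /andP[gM1 gM2].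
suff it k : forall rho : R, rho < 2 -> hoelder_on (eball 0 rho) (Num.min ga (g * k%:R)) u.
  have := it (Num.bound (ga / g)); rewrite min_l//.
  have := archi_boundP (divr_ge0 (ltW ga0) (ltW g0)).
  by rewrite ltr_pdivrMr// mulrC => /ltW.
elim: k => [|k IH].
  rewrite mulr0 min_r ?(ltW ga0)// => rho rho2; exists (2 * U) => x y hx hy.
  rewrite powRr0 mulr1; apply: (le_trans (ler_normB _ _)).
  have in2 (z : 'rV[R]_n) : eball 0 rho z -> eball 0 2 z by move=> h; exact: lt_trans h rho2.
  by rewrite mulr2n mulrDl mul1r; apply: lerD; apply: uU; exact: in2.
have m1 : Num.min ga (g * k.+1%:R) <= ga by rewrite ge_min lexx.
have m2 : 0 < Num.min ga (g * k.+1%:R) by rewrite lt_min ga0 mulr_gt0.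
have m3 : Num.min ga (g * k%:R) <= ga by rewrite ge_min lexx.
apply: (step (g0 := Num.min ga (g * k%:R)) (ka := 0) (th := 0) (thp := 0)) => //.
- by left; rewrite m2 (le_lt_trans m1).
- by rewrite le_min (ltW ga0) mulr_ge0 ?(ltW g0)//= (le_trans m3)// ltW.
apply: (@exponents_lt1 _ n p q s1 s2 alpha p1 pq gap _ _ g) => //.
- by rewrite m2 (le_lt_trans m1).
- by apply: le_trans gas; rewrite ler_pM2r.
- by rewrite le_min (ltW ga0) mulr_ge0 ?(ltW g0)//= (le_trans m3)// ltW.
- exact: ltW.
- rewrite le_min !lerBlDr; apply/andP; split.
    by apply: (le_trans m1); rewrite lerDl ltW.
  rewrite (_ : g * k%:R + g = g * k.+1%:R); last by rewrite -natr1; ring.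
  by rewrite ge_min lexx orbT.
- by apply: (lt_le_trans gM1); rewrite lerD2l lerN2.
Qed.

Lemma hoelder_lipschitz : 1 < s1 * p / (p - 1) ->
  forall rho : R, rho < 2 -> hoelder_on (eball 0 rho) 1 u.
Proof.
move=> sp1; have p10 : 0 < p - 1 by rewrite subr_gt0.
have [th [thp [g0 [/andP[th0 th1] /andP[g00 g01] ex]]]] :=
  exponents_lipschitz n p1 pq s101 s201 a01 gap sp1.
apply: (step (g0 := g0) (ka := 1 / 4) _ _ ex).
- by right; split=> //; rewrite th0.
- by rewrite !ltW.
- apply: hoelder_lt1; first by rewrite g00.
  move: sp1; rewrite ltr_pdivlMr// mul1r => h; apply: le_trans (ltW h).
  by rewrite ler_piMl// ltW.
Qed.

End bootstrap.

(** * A Borel version of the solution *)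

Section borel_version.
Context {R : realType} {n : nat}.

(** An open set is the union of the cubes with rational centre and radius
    [1 / (j + 1)] that it contains. *)
Lemma open_measurable_rV (A : set 'rV[R]_n) : open A -> measurable A.
Proof.
move=> oA.
pose rbox (i : 'rV[rat]_n * nat) : set 'rV[R]_n :=
  box (\row_j ratr (i.1 ord0 j)) (i.2.+1%:R^-1).
pose F k : set 'rV[R]_n := if unpickle k is Some i then
  (if `[< rbox i `<=` A >] then rbox i else set0) else set0.
have -> : A = \bigcup_k F k.
  apply/seteqP; split => [x Ax|x [k _]]; last first.
    by rewrite /F; case: unpickle => // i; case: asboolP => // h /h.
  have /nbhs_ballP[e /= e0 eA] : nbhs x A by exact: open_nbhs_nbhs.
  have [j je] : exists j, j.+1%:R^-1 < e / 2 :> R.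
    exists (Num.bound (e / 2)^-1); rewrite invf_plt ?posrE ?divr_gt0//.
    apply: (lt_trans (archi_boundP _)); first by rewrite invr_ge0 divr_ge0// ltW.
    by rewrite ltr_nat.
  have j0 : 0 < j.+1%:R^-1 :> R by rewrite invr_gt0.
  have ex_rat i : exists r : rat, `|x ord0 i - ratr r| <= j.+1%:R^-1.
    have [r] := rat_in_itvoo (ltr_pwDr j0 (lexx (x ord0 i))).
    rewrite in_itv /= => /andP[r1 r2]; exists r.
    by rewrite distrC ger0_norm ?subr_ge0 ?ltW// ltrBlDl.
  pose c : 'rV[rat]_n := \row_i (sval (cid (ex_rat i))).
  have xc : rbox (c, j) x by move=> i; rewrite !mxE /=; exact: svalP (cid (ex_rat i)).
  exists (pickle (c, j)) => //; rewrite /F pickleK.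
  case: asboolP => // -[] y yc; apply: eA; rewrite /ball /=; split => // i k; rewrite !ord1.
  have := xc k; have := yc k; rewrite /= !mxE => h1 h2.
  suff : `|x ord0 k - y ord0 k| < e by [].
  rewrite (_ : x ord0 k - y ord0 k =
    (x ord0 k - ratr (c ord0 k)) - (y ord0 k - ratr (c ord0 k))); last by ring.
  apply: (le_lt_trans (ler_normB _ _)).
  have h1' : `|y ord0 k - ratr (c ord0 k)| <= j.+1%:R^-1 by rewrite mxE.
  have h2' : `|x ord0 k - ratr (c ord0 k)| <= j.+1%:R^-1 by rewrite mxE.
  by apply: (le_lt_trans (lerD h2' h1')); rewrite [X in _ < X]splitr; exact: ltrD.
apply: bigcup_measurable => k _; rewrite /F; case: unpickle => // i.
by case: asboolP => // _; exact: measurable_box.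
Qed.

Lemma measurable_continuous_on (D : set 'rV[R]_n) (u : 'rV[R]_n -> R) : open D ->
  (forall x, D x -> {for x, continuous u}) -> measurable_fun D u.
Proof.
move=> oD cu mD; apply: (measurability _ (RGenOInfty.measurableE R)) => //.
move=> _ [_ [a ->] <-]; apply: open_measurable_rV; rewrite openE => x [Dx ux].
apply: (@filterI _ (nbhs x) (nbhs_filter x)).
  exact: open_nbhs_nbhs.
apply: (cu x Dx); apply: open_nbhs_nbhs; split => //.
Qed.

(** [u] is kept where it is continuous, so that the pointwise notion of viscosity
    solution does not change. *)
Lemma borel_version (D : set 'rV[R]_n) (u : 'rV[R]_n -> R) : open D ->
  (forall x, D x -> {for x, continuous u}) -> Lebesgue_measurable_fun u ->
  exists u' N, [/\ measurable_fun setT u', measurable N, lebesgue_rV R n N = 0%E,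
    forall y, ~ N y -> u' y = u y & forall x, D x -> u' x = u x].
Proof.
move=> oD cu [w mw [N [mN N0 hN]]].
exists (fun x => if x \in D then u x else w x), N; split => //.
- have mD : measurable D by exact: open_measurable_rV.
  apply: (measurable_fun_if (g := u) (h := w)) => //.
  + apply: (measurable_fun_bool true); rewrite setTI.
    rewrite (_ : _ @^-1` _ = D)//.
    by apply/seteqP; split => y /= h; [exact: set_mem|exact: mem_set].
  + rewrite setTI (_ : _ @^-1` _ = D); first exact: measurable_continuous_on.
    by apply/seteqP; split => y /= h; [exact: set_mem|exact: mem_set].
  + by apply: measurable_funTS.
- move=> y Ny; case: ifP => // _; apply/esym/not_notP => h; apply: Ny.
  exact: hN.
- by move=> x Dx; rewrite mem_set.
Qed.

Lemma Ltail_ae (p s : R) (u u' : 'rV[R]_n -> R) (N : set 'rV[R]_n) :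
  measurable_fun setT u' -> measurable N -> lebesgue_rV R n N = 0%E ->
  (forall y, ~ N y -> u' y = u y) -> Ltail p s u -> Ltail p s u'.
Proof.
move=> mu' mN N0 uu' [[_ loc] tail]; split; first split.
- by exists u' => //; exact: aeW.
- move=> K cK; rewrite (integral_ae_eq_fun (D := K) (g := fun x => (`|u x| `^ (p - 1))%:E) mN N0).
    exact: loc.
  by move=> x _ Nx; rewrite uu'.
- rewrite (integral_ae_eq_fun (D := setT)
    (g := fun x => (`|u x| `^ (p - 1) / (1 + enorm x) `^ (n%:R + s * p))%:E) mN N0)//.
  by move=> x _ Nx; rewrite uu'.
Qed.

Lemma viscosity_solution_ae (p q s1 s2 C : R) (xi u u' : 'rV[R]_n -> R)
    (D N : set 'rV[R]_n) :
  measurable N -> lebesgue_rV R n N = 0%E -> (forall y, ~ N y -> u' y = u y) ->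
  (forall x, D x -> u' x = u x) ->
  viscosity_solution p q s1 s2 C xi u D -> viscosity_solution p q s1 s2 C xi u' D.
Proof.
move=> mN N0 uu' uD visc x0 r f r0 rD adm fx.
have xx : eball x0 r x0 by rewrite /eball /= subrr enorm0.
have [h1 h2] := visc x0 r f r0 rD adm (etrans fx (uD x0 (rD x0 xx))).
have E : double_phase p q s1 s2 xi (patch u' (eball x0 r) f) x0 =
    double_phase p q s1 s2 xi (patch u (eball x0 r) f) x0.
  have vw y : ~ N y -> patch u' (eball x0 r) f y = patch u (eball x0 r) f y.
    by move=> Ny; rewrite /patch; case: ifP => // _; exact: uu'.
  have vx : patch u' (eball x0 r) f x0 = patch u (eball x0 r) f x0.
    by rewrite /patch mem_set.
  rewrite /double_phase (frac_plaplacian_ae p s1 mN N0 vw vx).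
  by rewrite (frac_plaplacian_ae q s2 mN N0 vw vx).
by rewrite E; split => h; [apply: h1|apply: h2] => y yr; rewrite -uD; [exact: h|exact: rD|exact: h|exact: rD].
Qed.

End borel_version.

(** * Regularity of viscosity solutions *)

Theorem theorem5p2 (R : realType) (n : nat) (p q s1 s2 alpha C : R)
    (xi u : 'rV[R]_n -> R)
    (hn : (1 <= n)%N)
    (hp : 1 < p) (hpq : p <= q)
    (hs1 : 0 < s1 < 1) (hs2 : 0 < s2 < 1)
    (halpha : 0 < alpha <= 1) (hC : 0 <= C)
    (hxi : hoelder_on (eball 0 2) alpha xi)
    (hxi0 : forall x, eball 0 2 x -> 0 <= xi x)
    (hgap : s2 * q < p * s1 + alpha)
    (hucont : {within closed_eball 0 2, continuous u})
    (hup : Ltail p s1 u) (huq : Ltail q s2 u)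
    (hu : viscosity_solution p q s1 s2 C xi u (eball 0 2)) :
  (forall gamma : R, 0 < gamma -> gamma < gamma_circ p s1 ->
     hoelder_on (eball 0 1) gamma u) /\
  (s1 * p / (p - 1) <> 1 -> hoelder_on (eball 0 1) (gamma_circ p s1) u).
Proof.
have p10 : 0 < p - 1 by rewrite subr_gt0.
have oB : open (eball (0 : 'rV[R]_n) 2) := @open_eball R n 0 2.
have sub2 : eball (0 : 'rV[R]_n) 2 `<=` closed_eball 0 2 by move=> x /ltW.
have cu := continuous_inside oB sub2 hucont.
have [U U0 uU] : exists2 U : R, 0 <= U & forall x, eball 0 2 x -> `|u x| <= U.
  have B0 : closed_eball (0 : 'rV[R]_n) 2 !=set0.
    by exists 0; rewrite /closed_eball /= subrr enorm0.
  have cB := @compact_closed_eball R n 0 2.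
  have [a _ ha] := compact_EVT_max B0 cB hucont.
  have [b _ hb] := compact_EVT_min B0 cB hucont.
  exists (`|u a| + `|u b|) => [|x /sub2 hx]; first exact: addr_ge0.
  have := ha x (mem_set hx); have := hb x (mem_set hx).
  have := ler_norm (u a); have := ler_norm (- u b); rewrite normrN.
  have := normr_ge0 (u a); have := normr_ge0 (u b).
  by rewrite ler_norml => *; apply/andP; split; lra.
have [u' [N [mu' mN N0 uN uB]]] := borel_version oB cu hup.1.1.
have cu' x : eball 0 2 x -> {for x, continuous u'}.
  move=> hx; have nx : nbhs x (eball (0 : 'rV[R]_n) 2) by exact: open_nbhs_nbhs.
  rewrite /prop_for /continuous_at uB// => S /(cu x hx) hS.
  apply: (@filterS2 _ (nbhs x) (nbhs_filter x) _ _ _ _ nx hS) => y hy.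
  by rewrite /= uB.
have uU' x : eball 0 2 x -> `|u' x| <= U by move=> hx; rewrite uB//; exact: uU.
have up' := Ltail_ae mu' mN N0 uN hup.
have uq' := Ltail_ae mu' mN N0 uN huq.
have visc' := viscosity_solution_ae mN N0 uN uB hu.
have back (ga : R) : (forall rho : R, rho < 2 -> hoelder_on (eball 0 rho) ga u') ->
    hoelder_on (eball 0 1) ga u.
  move=> /(_ 1 (ltr1n _ 2)) [K hK]; exists K => x y hx hy.
  have sub1 (z : 'rV[R]_n) : eball 0 1 z -> eball 0 2 z.
    by move=> /lt_trans; apply; rewrite ltr1n.
  by rewrite -uB; [rewrite -(uB y); [exact: hK|exact: sub1]|exact: sub1].
have lt1 (ga : R) : 0 < ga < 1 -> ga * (p - 1) <= s1 * p -> hoelder_on (eball 0 1) ga u.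
  move=> ga01 gas; apply: back.
  exact: (hoelder_lt1 hn mu' hp hpq hs1 hs2 halpha hC hxi hxi0 hgap up' uq' visc' cu' U0 uU').
split.
- move=> ga ga0; rewrite /gamma_circ lt_min => /andP[ga1 gas].
  by apply: lt1; [rewrite ga0|rewrite -ler_pdivlMr// ltW].
- move=> /eqP; rewrite neq_lt => /orP[lt|gt].
  + rewrite /gamma_circ min_r; last exact: ltW.
    apply: lt1; last by rewrite divfK// gt_eqF.
    rewrite lt andbT divr_gt0// mulr_gt0//; first by case/andP: hs1.
    exact: lt_trans hp.
  + rewrite /gamma_circ min_l; last exact: ltW.
    apply: back.
    exact: (hoelder_lipschitz hn mu' hp hpq hs1 hs2 halpha hC hxi hxi0 hgap up' uq' visc' cu' U0 uU').
Qed.
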